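(* Let the standing assumptions listed in the context hold. (Direct part.) Let $(\zeta,q,P)$ and $(\delta,\dot\delta)$ be a sufficiently regular solution of the radial Boussinesq--Abbott system coupled with Newton's equation, with the interior/exterior constraints and the transmission conditions (all written in the context). Then $u:=(\zeta_{\rm e},q_{\rm e})$ and $Z:=(\delta,\dot\delta,\underline{\zeta_{\rm e}},\underline{\dot\zeta_{\rm e}})$ solve the Augmented formulation $$\begin{cases}\partial_t u+\partial_r\widetilde{\mathfrak F}_\kappa[u,Z]=\mathcal S_r(u)+\nu\varepsilon\,\mathcal S_\nu(u) & \text{in }(R,\infty),\\ \partial_t Z+\widetilde{\mathfrak D}(Z,\mathcal I_{\rm hyd}u,F_{\rm ext})=0 & \text{for }t>0,\\ \underline{u_1}=Z_3,\quad \underline{u_2}=-\tfrac R2 Z_2 & \text{at } r=R,\\ u_{|t=0}=(\zeta_{{\rm e}|t=0},q_{{\rm e}|t=0}),\quad Z_{|t=0}=(\delta_{|t=0},\dot\delta_{|t=0},\underline{\zeta_{\rm e}}_{|t=0},\underline{\dot\zeta_{\rm e}}_{|t=0}).\end{cases}$$ (Converse part.) Let $(u,Z)$ be a sufficiently regular solution of the Augmented formulation. Put, for $0\le r\le R$, $$\zeta_{\rm i}=Z_1+\varepsilon^{-1}(h_{\rm i,eq}-1),\qquad q_{\rm i}(r)=-\frac r2 Z_2,$$ $$\frac{P_{\rm i}(r)}{\varepsilon}=\frac{r^2-R^2}{2(1+\varepsilon\zeta_{\rm i})}\Big(\frac{\dot Z_2}{2}-\frac{3\varepsilon|Z_2|^2}{4(1+\varepsilon\zeta_{\rm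 i})}\Big)+Z_3-\underline{\zeta_{\rm i}}+\nu(Z_4-\underline{\dot\zeta_{\rm i}})+\kappa^2(\dot Z_4-\underline{\ddot\zeta_{\rm i}})+\frac\varepsilon2\Big(\frac{|\underline{u_2}|^2}{(1+\varepsilon\underline{u_1})^2}-\frac{|\underline{q_{\rm i}}|^2}{(1+\varepsilon\zeta_{\rm i})^2}\Big).$$ Then $(\delta,\dot\delta,P_{\rm i}):=(Z_1,Z_2,P_{\rm i})$ solves Newton's equation, and $$(\zeta,q,P):=\begin{cases}(u_1,u_2,0)&\text{in }\mathcal E,\\(\zeta_{\rm i},q_{\rm i},P_{\rm i})&\text{in }\mathcal I,\end{cases}$$ solves the radial Boussinesq--Abbott system together with the transmission conditions.
   Context: **Geometry and notation.** $R>0$; $\mathcal I=\{r<R\}$ (ball of radius $R$ in $\mathbb R^2$, under the floating cylinder), $\mathcal E=\mathbb R^2\setminus\mathcal I$, $\Gamma=\{r=R\}$. All functions are axisymmetric without swirl: $\zeta=\zeta(t,r)$, discharge $Q=q(t,r)e_r$. $\mathrm d_r f:=\partial_r f+f/r$. Subscripts $f_{\rm e},f_{\rm i}$ denote restrictions to $\mathcal E,\mathcal I$; $\underline{f_{\rm e}}$, $\underline{f_{\rm i}}$ are the limits at $r=R^+$, $r=R^-$; $\underline f$ denotes the trace at $R^+$ of a function on $(R,\infty)$; $[f]_\Gamma=\underline{f_{\rm e}}-\underline{f_{\rm i}}$. Dots are time derivatives. ''Sufficiently regular'' means that all derivatives, traces and operators below make sense. Formulas containing $1/\varepsilon$ are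 read for $\varepsilon>0$. **Standing assumptions.** $\varepsilon,\nu\in[0,1)$, $\kappa\in(0,1)$ with $\varepsilon(\kappa^2+\nu)\ll1$; $h_{\rm i,eq}$ is a positive constant (flat bottom); initially $\varepsilon\delta+h_{\rm i,eq}>0$; at $t=0$, $\mathrm{div}\,Q=-\dot\delta$ in $\mathcal I$; $F_{\rm ext}$ is bounded and continuous in time; $h$ does not vanish; $m=1-h_{\rm i,eq}$ (Archimedes' principle at equilibrium). **Radial Boussinesq--Abbott system** with $h=1+\varepsilon\zeta$: $$\partial_t\zeta+\mathrm d_r q=0,\qquad (1-\kappa^2\partial_r\mathrm d_r)\partial_t q+\varepsilon\,\mathrm d_r\Big(\frac{q^2}{h}\Big)+h\,\partial_r\zeta=-h\,\partial_r\frac P\varepsilon+\nu h\,\partial_r\frac{\mathrm d_r q}{h},$$ with $P_{\rm e}=0$ in $\mathcal E$ and $h_{\rm i}(t)=h_{\rm i,eq}+\varepsilon\delta(t)$ in $\mathcal I$ (hence $\mathrm{div}\,Q_{\rm i}=-\dot\delta$ and $q_{\rm i}=-\frac r2\dot\delta$). **Newton's equation:** $\tau_{\rm buoy}^2\ddot\delta+\frac m\varepsilon=\frac1{|\mathcal I|}\int_{\mathcal I}\frac{P_{\rm i}}{\varepsilon}\,dx+F_{\rm ext}$, $\tau_{\rm buoy}>0$. **Transmission conditions:** $[q]_\Gamma=0$; $\big[\frac P\varepsilon+\zeta+\nu\dot\zeta+\kappa^2\ddot\zeta+\frac\varepsilon2\frac{q^2}{h^2}\big]_\Gamma=0$; $[\frac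 Qh\times n_\Gamma]_\Gamma=0$ (automatic for axisymmetric flow without swirl). **Operators.** $K_0,K_1$: modified Bessel functions of the second kind. On $(R,\infty)$: $\mathfrak R_0f$ is the solution $w$ of $(1-\kappa^2\partial_r\mathrm d_r)w=f$, $w(R)=0$, $w\to0$ at infinity; $\mathfrak R_1f$ is the solution $v$ of $(1-\kappa^2\mathrm d_r\partial_r)v=f$, $\partial_rv(R)=0$, $v\to0$ at infinity. $G:=\frac R2\frac{K_0(R/\kappa)}{K_1(R/\kappa)}$. For $u=(\zeta,q)$ on $(R,\infty)$, $h=1+\varepsilon\zeta$, $\mathfrak f:=\frac{\zeta^2}{2}+\frac{q^2}{h}$, and $$f_{\rm hyd}:=\mathfrak R_1(\zeta-\nu\,\mathrm d_rq+\varepsilon\mathfrak f)+\varepsilon\kappa^2\mathrm d_r\mathfrak R_0\Big(\frac{q^2}{rh}\Big)+\nu\kappa^2\,\mathrm d_r\mathfrak R_0\big(\partial_r(\ln h)\,\mathrm d_rq\big),\qquad \mathcal I_{\rm hyd}u:=\underline{f_{\rm hyd}}.$$ For $Z=(Z_1,Z_2,Z_3,Z_4)$: $h_{\rm i}=h_{\rm i,eq}+\varepsilon Z_1$, $\underline h=1+\varepsilon Z_3$, $\underline{\mathfrak f}=\frac{Z_3^2}{2}+\frac{R^2Z_2^2}{4\underline h}$, $\tau_\kappa^2(\varepsilon Z_1)=\tau_{\rm buoy}^2+\kappa^2+\frac{R^2}{8h_{\rm i}}$, $a=\frac{R^2}{16h_{\rm i}^2}+\frac{R^2}{8\underline h^2}$,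 and $$\mathcal D=\mathcal D(\mathcal I_{\rm hyd}u,Z,F_{\rm ext}):=\frac{\mathcal I_{\rm hyd}u-\varepsilon\underline{\mathfrak f}-Z_1-\nu Z_2+\varepsilon aZ_2^2+F_{\rm ext}}{\tau_\kappa^2(\varepsilon Z_1)+\kappa G}.$$ Then $$\widetilde{\mathfrak F}_\kappa[u,Z]=\begin{pmatrix}q\\ \mathfrak R_1(\zeta-\nu\,\mathrm d_rq+\varepsilon\mathfrak f)-\mathcal D\,\frac{\kappa R}{2}\frac{K_0(r/\kappa)}{K_1(R/\kappa)}\end{pmatrix},\quad \mathcal S_r(u)=-\begin{pmatrix}q/r\\ \varepsilon\mathfrak R_0\big(\frac{q^2}{rh}\big)\end{pmatrix},\quad \nu\varepsilon\,\mathcal S_\nu(u)=\begin{pmatrix}0\\-\nu\mathfrak R_0\big(\partial_r(\ln h)\,\mathrm d_rq\big)\end{pmatrix},$$ $$-\widetilde{\mathfrak D}(Z,\mathcal I_{\rm hyd}u,F_{\rm ext})=\Big(Z_2,\ \mathcal D,\ Z_4,\ \kappa^{-2}\big(\mathcal I_{\rm hyd}u-\varepsilon\underline{\mathfrak f}-Z_3-\nu Z_4-\kappa G\mathcal D\big)\Big).$$ *)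

(* Defs.v *)
From Stdlib Require Export Reals ClassicalEpsilon.
From Coquelicot Require Export Coquelicot.
Open Scope R_scope.

(* Conventions.  A space-time function is [f : R -> R -> R], written [f t r].
   Only the values for [0 <= t < T] and [0 < r], [r <> Rad], are meaningful:
   [r < Rad] is the interior (under the cylinder), [r > Rad] the exterior.
   Values at [r = Rad] are always replaced by one-sided limits. *)

Record params := Params {
  eps : R;
  nu : R;
  kappa : R;
  Rad : R;
  hieq : R;
  taub : R;
  mass : R }.

(* [eps (kappa^2 + nu) << 1] is represented by its weakest reading, [< 1].
   [eps > 0] because the equations contain [1 / eps]. *)
Definition standing_params (p : params) : Prop :=
  0 < eps p < 1 /\ 0 <= nu p < 1 /\ 0 < kappa p < 1 /\
  eps p * (kappa p ^ 2 + nu p) < 1 /\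
  0 < Rad p /\ 0 < hieq p /\ 0 < taub p /\ mass p = 1 - hieq p.

Definition ex_lim_right (x : R) (f : R -> R) : Prop :=
  exists l : R, filterlim f (at_right x) (locally l).

Definition ex_lim_left (x : R) (f : R -> R) : Prop :=
  exists l : R, filterlim f (at_left x) (locally l).

Definition lim_right (x : R) (f : R -> R) : R :=
  iota (fun l : R => filterlim f (at_right x) (locally l)).

Definition lim_left (x : R) (f : R -> R) : R :=
  iota (fun l : R => filterlim f (at_left x) (locally l)).

Definition no_jump (x : R) (f : R -> R) : Prop :=
  ex_lim_right x f /\ ex_lim_left x f /\ lim_right x f - lim_left x f = 0.

(* Time derivative of a function of [t >= 0]: at [t = 0] it is the limit of the
   derivative as [t -> 0+], so that nothing depends on values at [t < 0]. *)
Definition Dt (f : R -> R) (t : R) : R :=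
  if Rlt_dec 0 t then Derive f t else lim_right 0 (Derive f).

Definition dt (f : R -> R -> R) (t r : R) : R := Dt (fun s => f s r) t.

Definition dr (f : R -> R) (r : R) : R := Derive f r + f r / r.

Definition continuous_on_time (T : Rbar) (f : R -> R) : Prop :=
  forall t : R, 0 <= t -> Rbar_lt t T ->
    filterlim f (within (fun s => 0 <= s) (locally t)) (locally (f t)).

Definition besselK (n x : R) : R :=
  RInt_gen (fun s => exp (- (x * cosh s)) * cosh (n * s))
    (at_point 0) (Rbar_locally p_infty).

Definition K0 : R -> R := besselK 0.
Definition K1 : R -> R := besselK 1.

Definition is_frakR0 (p : params) (f w : R -> R) : Prop :=
  (forall r, Rad p < r ->
     ex_derive w r /\ ex_derive (dr w) r /\
     w r - kappa p ^ 2 * Derive (dr w) r = f r) /\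
  filterlim w (at_right (Rad p)) (locally 0) /\
  is_lim w p_infty 0.

Definition is_frakR1 (p : params) (f v : R -> R) : Prop :=
  (forall r, Rad p < r ->
     ex_derive v r /\ ex_derive (Derive v) r /\
     v r - kappa p ^ 2 * dr (Derive v) r = f r) /\
  filterlim (Derive v) (at_right (Rad p)) (locally 0) /\
  is_lim v p_infty 0.

(* The solution when there is one; it is then unique on [(Rad, +oo)], and its
   values elsewhere are never used. *)
Definition frakR0 (p : params) (f : R -> R) : R -> R :=
  epsilon (inhabits (fun _ : R => 0)) (is_frakR0 p f).

Definition frakR1 (p : params) (f : R -> R) : R -> R :=
  epsilon (inhabits (fun _ : R => 0)) (is_frakR1 p f).

Definition G (p : params) : R :=
  Rad p / 2 * (K0 (Rad p / kappa p) / K1 (Rad p / kappa p)).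

Definition height (p : params) (zeta : R -> R) (r : R) : R :=
  1 + eps p * zeta r.

Definition ff (p : params) (zeta q : R -> R) (r : R) : R :=
  zeta r ^ 2 / 2 + q r ^ 2 / height p zeta r.

Definition src1 (p : params) (zeta q : R -> R) (r : R) : R :=
  zeta r - nu p * dr q r + eps p * ff p zeta q r.

Definition src_r (p : params) (zeta q : R -> R) (r : R) : R :=
  q r ^ 2 / (r * height p zeta r).

Definition src_nu (p : params) (zeta q : R -> R) (r : R) : R :=
  Derive (fun x => ln (height p zeta x)) r * dr q r.

Definition f_hyd (p : params) (zeta q : R -> R) (r : R) : R :=
  frakR1 p (src1 p zeta q) r
  + eps p * kappa p ^ 2 * dr (frakR0 p (src_r p zeta q)) r
  + nu p * kappa p ^ 2 * dr (frakR0 p (src_nu p zeta q)) r.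

Definition I_hyd (p : params) (zeta q : R -> R) : R :=
  lim_right (Rad p) (f_hyd p zeta q).

Record vec4 := Vec4 { Z1 : R; Z2 : R; Z3 : R; Z4 : R }.

Definition hi_of (p : params) (Z : vec4) : R := hieq p + eps p * Z1 Z.
Definition he_of (p : params) (Z : vec4) : R := 1 + eps p * Z3 Z.
Definition ff_of (p : params) (Z : vec4) : R :=
  Z3 Z ^ 2 / 2 + Rad p ^ 2 * Z2 Z ^ 2 / (4 * he_of p Z).
Definition tau2_of (p : params) (Z : vec4) : R :=
  taub p ^ 2 + kappa p ^ 2 + Rad p ^ 2 / (8 * hi_of p Z).
Definition a_of (p : params) (Z : vec4) : R :=
  Rad p ^ 2 / (16 * hi_of p Z ^ 2) + Rad p ^ 2 / (8 * he_of p Z ^ 2).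

Definition DD (p : params) (I : R) (Z : vec4) (F : R) : R :=
  (I - eps p * ff_of p Z - Z1 Z - nu p * Z2 Z + eps p * a_of p Z * Z2 Z ^ 2 + F)
  / (tau2_of p Z + kappa p * G p).

Definition Dtilde (p : params) (Z : vec4) (I F : R) : vec4 :=
  Vec4 (- Z2 Z)
       (- DD p I Z F)
       (- Z4 Z)
       (- (/ kappa p ^ 2 *
           (I - eps p * ff_of p Z - Z3 Z - nu p * Z4 Z
            - kappa p * G p * DD p I Z F))).

Definition Ftilde (p : params) (zeta q : R -> R) (Z : vec4) (F : R) (r : R) : R * R :=
  (q r,
   frakR1 p (src1 p zeta q) r
   - DD p (I_hyd p zeta q) Z F * (kappa p * Rad p / 2)
     * (K0 (r / kappa p) / K1 (Rad p / kappa p))).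

Definition S_r (p : params) (zeta q : R -> R) (r : R) : R * R :=
  (- (q r / r), - (eps p * frakR0 p (src_r p zeta q) r)).

(* The product [nu * eps * S_nu]. *)
Definition nueps_S_nu (p : params) (zeta q : R -> R) (r : R) : R * R :=
  (0, - (nu p * frakR0 p (src_nu p zeta q) r)).

Definition augmented_pde (p : params) (F : R -> R) (u1 u2 : R -> R -> R)
    (Z : R -> vec4) (t r : R) : Prop :=
  let Fl := Ftilde p (u1 t) (u2 t) (Z t) (F t) in
  ex_derive (fun s => u1 s r) t /\ ex_derive (fun s => u2 s r) t /\
  ex_derive (fun x => fst (Fl x)) r /\ ex_derive (fun x => snd (Fl x)) r /\
  dt u1 t r + Derive (fun x => fst (Fl x)) r
    = fst (S_r p (u1 t) (u2 t) r) + fst (nueps_S_nu p (u1 t) (u2 t) r) /\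
  dt u2 t r + Derive (fun x => snd (Fl x)) r
    = snd (S_r p (u1 t) (u2 t) r) + snd (nueps_S_nu p (u1 t) (u2 t) r).

Definition augmented_ode (p : params) (F : R -> R) (u1 u2 : R -> R -> R)
    (Z : R -> vec4) (t : R) : Prop :=
  let D := Dtilde p (Z t) (I_hyd p (u1 t) (u2 t)) (F t) in
  ex_lim_right (Rad p) (f_hyd p (u1 t) (u2 t)) /\
  (ex_derive (fun s => Z1 (Z s)) t /\ Dt (fun s => Z1 (Z s)) t + Z1 D = 0) /\
  (ex_derive (fun s => Z2 (Z s)) t /\ Dt (fun s => Z2 (Z s)) t + Z2 D = 0) /\
  (ex_derive (fun s => Z3 (Z s)) t /\ Dt (fun s => Z3 (Z s)) t + Z3 D = 0) /\
  (ex_derive (fun s => Z4 (Z s)) t /\ Dt (fun s => Z4 (Z s)) t + Z4 D = 0).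

(* Initial data: exterior profiles [zeta0], [q0] and [zetadot0] of [zeta], [q]
   and of the time derivative of [zeta], and the data [delta0], [deltadot0] of
   the solid. *)
Definition augmented (p : params) (T : Rbar) (F : R -> R)
    (zeta0 q0 zetadot0 : R -> R) (delta0 deltadot0 : R)
    (u1 u2 : R -> R -> R) (Z : R -> vec4) : Prop :=
  (forall t r, 0 < t -> Rbar_lt t T -> Rad p < r -> augmented_pde p F u1 u2 Z t r) /\
  (forall t, 0 < t -> Rbar_lt t T -> augmented_ode p F u1 u2 Z t) /\
  (forall t, 0 <= t -> Rbar_lt t T ->
     (ex_lim_right (Rad p) (u1 t) /\ lim_right (Rad p) (u1 t) = Z3 (Z t)) /\
     (ex_lim_right (Rad p) (u2 t) /\
      lim_right (Rad p) (u2 t) = - (Rad p / 2) * Z2 (Z t))) /\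
  (continuous_on_time T (fun t => Z1 (Z t)) /\
   continuous_on_time T (fun t => Z2 (Z t)) /\
   continuous_on_time T (fun t => Z3 (Z t)) /\
   continuous_on_time T (fun t => Z4 (Z t))) /\
  (forall r, Rad p < r -> u1 0 r = zeta0 r /\ u2 0 r = q0 r) /\
  Z 0 = Vec4 delta0 deltadot0 (lim_right (Rad p) zeta0) (lim_right (Rad p) zetadot0).

Definition BA_defined (zeta q P : R -> R -> R) (t r : R) : Prop :=
  ex_derive (fun s => zeta s r) t /\ ex_derive (zeta t) r /\
  ex_derive (q t) r /\ ex_derive (dr (q t)) r /\
  ex_derive (fun s => q s r) t /\
  ex_derive (dt q t) r /\ ex_derive (dr (dt q t)) r /\
  ex_derive (P t) r.

Definition BA_equations (p : params) (zeta q P : R -> R -> R) (t r : R) : Prop :=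
  let h := height p (zeta t) in
  dt zeta t r + dr (q t) r = 0 /\
  dt q t r - kappa p ^ 2 * Derive (dr (dt q t)) r
    + eps p * dr (fun x => q t x ^ 2 / h x) r
    + h r * Derive (zeta t) r
  = - (h r * Derive (fun x => P t x / eps p) r)
    + nu p * h r * Derive (fun x => dr (q t) x / h x) r.

(* The last clause is the continuity at the centre of the vector field [q e_r],
   which the equations in polar coordinates ([r > 0]) do not see. *)
Definition BA_solution (p : params) (T : Rbar) (zeta q P : R -> R -> R)
    (delta : R -> R) : Prop :=
  (forall t r, 0 < t -> Rbar_lt t T -> 0 < r -> r <> Rad p ->
     BA_defined zeta q P t r /\ BA_equations p zeta q P t r) /\
  (forall t r, 0 <= t -> Rbar_lt t T -> Rad p < r -> P t r = 0) /\
  (forall t r, 0 <= t -> Rbar_lt t T -> 0 < r < Rad p ->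
     height p (zeta t) r = hieq p + eps p * delta t) /\
  (forall t, 0 <= t -> Rbar_lt t T -> filterlim (q t) (at_right 0) (locally 0)).

(* Polar coordinates: [f] is the radial profile of an axisymmetric function. *)
Definition disc_int (rho : R) (f : R -> R) : R :=
  RInt (fun _ : R => RInt (fun r => f r * r) 0 rho) 0 (2 * PI).

Definition disc_mean (rho : R) (f : R -> R) : R :=
  / disc_int rho (fun _ => 1) * disc_int rho f.

Definition newton (p : params) (T : Rbar) (F : R -> R)
    (delta deltadot : R -> R) (P : R -> R -> R) : Prop :=
  forall t, 0 < t -> Rbar_lt t T ->
    is_derive delta t (deltadot t) /\ ex_derive deltadot t /\
    ex_RInt (fun r => P t r / eps p * r) 0 (Rad p) /\
    taub p ^ 2 * Dt deltadot t + mass p / eps p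
    = disc_mean (Rad p) (fun r => P t r / eps p) + F t.

(* In the third condition, the normal at the point of angle [theta] of the
   circle is [n = (cos theta, sin theta)] and [Q = q n]. *)
Definition transmission (p : params) (T : Rbar) (zeta q P : R -> R -> R) : Prop :=
  forall t, 0 < t -> Rbar_lt t T ->
    let h := height p (zeta t) in
    no_jump (Rad p) (q t) /\
    no_jump (Rad p)
      (fun r => P t r / eps p + zeta t r + nu p * dt zeta t r
                + kappa p ^ 2 * dt (dt zeta) t r
                + eps p / 2 * (q t r ^ 2 / h r ^ 2)) /\
    forall theta : R,
      no_jump (Rad p)
        (fun r => (q t r * cos theta / h r) * sin theta
                  - (q t r * sin theta / h r) * cos theta).

Definition continuous_up_to_boundary (p : params) (T : Rbar) (f : R -> R -> R) : Prop :=
  exists g : R -> R -> R,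
    (forall t r, 0 <= t -> Rbar_lt t T -> Rad p < r -> f t r = g t r) /\
    (forall t r, 0 <= t -> Rbar_lt t T -> Rad p <= r ->
       filterlim (fun y : R * R => g (fst y) (snd y))
         (within (fun y : R * R => 0 <= fst y /\ Rad p <= snd y) (locally (t, r)))
         (locally (g t r))).

(* Decay is what makes [frakR0] and [frakR1], which act between functions
   vanishing at infinity, invert the elliptic operators on [zeta] and [q]. *)
Definition vanishes_at_infinity (T : Rbar) (f : R -> R -> R) : Prop :=
  forall t : R, 0 <= t -> Rbar_lt t T -> is_lim (f t) p_infty 0.

Definition Dr (f : R -> R -> R) (t r : R) : R := Derive (f t) r.

Definition regular_exterior (p : params) (T : Rbar) (zeta q : R -> R -> R) : Prop :=
  (forall t r, 0 < t -> Rbar_lt t T -> Rad p < r ->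
     ex_derive (fun s => zeta s r) t /\ ex_derive (fun s => dt zeta s r) t /\
     ex_derive (zeta t) r /\
     ex_derive (q t) r /\ ex_derive (Dr q t) r /\
     ex_derive (fun s => q s r) t /\
     ex_derive (dt q t) r /\ ex_derive (Dr (dt q) t) r) /\
  (continuous_up_to_boundary p T zeta /\
   continuous_up_to_boundary p T (dt zeta) /\
   continuous_up_to_boundary p T (dt (dt zeta)) /\
   continuous_up_to_boundary p T (Dr zeta) /\
   continuous_up_to_boundary p T q /\
   continuous_up_to_boundary p T (Dr q) /\
   continuous_up_to_boundary p T (Dr (Dr q)) /\
   continuous_up_to_boundary p T (dt q) /\
   continuous_up_to_boundary p T (Dr (dt q)) /\
   continuous_up_to_boundary p T (Dr (Dr (dt q)))) /\
  (vanishes_at_infinity T zeta /\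
   vanishes_at_infinity T q /\
   vanishes_at_infinity T (Dr q) /\
   vanishes_at_infinity T (dt q)) /\
  (forall t, 0 < t -> Rbar_lt t T ->
     (exists v, is_frakR1 p (src1 p (zeta t) (q t)) v) /\
     (exists w, is_frakR0 p (src_r p (zeta t) (q t)) w) /\
     (exists w, is_frakR0 p (src_nu p (zeta t) (q t)) w)).

(* The total height [h_e] vanishes neither in the exterior nor, as a trace, on
   the contact line. *)
Definition exterior_nonvanishing (p : params) (T : Rbar) (zeta : R -> R -> R) : Prop :=
  forall t : R, 0 <= t -> Rbar_lt t T ->
    (forall r, Rad p < r -> height p (zeta t) r <> 0) /\
    lim_right (Rad p) (height p (zeta t)) <> 0.

Definition interior_nonvanishing (p : params) (T : Rbar) (zeta : R -> R -> R) : Prop :=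
  forall t r : R, 0 <= t -> Rbar_lt t T -> 0 < r < Rad p ->
    height p (zeta t) r <> 0.

Definition standing_force (T : Rbar) (F : R -> R) : Prop :=
  continuous_on_time T F /\
  exists M : R, forall t, 0 <= t -> Rbar_lt t T -> Rabs (F t) <= M.

Definition zeta_int (p : params) (Z : R -> vec4) (t : R) : R :=
  Z1 (Z t) + / eps p * (hieq p - 1).

Definition q_int (Z : R -> vec4) (t r : R) : R := - (r / 2) * Z2 (Z t).

Definition P_int (p : params) (u1 u2 : R -> R -> R) (Z : R -> vec4) (t r : R) : R :=
  let hi := 1 + eps p * zeta_int p Z t in
  eps p *
  ((r ^ 2 - Rad p ^ 2) / (2 * hi)
     * (Dt (fun s => Z2 (Z s)) t / 2 - 3 * eps p * Rabs (Z2 (Z t)) ^ 2 / (4 * hi))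
   + (Z3 (Z t) - zeta_int p Z t)
   + nu p * (Z4 (Z t) - Dt (zeta_int p Z) t)
   + kappa p ^ 2 * (Dt (fun s => Z4 (Z s)) t - Dt (Dt (zeta_int p Z)) t)
   + eps p / 2 *
     (Rabs (lim_right (Rad p) (u2 t)) ^ 2
        / (1 + eps p * lim_right (Rad p) (u1 t)) ^ 2
      - Rabs (q_int Z t (Rad p)) ^ 2 / hi ^ 2)).

Definition glue (rho : R) (f_in f_ex : R -> R -> R) (t r : R) : R :=
  if Rlt_dec r rho then f_in t r else f_ex t r.

(* Main.v *)
Require Import Defs.
From Stdlib Require Import Reals.
From Coquelicot Require Import Coquelicot.
From Stdlib Require Import Lra FunctionalExtensionality.
Open Scope R_scope.

(** Outside the cylinder the pressure vanishes, and the momentum equation can be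
    arranged as the vanishing of
    [(1 - kappa^2 ∂_r d_r) q_t + ∂_r (zeta - nu d_r q + eps f)] plus two source terms
    ([momentum_residual_eq]). Since [∂_r] intertwines
    [1 - kappa^2 d_r ∂_r] and [1 - kappa^2 ∂_r d_r], the equation says exactly that
    [W = q_t + ∂_r R_1(...) + eps R_0(...) + nu R_0(...)] lies in the kernel of
    [1 - kappa^2 ∂_r d_r] ([hydro_combination_helmholtz]). The elements of this kernel
    that decay at infinity are the multiples of [K_1(r/kappa)] and are determined by
    their value at [r = Rad] ([helmholtz_homogeneous]). The boundary conditions in
    [R_0] and [R_1] leave the trace of [q_t] as the value of [W] there; the continuity
    of the discharge makes it [- (Rad/2) delta'']. As [K_0' = - K_1], the equation
    [W = - (Rad/2) delta'' K_1(r/kappa) / K_1(Rad/kappa)] is the second component of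
    the augmented system, provided that [delta''] is the quantity [DD].

    Applying [d_r] to [W] and using [zeta_t = - d_r q] gives
    [f_hyd = kappa^2 zeta_tt + zeta + nu zeta_t + eps f + kappa^2 d_r W], whose trace
    ([exterior_f_hyd_trace]) is the equation for [Z4]: a second-order equation in time
    for the trace of [zeta], with [kappa G delta''] as the contribution of [W].

    Under the cylinder the constraint leaves no freedom: [q = - (r/2) delta'], and the
    momentum equation makes the pressure a parabola in [r], known up to a constant
    that the jump condition fixes. Inserting its mean into Newton's equation, and the
    trace identity into that constant, yields an affine equation for [delta''] whose
    coefficient [tau_kappa^2 + kappa G] is positive; its solution is [DD]
    ([newton_iff_acceleration]). Positivity of the interior height propagates from
    [t = 0] since the height is continuous and does not vanish.

    The converse reads these steps backwards. The augmented equation puts [W] in the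
    kernel, hence the momentum equation holds ([augmented_residual]); the pressure
    [P_int] is the parabola whose constant makes the jump vanish; and with the equation
    for [Z4] in the place of the trace identity, the acceleration [DD] returns Newton's
    equation. The facts on [K_0] and [K_1] come from their integral representation. *)

(** * The modified Bessel functions and their differential equations *)

Definition half_line_integral (f : R -> R) (l : R) : Prop :=
  is_RInt_gen f (at_point 0) (Rbar_locally p_infty) l.

Definition bounded_integrals (f : R -> R) : Prop :=
  exists M, forall b, 0 <= b -> RInt f 0 b <= M.

Lemma ex_RInt_of_continuous (f : R -> R) (a b : R) :
  (forall s, continuous f s) -> ex_RInt f a b.
Proof.
  intros Hf. apply (@ex_RInt_continuous R_CompleteNormedModule).
  intros z _. apply Hf.
Qed.

(** Monotone convergence: the integrals over [[0, b]] increase with [b], so they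
    converge to their supremum. *)
Lemma half_line_integral_exists (f : R -> R) :
  (forall s, continuous f s) -> (forall s, 0 <= s -> 0 <= f s) ->
  bounded_integrals f -> exists l, half_line_integral f l.
Proof.
  intros Hc Hpos [M HM].
  assert (Hmono : forall a b, 0 <= a <= b -> RInt f 0 a <= RInt f 0 b).
  { intros a b Hab.
    rewrite <- (RInt_Chasles f 0 a b) by now apply ex_RInt_of_continuous.
    unfold plus; simpl.
    enough (0 <= RInt f a b) by lra.
    apply RInt_ge_0; [lra | now apply ex_RInt_of_continuous |].
    intros x Hx; apply Hpos; lra. }
  destruct (completeness (fun y => exists b, 0 <= b /\ y = RInt f 0 b))
    as [l [Hub Hlub]].
  { exists M. intros y [b [Hb ->]]. now apply HM. }
  { exists (RInt f 0 0), 0. split; [lra | reflexivity]. }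
  exists l. unfold half_line_integral, is_RInt_gen.
  apply filterlimi_locally. intros e.
  assert (Hnear : exists b0, 0 <= b0 /\ l - e < RInt f 0 b0).
  { apply Classical_Prop.NNPP. intros Hno.
    assert (l <= l - e); [| destruct e as [e He]; simpl in *; lra].
    apply Hlub. intros y [b [Hb ->]].
    destruct (Rle_lt_dec (RInt f 0 b) (l - e)) as [H | H]; [exact H |].
    exfalso; apply Hno. now exists b. }
  destruct Hnear as [b0 [Hb0 Hl]].
  exists (fun a => a = 0) (fun b => b0 < b).
  - reflexivity.
  - exists b0. intros x Hx; exact Hx.
  - intros a b -> Hb. exists (RInt f 0 b). split.
    + apply (@RInt_correct R_CompleteNormedModule). now apply ex_RInt_of_continuous.
    + assert (RInt f 0 b <= l) by (apply Hub; exists b; split; [lra | reflexivity]).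
      assert (RInt f 0 b0 <= RInt f 0 b) by (apply Hmono; lra).
      unfold ball; simpl; unfold AbsRing_ball, abs, minus, plus, opp; simpl.
      apply Rabs_def1; lra.
Qed.

Lemma half_line_integral_abs_le (f g : R -> R) (lf lg : R) :
  (forall s, 0 <= s -> Rabs (f s) <= g s) ->
  half_line_integral f lf -> half_line_integral g lg -> Rabs lf <= lg.
Proof.
  intros Hfg Hf Hg.
  apply (RInt_gen_norm (V := R_CompleteNormedModule)
           (Fa := at_point 0) (Fb := Rbar_locally p_infty) f g lf lg); trivial.
  - exists (fun a => a = 0) (fun b => 0 < b).
    + reflexivity.
    + exists 0. intros x Hx; exact Hx.
    + intros x y -> Hy; simpl; lra.
  - exists (fun a => a = 0) (fun b => 0 < b).
    + reflexivity.
    + exists 0. intros x Hx; exact Hx.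
    + intros x y -> Hy z Hz; simpl in *. apply Hfg; lra.
Qed.

Lemma half_line_integral_unique (f : R -> R) (l : R) :
  half_line_integral f l -> RInt_gen f (at_point 0) (Rbar_locally p_infty) = l.
Proof.
  intros Hf.
  exact (is_RInt_gen_unique (V := R_CompleteNormedModule)
           (Fa := at_point 0) (Fb := Rbar_locally p_infty) f l Hf).
Qed.

Lemma half_line_integral_ext (f g : R -> R) (l : R) :
  (forall s, f s = g s) -> half_line_integral f l -> half_line_integral g l.
Proof.
  intros Hfg Hf. replace g with f; [exact Hf |].
  now apply functional_extensionality.
Qed.

Lemma half_line_integral_plus (f g : R -> R) (lf lg : R) :
  half_line_integral f lf -> half_line_integral g lg ->
  half_line_integral (fun s => f s + g s) (lf + lg).
Proof.
  intros Hf Hg.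
  exact (is_RInt_gen_plus (V := R_NormedModule) (Fa := at_point 0)
           (Fb := Rbar_locally p_infty) f g lf lg Hf Hg).
Qed.

Lemma half_line_integral_minus (f g : R -> R) (lf lg : R) :
  half_line_integral f lf -> half_line_integral g lg ->
  half_line_integral (fun s => f s - g s) (lf - lg).
Proof.
  intros Hf Hg.
  exact (is_RInt_gen_minus (V := R_NormedModule) (Fa := at_point 0)
           (Fb := Rbar_locally p_infty) f g lf lg Hf Hg).
Qed.

Lemma half_line_integral_scal (f : R -> R) (a l : R) :
  half_line_integral f l -> half_line_integral (fun s => a * f s) (a * l).
Proof.
  intros Hf.
  exact (is_RInt_gen_scal (V := R_NormedModule) (Fa := at_point 0)
           (Fb := Rbar_locally p_infty) f a l Hf).
Qed.

Definition cosh_weight (k : nat) (x s : R) : R := cosh s ^ k * exp (- (x * cosh s)).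

(** [K0] and [K1] are the moments of order 0 and 1. The whole family is considered
    because differentiation in [x] raises the order. *)
Definition cosh_moment (k : nat) (x : R) : R :=
  RInt_gen (cosh_weight k x) (at_point 0) (Rbar_locally p_infty).

Lemma cosh_ge_id (s : R) : 0 <= s -> 1 <= cosh s /\ s <= cosh s.
Proof.
  intros Hs. unfold cosh.
  assert (H1 : exp s * exp (- s) = 1) by (rewrite <- exp_plus, Rplus_opp_r; apply exp_0).
  assert (H2 : 0 < exp s) by apply exp_pos.
  assert (H3 : 0 < exp (- s)) by apply exp_pos.
  split; [generalize (pow2_ge_0 (exp s - 1)); nra |].
  assert (H4 : 1 + s / 2 <= exp (s / 2)).
  { destruct (Req_dec s 0) as [-> | Hn].
    - replace (0 / 2) with 0 by field. rewrite exp_0; lra.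
    - left; apply exp_ineq1; lra. }
  assert (H5 : exp s = exp (s / 2) * exp (s / 2))
    by (rewrite <- exp_plus; f_equal; field).
  generalize (pow2_ge_0 (1 - s / 2)). nra.
Qed.

Lemma cosh_weight_continuous (k : nat) (x s : R) : continuous (cosh_weight k x) s.
Proof.
  apply (ex_derive_continuous (V := R_NormedModule)).
  unfold cosh_weight, cosh. auto_derive. trivial.
Qed.

Lemma cosh_weight_pos (k : nat) (x s : R) : 0 <= s -> 0 < cosh_weight k x s.
Proof.
  intros Hs. destruct (cosh_ge_id s Hs).
  apply Rmult_lt_0_compat; [apply pow_lt; lra | apply exp_pos].
Qed.

(** Half of the exponential absorbs one factor [cosh s], since
    [c * exp (- x c / 2) <= 2 / x]. Iterated, this reduces the integrability of every
    weight to that of [exp (- x s)]. *)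
Lemma cosh_weight_step (k : nat) (x s : R) : 0 < x -> 0 <= s ->
  cosh_weight (S k) x s <= 2 / x * cosh_weight k (x / 2) s.
Proof.
  intros Hx Hs. unfold cosh_weight. destruct (cosh_ge_id s Hs) as [Hc _].
  set (c := cosh s) in *.
  replace (exp (- (x * c))) with (exp (- (x / 2 * c)) * exp (- (x / 2 * c)))
    by (rewrite <- exp_plus; f_equal; field).
  set (e := exp (- (x / 2 * c))).
  assert (He : 0 < e) by apply exp_pos.
  assert (Hce : c * e <= 2 / x).
  { assert (H1 : e * exp (x / 2 * c) = 1)
      by (unfold e; rewrite <- exp_plus, Rplus_opp_l; apply exp_0).
    assert (H2 : 1 + x / 2 * c < exp (x / 2 * c)) by (apply exp_ineq1; nra).
    apply Rmult_le_reg_l with (x / 2); [lra |].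
    replace (x / 2 * (2 / x)) with 1 by (field; lra).
    nra. }
  assert (0 < c ^ k) by (apply pow_lt; lra).
  simpl. replace (c * c ^ k * (e * e)) with (c * e * (c ^ k * e)) by ring.
  apply Rmult_le_compat_r; [nra | exact Hce].
Qed.

Lemma bounded_integrals_le (f g : R -> R) (a : R) :
  (forall s, continuous f s) -> (forall s, continuous g s) -> 0 < a ->
  (forall s, 0 <= s -> f s <= a * g s) -> bounded_integrals g -> bounded_integrals f.
Proof.
  intros Hf Hg Ha Hfg [M HM]. exists (a * M). intros b Hb.
  apply Rle_trans with (a * RInt g 0 b).
  - replace (a * RInt g 0 b) with (RInt (fun s => a * g s) 0 b).
    + apply RInt_le; [exact Hb | now apply ex_RInt_of_continuous | |].
      * apply ex_RInt_of_continuous. intros s.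
        apply (continuous_scal_r a g s (Hg s)).
      * intros s Hs; apply Hfg; lra.
    + apply (RInt_scal g 0 b a). now apply ex_RInt_of_continuous.
  - apply Rmult_le_compat_l; [lra | now apply HM].
Qed.

Lemma cosh_weight_bounded_integrals (k : nat) (x : R) :
  0 < x -> bounded_integrals (cosh_weight k x).
Proof.
  revert x; induction k as [| k IHk]; intros x Hx.
  - apply bounded_integrals_le with (g := fun s => exp (- (x * s))) (a := 1).
    + apply cosh_weight_continuous.
    + intros s. apply (ex_derive_continuous (V := R_NormedModule)).
      auto_derive; trivial.
    + lra.
    + intros s Hs. unfold cosh_weight. simpl. rewrite !Rmult_1_l.
      destruct (cosh_ge_id s Hs) as [_ Hc].
      destruct (Req_dec s (cosh s)) as [<- | Hn]; [lra |].
      left; apply exp_increasing; nra.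
    + exists (/ x). intros b Hb.
      rewrite (is_RInt_unique (V := R_CompleteNormedModule) (fun s => exp (- (x * s))) 0 b
                 (minus (- exp (- (x * b)) / x) (- exp (- (x * 0)) / x))).
      * unfold minus, plus, opp; simpl.
        rewrite Rmult_0_r, Ropp_0, exp_0.
        assert (0 < exp (- (x * b)) / x)
          by (apply Rdiv_lt_0_compat; [apply exp_pos | exact Hx]).
        unfold Rdiv in *. lra.
      * apply (is_RInt_derive (V := R_CompleteNormedModule) (fun s => - exp (- (x * s)) / x)).
        -- intros s _. auto_derive; [trivial | field; lra].
        -- intros s _. apply (ex_derive_continuous (V := R_NormedModule)).
           auto_derive; trivial.
  - apply bounded_integrals_le with (g := cosh_weight k (x / 2)) (a := 2 / x).
    + apply cosh_weight_continuous.
    + apply cosh_weight_continuous.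
    + apply Rdiv_lt_0_compat; lra.
    + intros s Hs. now apply cosh_weight_step.
    + apply IHk; lra.
Qed.

Lemma cosh_moment_integral (k : nat) (x : R) :
  0 < x -> half_line_integral (cosh_weight k x) (cosh_moment k x).
Proof.
  intros Hx.
  destruct (half_line_integral_exists (cosh_weight k x)) as [l Hl].
  - apply cosh_weight_continuous.
  - intros s Hs; left; now apply cosh_weight_pos.
  - now apply cosh_weight_bounded_integrals.
  - unfold cosh_moment. rewrite (half_line_integral_unique _ _ Hl). exact Hl.
Qed.

(** A Taylor bound made to be integrated: the exponential in the remainder is
    taken at a point [m] below [u] and [v], so that it can be chosen independent of
    [v]. *)
Lemma exp_neg_taylor (u v m : R) : m <= u -> m <= v ->
  Rabs (exp (- v) - exp (- u) + (v - u) * exp (- u)) <= (v - u) ^ 2 * exp (- m).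
Proof.
  intros Hu Hv.
  assert (exp_ge : forall t, 1 + t <= exp t).
  { intros t. destruct (Req_dec t 0) as [-> | Hn];
      [rewrite exp_0; lra | left; now apply exp_ineq1]. }
  assert (exp_le : forall s t, s <= t -> exp s <= exp t).
  { intros s t [H | ->]; [left; now apply exp_increasing | lra]. }
  assert (Hmu : exp (- u) <= exp (- m)) by (apply exp_le; lra).
  assert (Hmv : exp (- v) <= exp (- m)) by (apply exp_le; lra).
  assert (Hpu : 0 < exp (- u)) by apply exp_pos.
  assert (Hpv : 0 < exp (- v)) by apply exp_pos.
  assert (Hvu : exp (- v) = exp (- (v - u)) * exp (- u))
    by (rewrite <- exp_plus; f_equal; ring).
  assert (H1 := exp_ge (- (v - u))). assert (H2 := exp_ge (v - u)).
  assert (H3 : exp (- (v - u)) * exp (v - u) = 1)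
    by (rewrite <- exp_plus, Rplus_opp_l; apply exp_0).
  set (d := v - u) in *. set (a := exp (- d)) in *. set (b := exp (- u)) in *.
  assert (Ha : 0 < a) by apply exp_pos.
  rewrite Rabs_pos_eq by nra.
  destruct (Rle_lt_dec 0 d) as [Hd | Hd].
  - apply Rle_trans with (d ^ 2 * b); [| apply Rmult_le_compat_l; [apply pow2_ge_0 | exact Hmu]].
    assert (a * (1 + d) <= 1) by nra.
    assert (a <= 1 - d + d ^ 2).
    { apply Rmult_le_reg_r with (1 + d); [lra |].
      replace ((1 - d + d ^ 2) * (1 + d)) with (1 + d ^ 3) by ring.
      assert (0 <= d ^ 3) by (apply pow_le; lra). lra. }
    rewrite Hvu. replace (a * b - b + d * b) with ((a - 1 + d) * b) by ring.
    apply Rmult_le_compat_r; lra.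
  - apply Rle_trans with (d ^ 2 * exp (- v)); [| apply Rmult_le_compat_l; [apply pow2_ge_0 | exact Hmv]].
    assert (1 >= (1 + d) * a) by nra.
    rewrite Hvu. replace (a * b - b + d * b) with ((a - 1 + d) * b) by ring.
    replace (d ^ 2 * (a * b)) with ((d ^ 2 * a) * b) by ring.
    apply Rmult_le_compat_r; nra.
Qed.

(** Reduces differentiation under the integral sign to a comparison of integrals. *)
Lemma is_derive_of_quadratic_bound (f : R -> R) (x l C eta : R) : 0 < eta ->
  (forall y, Rabs (y - x) < eta -> Rabs (f y - f x - (y - x) * l) <= C * (y - x) ^ 2) ->
  is_derive f x l.
Proof.
  intros Heta Hf. apply is_derive_Reals. intros e He.
  assert (HC : 0 < Rabs C + 1) by (generalize (Rabs_pos C); lra).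
  assert (Hd : 0 < Rmin eta (e / (Rabs C + 1)))
    by (apply Rmin_pos; [exact Heta | now apply Rdiv_lt_0_compat]).
  exists (mkposreal _ Hd). simpl. intros h Hh Hhd.
  assert (H1 : Rabs h < eta) by (eapply Rlt_le_trans; [exact Hhd | apply Rmin_l]).
  assert (H2 : Rabs h < e / (Rabs C + 1))
    by (eapply Rlt_le_trans; [exact Hhd | apply Rmin_r]).
  assert (H3 := Hf (x + h)). replace (x + h - x) with h in H3 by ring.
  specialize (H3 H1).
  assert (Hh0 : 0 < Rabs h) by now apply Rabs_pos_lt.
  replace ((f (x + h) - f x) / h - l) with ((f (x + h) - f x - h * l) / h) by (field; exact Hh).
  unfold Rdiv. rewrite Rabs_mult, Rabs_inv.
  apply Rmult_lt_reg_r with (Rabs h); [exact Hh0 |].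
  rewrite Rmult_assoc, Rinv_l, Rmult_1_r by lra.
  apply Rle_lt_trans with (1 := H3).
  rewrite <- (pow2_abs h).
  assert (H4 : Rabs h * (Rabs C + 1) < e).
  { apply (Rmult_lt_compat_r (Rabs C + 1)) in H2; [| exact HC].
    unfold Rdiv in H2. rewrite Rmult_assoc, Rinv_l, Rmult_1_r in H2 by lra. exact H2. }
  assert (H5 := Rle_abs C).
  apply Rle_lt_trans with ((Rabs h * (Rabs C + 1)) * Rabs h); [nra |].
  now apply Rmult_lt_compat_r.
Qed.

Lemma cosh_weight_taylor (k : nat) (x y s : R) : Rabs (y - x) < x / 2 -> 0 <= s ->
  Rabs (cosh_weight k y s - cosh_weight k x s + (y - x) * cosh_weight (S k) x s)
  <= (y - x) ^ 2 * cosh_weight (S (S k)) (x / 2) s.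
Proof.
  intros Hxy Hs. apply Rabs_def2 in Hxy. destruct (cosh_ge_id s Hs) as [Hc _].
  unfold cosh_weight. set (c := cosh s) in *.
  change (c ^ S (S k)) with (c * (c * c ^ k)). change (c ^ S k) with (c * c ^ k).
  assert (Hck : 0 < c ^ k) by (apply pow_lt; lra).
  replace (c ^ k * exp (- (y * c)) - c ^ k * exp (- (x * c))
           + (y - x) * (c * c ^ k * exp (- (x * c))))
    with (c ^ k * (exp (- (y * c)) - exp (- (x * c)) + (y * c - x * c) * exp (- (x * c))))
    by ring.
  rewrite Rabs_mult, (Rabs_pos_eq (c ^ k)) by lra.
  replace ((y - x) ^ 2 * (c * (c * c ^ k) * exp (- (x / 2 * c))))
    with (c ^ k * ((y * c - x * c) ^ 2 * exp (- (x / 2 * c)))) by ring.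
  apply Rmult_le_compat_l; [lra |].
  apply exp_neg_taylor; nra.
Qed.

(** Integrating [cosh_weight_taylor] over the half-line bounds the remainder by
    [(y - x)^2] times the moment of order [k + 2] at [x / 2]. *)
Lemma is_derive_cosh_moment (k : nat) (x : R) :
  0 < x -> is_derive (cosh_moment k) x (- cosh_moment (S k) x).
Proof.
  intros Hx.
  apply is_derive_of_quadratic_bound
    with (C := cosh_moment (S (S k)) (x / 2)) (eta := x / 2); [lra |].
  intros y Hy. assert (Hy' := Rabs_def2 _ _ Hy).
  apply half_line_integral_abs_le with
    (f := fun s => cosh_weight k y s - cosh_weight k x s + (y - x) * cosh_weight (S k) x s)
    (g := fun s => (y - x) ^ 2 * cosh_weight (S (S k)) (x / 2) s).
  - intros s Hs. now apply cosh_weight_taylor.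
  - replace (cosh_moment k y - cosh_moment k x - (y - x) * - cosh_moment (S k) x)
      with (cosh_moment k y - cosh_moment k x + (y - x) * cosh_moment (S k) x) by ring.
    apply half_line_integral_plus.
    + apply half_line_integral_minus; apply cosh_moment_integral; lra.
    + apply half_line_integral_scal; apply cosh_moment_integral; lra.
  - rewrite Rmult_comm. apply half_line_integral_scal.
    apply cosh_moment_integral; lra.
Qed.

(** The source of the strict positivity of the moments. *)
Lemma RInt_le_half_line_integral (f : R -> R) (l b : R) :
  (forall s, continuous f s) -> (forall s, 0 <= s -> 0 <= f s) ->
  half_line_integral f l -> 0 <= b -> RInt f 0 b <= l.
Proof.
  intros Hc Hpos Hf Hb. apply Rnot_lt_le. intros Hlt.
  assert (He : 0 < RInt f 0 b - l) by lra.
  unfold half_line_integral, is_RInt_gen in Hf.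
  apply (proj1 (filterlimi_locally _ _)) with (eps := mkposreal _ He) in Hf.
  destruct Hf as [Q1 Q2 HQ1 [M HM] HQ].
  assert (H1 := Rmax_l M b). assert (H2 := Rmax_r M b). set (b' := Rmax M b + 1) in *.
  destruct (HQ 0 b' HQ1 (HM b' ltac:(unfold b'; lra))) as [z [Hz Hball]].
  simpl in Hz.
  apply (is_RInt_unique (V := R_CompleteNormedModule)) in Hz.
  unfold ball in Hball; simpl in Hball.
  unfold AbsRing_ball, abs, minus, plus, opp in Hball; simpl in Hball.
  apply Rabs_def2 in Hball.
  rewrite <- (RInt_Chasles f 0 b b') in Hz by now apply ex_RInt_of_continuous.
  unfold plus in Hz; simpl in Hz.
  assert (0 <= RInt f b b').
  { apply RInt_ge_0; [unfold b'; lra | now apply ex_RInt_of_continuous |].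
    intros x Hx; apply Hpos; lra. }
  lra.
Qed.

Lemma cosh_moment_pos (k : nat) (x : R) : 0 < x -> 0 < cosh_moment k x.
Proof.
  intros Hx. apply Rlt_le_trans with (RInt (cosh_weight k x) 0 1).
  - apply RInt_gt_0; [lra | | intros; apply cosh_weight_continuous].
    intros s Hs; apply cosh_weight_pos; lra.
  - apply RInt_le_half_line_integral; [apply cosh_weight_continuous | | | lra].
    + intros s Hs; left; now apply cosh_weight_pos.
    + now apply cosh_moment_integral.
Qed.

(** [cosh s >= 1], so that [exp (- x cosh s) <= exp (1 - x) * exp (- cosh s)]. *)
Lemma cosh_moment_le (k : nat) (x : R) : 1 <= x ->
  cosh_moment k x <= exp (1 - x) * cosh_moment k 1.
Proof.
  intros Hx. eapply Rle_trans; [apply Rle_abs |].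
  apply half_line_integral_abs_le with
    (f := cosh_weight k x) (g := fun s => exp (1 - x) * cosh_weight k 1 s).
  - intros s Hs. rewrite Rabs_pos_eq by (left; now apply cosh_weight_pos).
    unfold cosh_weight. destruct (cosh_ge_id s Hs) as [Hc _].
    assert (0 < cosh s ^ k) by (apply pow_lt; lra).
    replace (exp (1 - x) * (cosh s ^ k * exp (- (1 * cosh s))))
      with (cosh s ^ k * (exp (1 - x) * exp (- (1 * cosh s)))) by ring.
    apply Rmult_le_compat_l; [lra |]. rewrite <- exp_plus.
    destruct (Req_dec (- (x * cosh s)) (1 - x + - (1 * cosh s))) as [-> | Hn]; [lra |].
    left; apply exp_increasing; nra.
  - apply cosh_moment_integral; lra.
  - apply (half_line_integral_scal _ (exp (1 - x))).
    apply cosh_moment_integral; lra.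
Qed.

(** Integration by parts: [sinh s * exp (- x cosh s)] vanishes at both ends of the
    half-line, and [cosh^2 = 1 + sinh^2]. Read as [K0'' = K0 - K0' / x], this is the
    modified Bessel equation of order 0. *)
Lemma cosh_moment_recurrence (x : R) : 0 < x ->
  cosh_moment 2 x = cosh_moment 0 x + cosh_moment 1 x / x.
Proof.
  intros Hx.
  set (prim := fun s => - (sinh s * exp (- (x * cosh s)))).
  assert (Hprim : forall s, is_derive prim s
            (x * cosh_weight 2 x s - x * cosh_weight 0 x s - cosh_weight 1 x s)).
  { intros s. unfold prim, cosh_weight.
    auto_derive.
    - trivial.
    -       replace (cosh s ^ 2) with (1 + sinh s * sinh s).
      + ring.
      + unfold cosh, sinh.
        assert (H1 : exp s * exp (- s) = 1)
          by (rewrite <- exp_plus, Rplus_opp_r; apply exp_0).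
        nra. }
  (* [cosh_weight 2 x <= 8 / x^2] by two uses of [cosh_weight_step], and
     [Rabs (prim s) * s <= cosh_weight 2 x s] *)
  assert (Hbound : forall s, 0 < s -> Rabs (prim s) <= 8 / x ^ 2 / s).
  { intros s Hs. destruct (cosh_ge_id s (Rlt_le _ _ Hs)) as [Hc1 Hcs].
    assert (Hsinh : Rabs (sinh s) <= cosh s).
    { unfold sinh, cosh. assert (0 < exp s) by apply exp_pos.
      assert (0 < exp (- s)) by apply exp_pos. apply Rabs_le; lra. }
    assert (H2 := cosh_weight_step 1 x s Hx (Rlt_le _ _ Hs)).
    assert (H1 := cosh_weight_step 0 (x / 2) s ltac:(lra) (Rlt_le _ _ Hs)).
    assert (H0 : cosh_weight 0 (x / 2 / 2) s <= 1).
    { unfold cosh_weight. rewrite <- exp_0. simpl. rewrite Rmult_1_l.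
      left. apply exp_increasing. nra. }
    assert (Hw : cosh_weight 2 x s <= 8 / x ^ 2).
    { replace (8 / x ^ 2) with (2 / x * (2 / (x / 2) * 1)) by (field; lra).
      apply Rle_trans with (1 := H2). apply Rmult_le_compat_l; [left; apply Rdiv_lt_0_compat; lra |].
      apply Rle_trans with (1 := H1). apply Rmult_le_compat_l; [| exact H0].
      left; apply Rdiv_lt_0_compat; lra. }
    unfold prim. rewrite Rabs_Ropp, Rabs_mult.
    assert (He := exp_pos (- (x * cosh s))). rewrite (Rabs_pos_eq (exp _)) by lra.
    apply Rmult_le_reg_r with s; [exact Hs |].
    replace (8 / x ^ 2 / s * s) with (8 / x ^ 2) by (field; lra).
    apply Rle_trans with (2 := Hw). unfold cosh_weight.
    replace (Rabs (sinh s) * exp (- (x * cosh s)) * s)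
      with (Rabs (sinh s) * s * exp (- (x * cosh s))) by ring.
    apply Rmult_le_compat_r; [lra |]. generalize (Rabs_pos (sinh s)). nra. }
  assert (Hlim : filterlim prim (Rbar_locally p_infty) (locally 0)).
  { apply filterlim_locally. intros e.
    exists (Rmax 1 (8 / x ^ 2 / e)). intros s Hs.
    assert (Hs1 := Rle_lt_trans _ _ _ (Rmax_l _ _) Hs).
    assert (Hs2 := Rle_lt_trans _ _ _ (Rmax_r _ _) Hs).
    specialize (Hbound s ltac:(lra)).
    unfold ball; simpl; unfold AbsRing_ball, abs, minus, plus, opp; simpl.
    rewrite Ropp_0, Rplus_0_r. apply Rle_lt_trans with (1 := Hbound).
    apply Rmult_lt_reg_r with s; [lra |].
    replace (8 / x ^ 2 / s * s) with (8 / x ^ 2) by (field; lra).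
    apply (Rmult_lt_compat_r e) in Hs2; [| apply cond_pos].
    replace (8 / x ^ 2 / e * e) with (8 / x ^ 2) in Hs2
      by (field; split; [lra | apply Rgt_not_eq, cond_pos]).
    lra. }
  assert (Hint : half_line_integral (Derive prim) (0 - prim 0)).
  { refine (is_RInt_gen_Derive (Fa := at_point 0) (Fb := Rbar_locally p_infty)
              prim (prim 0) 0 _ _ _ Hlim).
    - apply filter_forall. intros ab s _. eexists; apply Hprim.
    - apply filter_forall. intros ab s _.
      apply continuous_ext with
        (f := fun s => x * cosh_weight 2 x s - x * cosh_weight 0 x s - cosh_weight 1 x s).
      + intros y. symmetry. apply is_derive_unique, Hprim.
      + apply (ex_derive_continuous (V := R_NormedModule)).
        unfold cosh_weight, cosh. auto_derive. trivial.
    - intros Q HQ. apply locally_singleton in HQ. exact HQ. }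
  assert (Hint' : half_line_integral (Derive prim)
            (x * cosh_moment 2 x - x * cosh_moment 0 x - cosh_moment 1 x)).
  { apply half_line_integral_ext with
      (f := fun s => x * cosh_weight 2 x s - x * cosh_weight 0 x s - cosh_weight 1 x s).
    - intros s. symmetry. apply is_derive_unique, Hprim.
    - apply half_line_integral_minus.
      + apply half_line_integral_minus;
          apply half_line_integral_scal; now apply cosh_moment_integral.
      + now apply cosh_moment_integral. }
  apply half_line_integral_unique in Hint. apply half_line_integral_unique in Hint'.
  assert (Hp0 : prim 0 = 0) by (unfold prim; rewrite sinh_0; ring).
  assert (Heq : x * cosh_moment 2 x - x * cosh_moment 0 x - cosh_moment 1 x = 0) by lra.
  apply Rmult_eq_reg_l with x; [| lra].
  replace (x * (cosh_moment 0 x + cosh_moment 1 x / x))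
    with (x * cosh_moment 0 x + cosh_moment 1 x) by (field; lra).
  lra.
Qed.

Lemma K0_cosh_moment : K0 = cosh_moment 0.
Proof.
  apply functional_extensionality; intros x.
  unfold K0, besselK, cosh_moment. f_equal.
  apply functional_extensionality; intros s. unfold cosh_weight.
  rewrite Rmult_0_l, cosh_0. simpl. ring.
Qed.

Lemma K1_cosh_moment : K1 = cosh_moment 1.
Proof.
  apply functional_extensionality; intros x.
  unfold K1, besselK, cosh_moment. f_equal.
  apply functional_extensionality; intros s. unfold cosh_weight.
  rewrite Rmult_1_l. simpl. ring.
Qed.

Lemma K0_pos (x : R) : 0 < x -> 0 < K0 x.
Proof. rewrite K0_cosh_moment. apply cosh_moment_pos. Qed.

Lemma K1_pos (x : R) : 0 < x -> 0 < K1 x.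
Proof. rewrite K1_cosh_moment. apply cosh_moment_pos. Qed.

Lemma is_derive_K0 (x : R) : 0 < x -> is_derive K0 x (- K1 x).
Proof. rewrite K0_cosh_moment, K1_cosh_moment. apply is_derive_cosh_moment. Qed.

Lemma is_derive_K1 (x : R) : 0 < x -> is_derive K1 x (- (K0 x + K1 x / x)).
Proof.
  intros Hx. rewrite K0_cosh_moment, K1_cosh_moment, <- cosh_moment_recurrence by exact Hx.
  now apply is_derive_cosh_moment.
Qed.

Lemma is_lim_K1 : is_lim K1 p_infty 0.
Proof.
  apply is_lim_le_le_loc with (f := fun _ => 0) (g := fun x => exp (1 - x) * cosh_moment 1 1).
  - exists 1. intros x Hx. split; [left; apply K1_pos; lra |].
    rewrite K1_cosh_moment. apply cosh_moment_le; lra.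
  - apply is_lim_const.
  - replace (Finite 0) with (Rbar_mult 0 (cosh_moment 1 1)) by (simpl; f_equal; ring).
    apply is_lim_mult; [| apply is_lim_const | exact I].
    apply is_lim_comp with m_infty.
    + apply is_lim_exp_m.
    + apply is_lim_ext with (fun x => 1 + - x); [intros; ring |].
      apply (is_lim_plus _ _ p_infty 1 m_infty); [apply is_lim_const | | reflexivity].
      apply (is_lim_opp _ p_infty p_infty), is_lim_id.
    + now exists 0.
Qed.

(** * One-sided limits and limits at infinity *)

Lemma filterlim_Rplus {U : Type} (F : (U -> Prop) -> Prop) {FF : Filter F}
  (f g : U -> R) (a b : R) :
  filterlim f F (locally a) -> filterlim g F (locally b) ->
  filterlim (fun x => f x + g x) F (locally (a + b)).
Proof.
  intros Hf Hg. eapply filterlim_comp_2; [exact Hf | exact Hg |].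
  apply (filterlim_plus (V := R_NormedModule)).
Qed.

Lemma filterlim_Rmult {U : Type} (F : (U -> Prop) -> Prop) {FF : Filter F}
  (f g : U -> R) (a b : R) :
  filterlim f F (locally a) -> filterlim g F (locally b) ->
  filterlim (fun x => f x * g x) F (locally (a * b)).
Proof.
  intros Hf Hg. eapply filterlim_comp_2; [exact Hf | exact Hg |].
  apply (filterlim_mult (K := R_AbsRing)).
Qed.

Lemma filterlim_continuous_comp {U : Type} (F : (U -> Prop) -> Prop)
  (f : U -> R) (h : R -> R) (a : R) :
  filterlim f F (locally a) -> continuous h a ->
  filterlim (fun x => h (f x)) F (locally (h a)).
Proof. intros Hf Hh. eapply filterlim_comp; [exact Hf | exact Hh]. Qed.

Lemma filterlim_Rscal {U : Type} (F : (U -> Prop) -> Prop) {FF : Filter F}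
  (f : U -> R) (c a : R) :
  filterlim f F (locally a) -> filterlim (fun x => c * f x) F (locally (c * a)).
Proof. intros Hf. apply (filterlim_Rmult F); [apply filterlim_const | exact Hf]. Qed.

Lemma filterlim_Rinv {U : Type} (F : (U -> Prop) -> Prop) {FF : Filter F}
  (f : U -> R) (a : R) : a <> 0 ->
  filterlim f F (locally a) -> filterlim (fun x => / f x) F (locally (/ a)).
Proof.
  intros Ha Hf. apply (filterlim_continuous_comp F f Rinv a Hf).
  apply continuity_pt_filterlim, continuity_pt_inv; [apply continuity_pt_id | exact Ha].
Qed.

Lemma is_lim_p_infty_0 (f : R -> R) :
  (forall e, 0 < e -> exists M, forall x, M < x -> Rabs (f x) < e) ->
  is_lim f p_infty 0.
Proof.
  intros Hf. apply filterlim_locally. intros e.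
  destruct (Hf e (cond_pos e)) as [M HM]. exists M. intros x Hx.
  unfold ball; simpl; unfold AbsRing_ball, abs, minus, plus, opp; simpl.
  rewrite Ropp_0, Rplus_0_r. now apply HM.
Qed.

Lemma is_lim_p_infty_0_inv (f : R -> R) (e : R) :
  is_lim f p_infty 0 -> 0 < e -> exists M, forall x, M < x -> Rabs (f x) < e.
Proof.
  intros Hf He. apply (proj1 (filterlim_locally _ _)) with (eps := mkposreal e He) in Hf.
  destruct Hf as [M HM]. exists M. intros x Hx. specialize (HM x Hx).
  unfold ball in HM; simpl in HM; unfold AbsRing_ball, abs, minus, plus, opp in HM;
    simpl in HM.
  now rewrite Ropp_0, Rplus_0_r in HM.
Qed.

Lemma lim_right_eq (x : R) (f : R -> R) (l : R) :
  filterlim f (at_right x) (locally l) -> lim_right x f = l.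
Proof. apply (iota_filterlim_locally (V := R_CompleteNormedModule) (F := at_right x)). Qed.

Lemma lim_left_eq (x : R) (f : R -> R) (l : R) :
  filterlim f (at_left x) (locally l) -> lim_left x f = l.
Proof. apply (iota_filterlim_locally (V := R_CompleteNormedModule) (F := at_left x)). Qed.

Lemma filterlim_at_right_ext (x : R) (f g : R -> R) (l : R) :
  (forall y, x < y -> f y = g y) ->
  filterlim f (at_right x) (locally l) -> filterlim g (at_right x) (locally l).
Proof.
  intros Hfg. apply filterlim_ext_loc. unfold at_right, within.
  apply filter_forall. exact Hfg.
Qed.

Lemma filterlim_at_right_of_continuous (f : R -> R) (x : R) :
  continuous f x -> filterlim f (at_right x) (locally (f x)).
Proof.
  intros Hf. apply (filterlim_filter_le_1 (F := locally x)); [| exact Hf].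
  apply filter_le_within.
Qed.

Lemma filterlim_at_left_of_continuous (f : R -> R) (x : R) :
  continuous f x -> filterlim f (at_left x) (locally (f x)).
Proof.
  intros Hf. apply (filterlim_filter_le_1 (F := locally x)); [| exact Hf].
  apply filter_le_within.
Qed.

Lemma locally_gt (a x : R) : a < x -> locally x (fun y => a < y).
Proof. intros H. exact (open_gt a x H). Qed.

Lemma nondecreasing_of_derive_ge0 (f df : R -> R) (a b : R) : a <= b ->
  (forall x, a <= x <= b -> is_derive f x (df x)) ->
  (forall x, a <= x <= b -> 0 <= df x) -> f a <= f b.
Proof.
  intros Hab Hf Hdf.
  destruct (MVT_gen f a b df) as [c [Hc Heq]]; rewrite Rmin_left, Rmax_right in * by lra.
  - intros x Hx; apply Hf; lra.
  - intros x Hx. apply continuity_pt_filterlim.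
    apply (ex_derive_continuous (V := R_NormedModule)). exists (df x); apply Hf; lra.
  - specialize (Hdf c Hc). nra.
Qed.

(** * The elliptic operators on the exterior domain *)

Lemma is_derive_dr (w : R -> R) (r : R) : ex_derive w r ->
  is_derive w r (dr w r - w r / r).
Proof.
  intros Hw. replace (dr w r - w r / r) with (Derive w r) by (unfold dr; ring).
  now apply Derive_correct.
Qed.

Lemma is_derive_id_mult (g : R -> R) (x l : R) :
  is_derive g x l -> is_derive (fun y : R => y * g y) x (g x + x * l).
Proof.
  intros Hg. replace (g x + x * l) with (1 * g x + x * l) by ring.
  apply (is_derive_mult (fun y : R => y) g x 1 l);
    [exact (is_derive_id (K := R_AbsRing) x) | exact Hg |].
  intros a b; apply Rmult_comm.
Qed.

(** An energy argument. With [phi = dr w], the product [E = r w phi] satisfies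
    [E' = r phi^2 + r w^2 / kappa^2 >= 0] and [((r w)^2)' = 2 r E]. If [E] were positive
    somewhere, [(r w)^2] would grow at least like [r^2], against the decay of [w]; if it
    were negative somewhere, [(r w)^2] would increase as [r] decreases to [Rad], against
    the boundary condition. Hence [E = 0], and then [E' = 0] forces [w = 0]. *)
Lemma frakR0_zero_source (p : params) (w : R -> R) :
  0 < Rad p -> 0 < kappa p ->
  is_frakR0 p (fun _ => 0) w -> forall r, Rad p < r -> w r = 0.
Proof.
  intros HR Hk [Heq [H0 Hinf]].
  set (phi := dr w). set (E := fun r => r * w r * phi r).
  assert (Hw : forall r, Rad p < r -> is_derive w r (phi r - w r / r)).
  { intros r Hr. now apply is_derive_dr, Heq. }
  assert (Hphi : forall r, Rad p < r -> is_derive phi r (w r / kappa p ^ 2)).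
  { intros r Hr. destruct (Heq r Hr) as [_ [H1 H2]].
    replace (w r / kappa p ^ 2) with (Derive phi r); [now apply Derive_correct |].
    unfold phi. replace (w r) with (kappa p ^ 2 * Derive (dr w) r) by lra.
    field; lra. }
  assert (HE : forall r, Rad p < r ->
            is_derive E r (r * phi r ^ 2 + r * w r ^ 2 / kappa p ^ 2)).
  { intros r Hr. assert (Hw' := Hw r Hr). assert (Hphi' := Hphi r Hr). unfold E.
    auto_derive.
    - repeat split; [exists (phi r - w r / r); exact Hw' | eexists; exact Hphi'].
    - change (fun x : R => phi x) with phi. change (fun x : R => w x) with w.
      rewrite (is_derive_unique _ _ _ Hw'), (is_derive_unique _ _ _ Hphi').
      field; lra. }
  assert (HEpos : forall r, Rad p < r -> 0 <= r * phi r ^ 2 + r * w r ^ 2 / kappa p ^ 2).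
  { intros r Hr. assert (0 < / kappa p ^ 2) by (apply Rinv_0_lt_compat; nra).
    generalize (pow2_ge_0 (phi r)) (pow2_ge_0 (w r)). intros.
    assert (0 <= r * w r ^ 2) by nra. assert (0 <= r * phi r ^ 2) by nra.
    unfold Rdiv. nra. }
  assert (HEmono : forall a b, Rad p < a -> a <= b -> E a <= E b).
  { intros a b Ha Hab. eapply nondecreasing_of_derive_ge0; [exact Hab | |].
    - intros x Hx. apply HE; lra.
    - intros x Hx. apply HEpos; lra. }
  assert (Hy : forall r, Rad p < r -> is_derive (fun r => (r * w r) ^ 2) r (2 * r * E r)).
  { intros r Hr. assert (Hw' := Hw r Hr). unfold E. auto_derive.
    - eexists; exact Hw'.
    - change (fun x : R => w x) with w.
      rewrite (is_derive_unique _ _ _ Hw'). field; lra. }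
  assert (HE0 : forall r, Rad p < r -> E r = 0).
  { intros r0 Hr0. apply Rle_antisym; apply Rnot_lt_le; intros Hlt.
    - assert (Hgrow : forall r, r0 <= r ->
                E r0 * (r ^ 2 - r0 ^ 2) <= (r * w r) ^ 2).
      { intros r Hr.
        enough ((r0 * w r0) ^ 2 - E r0 * r0 ^ 2 <= (r * w r) ^ 2 - E r0 * r ^ 2)
          by (generalize (pow2_ge_0 (r0 * w r0)); lra).
        apply nondecreasing_of_derive_ge0 with
          (f := fun r => (r * w r) ^ 2 - E r0 * r ^ 2)
          (df := fun r => 2 * r * E r - E r0 * (2 * r)); [exact Hr | |].
        - intros x Hx. apply (is_derive_minus (V := R_NormedModule)); [apply Hy; lra |].
          auto_derive; [trivial | ring].
        - intros x Hx. assert (E r0 <= E x) by (apply HEmono; lra). nra. }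
      destruct (is_lim_p_infty_0_inv w (Rmin 1 (E r0 / 2)) Hinf) as [M HM].
      { apply Rmin_pos; lra. }
      set (r := Rmax (M + 1) (2 * r0)).
      assert (Hr1 : M < r) by (assert (H := Rmax_l (M + 1) (2 * r0)); unfold r; lra).
      assert (Hr2 : 2 * r0 <= r) by apply Rmax_r.
      specialize (HM r Hr1). specialize (Hgrow r ltac:(lra)).
      assert (H1 := Rlt_le_trans _ _ _ HM (Rmin_l _ _)).
      assert (H2 := Rlt_le_trans _ _ _ HM (Rmin_r _ _)).
      rewrite Rpow_mult_distr, <- (pow2_abs (w r)) in Hgrow.
      assert (Hw2 : Rabs (w r) ^ 2 <= E r0 / 2) by (generalize (Rabs_pos (w r)); nra).
      assert (r0 ^ 2 * 4 <= r ^ 2) by nra.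
      assert (0 < r ^ 2) by nra.
      assert (r ^ 2 * Rabs (w r) ^ 2 <= r ^ 2 * (E r0 / 2)) by (apply Rmult_le_compat_l; lra).
      nra.
    - assert (Hdecr : forall r, Rad p < r < r0 -> (r0 * w r0) ^ 2 <= (r * w r) ^ 2).
      { intros r Hr. apply Ropp_le_cancel.
        apply nondecreasing_of_derive_ge0 with
          (f := fun r => - (r * w r) ^ 2) (df := fun r => - (2 * r * E r)); [lra | |].
        - intros x Hx. apply (is_derive_opp (V := R_NormedModule)), Hy; lra.
        - intros x Hx. assert (E x <= E r0) by (apply HEmono; lra). nra. }
      assert (Hlim : filterlim (fun r => (r * w r) ^ 2) (at_right (Rad p)) (locally 0)).
      { replace 0 with ((Rad p * 0) ^ 2) by ring.
        apply (filterlim_continuous_comp (at_right (Rad p)) (fun r => r * w r)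
                 (fun y => y ^ 2) (Rad p * 0)).
        - apply (filterlim_Rmult (at_right (Rad p))); [| exact H0].
          apply (filterlim_at_right_of_continuous (fun r => r)), continuous_id.
        - apply (ex_derive_continuous (V := R_NormedModule)). auto_derive; trivial. }
      assert (Hle : Rbar_le ((r0 * w r0) ^ 2) 0).
      { apply (@filterlim_le _ (at_right (Rad p)) _
                 (fun _ => (r0 * w r0) ^ 2) (fun r => (r * w r) ^ 2));
          [| apply filterlim_const | exact Hlim].
        apply filter_imp with (fun r => Rad p < r < r0).
        - intros x Hx; now apply Hdecr.
        - assert (He : 0 < r0 - Rad p) by lra.
          exists (mkposreal _ He). intros y Hy' Hy''. split; [exact Hy'' |].
          apply Rabs_def2 in Hy'. unfold minus, plus, opp in Hy'; simpl in Hy'. lra. }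
      simpl in Hle.
      assert (r0 * w r0 = 0) by (generalize (pow2_ge_0 (r0 * w r0)); intros; nra).
      unfold E in Hlt. rewrite H in Hlt. lra. }
  intros r Hr.
  assert (Hd : is_derive E r 0).
  { apply (is_derive_ext_loc (fun _ => 0)); [| exact (is_derive_const (V := R_NormedModule) 0 r)].
    apply filter_imp with (2 := locally_gt _ _ Hr). intros x Hx; symmetry; now apply HE0. }
  assert (H1 := is_derive_unique _ _ _ Hd). rewrite (is_derive_unique _ _ _ (HE r Hr)) in H1.
  assert (0 < / kappa p ^ 2) by (apply Rinv_0_lt_compat; nra).
  unfold Rdiv in H1.
  assert (0 <= r * phi r ^ 2) by (apply Rmult_le_pos; [lra | apply pow2_ge_0]).
  assert (0 < r * / kappa p ^ 2) by (apply Rmult_lt_0_compat; lra).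
  assert (Hw2 : w r ^ 2 = 0) by (generalize (pow2_ge_0 (w r)); nra).
  nra.
Qed.

(** The equation of [is_frakR0] without its boundary conditions. *)
Definition helmholtz (p : params) (w f : R -> R) : Prop :=
  forall r, Rad p < r ->
    ex_derive w r /\ ex_derive (dr w) r /\ w r - kappa p ^ 2 * Derive (dr w) r = f r.

Lemma dr_ext_gt (a r : R) (w v : R -> R) : a < r ->
  (forall x, a < x -> w x = v x) -> dr w r = dr v r.
Proof.
  intros Hr Hwv. unfold dr. rewrite (Hwv r Hr). f_equal.
  apply Derive_ext_loc, filter_imp with (2 := locally_gt _ _ Hr), Hwv.
Qed.

Lemma ex_derive_ext_gt (a r : R) (w v : R -> R) : a < r ->
  (forall x, a < x -> w x = v x) -> ex_derive w r -> ex_derive v r.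
Proof.
  intros Hr Hwv. apply ex_derive_ext_loc, filter_imp with (2 := locally_gt _ _ Hr), Hwv.
Qed.

Lemma Derive_ext_gt (a r : R) (w v : R -> R) : a < r ->
  (forall x, a < x -> w x = v x) -> Derive w r = Derive v r.
Proof.
  intros Hr Hwv. apply Derive_ext_loc, filter_imp with (2 := locally_gt _ _ Hr), Hwv.
Qed.

Lemma dr_lincomb (a b : R) (w v : R -> R) (r : R) : r <> 0 ->
  ex_derive w r -> ex_derive v r ->
  dr (fun x => a * w x + b * v x) r = a * dr w r + b * dr v r.
Proof.
  intros Hr Hw Hv. unfold dr.
  rewrite Derive_plus, !Derive_scal.
  - field; exact Hr.
  - now apply (ex_derive_scal w a r).
  - now apply (ex_derive_scal v b r).
Qed.

Lemma ex_derive_lincomb (a b : R) (w v : R -> R) (r : R) :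
  ex_derive w r -> ex_derive v r -> ex_derive (fun x => a * w x + b * v x) r.
Proof.
  intros Hw Hv. apply (ex_derive_plus (V := R_NormedModule)).
  - now apply (ex_derive_scal w a r).
  - now apply (ex_derive_scal v b r).
Qed.

Lemma helmholtz_ext (p : params) (w w' f f' : R -> R) :
  (forall r, Rad p < r -> w r = w' r) -> (forall r, Rad p < r -> f r = f' r) ->
  helmholtz p w f -> helmholtz p w' f'.
Proof.
  intros Hw Hf H r Hr. destruct (H r Hr) as [H1 [H2 H3]].
  assert (Hdr : forall x, Rad p < x -> dr w x = dr w' x)
    by (intros x Hx; now apply dr_ext_gt with (Rad p)).
  repeat split.
  - now apply ex_derive_ext_gt with (a := Rad p) (2 := Hw).
  - now apply ex_derive_ext_gt with (a := Rad p) (2 := Hdr).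
  - rewrite <- Hw, <- Hf, <- H3 by exact Hr.
    now rewrite (Derive_ext_gt (Rad p) r _ _ Hr Hdr).
Qed.

Lemma helmholtz_lincomb (p : params) (a b : R) (w v f g : R -> R) : 0 < Rad p ->
  helmholtz p w f -> helmholtz p v g ->
  helmholtz p (fun r => a * w r + b * v r) (fun r => a * f r + b * g r).
Proof.
  intros HR Hw Hv r Hr.
  destruct (Hw r Hr) as [Hw1 [Hw2 Hw3]]. destruct (Hv r Hr) as [Hv1 [Hv2 Hv3]].
  assert (Hdr : forall x, Rad p < x ->
            a * dr w x + b * dr v x = dr (fun x => a * w x + b * v x) x).
  { intros x Hx. symmetry. apply dr_lincomb; [lra | apply Hw; exact Hx | apply Hv; exact Hx]. }
  repeat split.
  - now apply ex_derive_lincomb.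
  - apply ex_derive_ext_gt with (a := Rad p) (2 := Hdr); [exact Hr |].
    now apply ex_derive_lincomb.
  - rewrite <- (Derive_ext_gt (Rad p) r _ _ Hr Hdr), <- Hw3, <- Hv3.
    rewrite Derive_plus; [rewrite !Derive_scal | |];
      [ring | now apply (ex_derive_scal _ a r) | now apply (ex_derive_scal _ b r)].
Qed.

Lemma is_derive_scaled (f : R -> R) (k r l : R) :
  is_derive f (r / k) l -> is_derive (fun x : R => f (x / k)) r (l / k).
Proof.
  intros Hf. replace (l / k) with (/ k * l) by (unfold Rdiv; ring).
  apply (is_derive_comp (V := R_NormedModule) f (fun x => x / k)); [exact Hf |].
  auto_derive; [trivial | ring].
Qed.

Lemma is_derive_K0_scaled (k r : R) : 0 < k -> 0 < r ->
  is_derive (fun x : R => K0 (x / k)) r (- (K1 (r / k) / k)).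
Proof.
  intros Hk Hr. replace (- (K1 (r / k) / k)) with (- K1 (r / k) / k) by (field; lra).
  now apply is_derive_scaled, is_derive_K0, Rdiv_lt_0_compat.
Qed.

Lemma is_derive_K1_scaled (k r : R) : 0 < k -> 0 < r ->
  is_derive (fun x : R => K1 (x / k)) r (- (K0 (r / k) / k) - K1 (r / k) / r).
Proof.
  intros Hk Hr.
  replace (- (K0 (r / k) / k) - K1 (r / k) / r)
    with (- (K0 (r / k) + K1 (r / k) / (r / k)) / k) by (field; lra).
  now apply is_derive_scaled, is_derive_K1, Rdiv_lt_0_compat.
Qed.

Lemma dr_K1_scaled (k r : R) : 0 < k -> 0 < r ->
  dr (fun x => K1 (x / k)) r = - (K0 (r / k) / k).
Proof.
  intros Hk Hr. unfold dr.
  replace (Derive (fun x => K1 (x / k)) r) with (- (K0 (r / k) / k) - K1 (r / k) / r)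
    by (symmetry; now apply is_derive_unique, is_derive_K1_scaled).
  ring.
Qed.

Lemma helmholtz_K1 (p : params) : 0 < Rad p -> 0 < kappa p ->
  helmholtz p (fun r => K1 (r / kappa p)) (fun _ => 0).
Proof.
  intros HR Hk r Hr.
  assert (Hdr : forall x, Rad p < x ->
            - / kappa p * K0 (x / kappa p) = dr (fun x => K1 (x / kappa p)) x).
  { intros x Hx. rewrite dr_K1_scaled by lra. field; lra. }
  assert (HK0 := is_derive_K0_scaled (kappa p) r Hk ltac:(lra)).
  repeat split.
  - eexists; apply is_derive_K1_scaled; lra.
  - apply ex_derive_ext_gt with (a := Rad p) (2 := Hdr); [exact Hr |].
    apply (ex_derive_scal (fun x => K0 (x / kappa p))). eexists; exact HK0.
  - rewrite <- (Derive_ext_gt (Rad p) r _ _ Hr Hdr), Derive_scal.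
    replace (Derive (fun x => K0 (x / kappa p)) r) with (- (K1 (r / kappa p) / kappa p))
      by (symmetry; now apply is_derive_unique).
    field; lra.
Qed.

Lemma is_lim_K1_scaled (k : R) : 0 < k -> is_lim (fun r => K1 (r / k)) p_infty 0.
Proof.
  intros Hk. apply is_lim_p_infty_0. intros e He.
  destruct (is_lim_p_infty_0_inv K1 e is_lim_K1 He) as [M HM].
  exists (M * k). intros x Hx. apply HM.
  apply Rmult_lt_reg_r with k; [exact Hk |].
  now replace (x / k * k) with x by (field; lra).
Qed.

Lemma continuous_K1_scaled (k r : R) : 0 < k -> 0 < r -> continuous (fun x => K1 (x / k)) r.
Proof.
  intros Hk Hr. apply (ex_derive_continuous (V := R_NormedModule)).
  eexists; now apply is_derive_K1_scaled.
Qed.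

Lemma continuous_K0_scaled (k r : R) : 0 < k -> 0 < r -> continuous (fun x => K0 (x / k)) r.
Proof.
  intros Hk Hr. apply (ex_derive_continuous (V := R_NormedModule)).
  eexists; now apply is_derive_K0_scaled.
Qed.

Lemma is_lim_lincomb (a b : R) (f g : R -> R) :
  is_lim f p_infty 0 -> is_lim g p_infty 0 ->
  is_lim (fun r => a * f r + b * g r) p_infty 0.
Proof.
  intros Hf Hg. replace 0 with (a * 0 + b * 0) by ring.
  apply (filterlim_Rplus (Rbar_locally' p_infty));
    now apply (filterlim_Rscal (Rbar_locally' p_infty)).
Qed.

Lemma filterlim_at_right_lincomb (x a b lf lg : R) (f g : R -> R) :
  filterlim f (at_right x) (locally lf) -> filterlim g (at_right x) (locally lg) ->
  filterlim (fun r => a * f r + b * g r) (at_right x) (locally (a * lf + b * lg)).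
Proof.
  intros Hf Hg. apply (filterlim_Rplus (at_right x)); now apply (filterlim_Rscal (at_right x)).
Qed.

(** Subtracting the multiple of [K1 (r / kappa)] with the same boundary value leaves
    a solution with zero source and zero boundary value. *)
Lemma helmholtz_homogeneous (p : params) (w : R -> R) (w0 : R) :
  0 < Rad p -> 0 < kappa p -> helmholtz p w (fun _ => 0) ->
  filterlim w (at_right (Rad p)) (locally w0) -> is_lim w p_infty 0 ->
  forall r, Rad p < r -> w r = w0 * (K1 (r / kappa p) / K1 (Rad p / kappa p)).
Proof.
  intros HR Hk Hw Hw0 Hinf r Hr.
  set (k1 := K1 (Rad p / kappa p)).
  assert (Hk1 : 0 < k1) by now apply K1_pos, Rdiv_lt_0_compat.
  enough (1 * w r + - (w0 / k1) * K1 (r / kappa p) = 0)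
    by (unfold Rdiv in *; lra).
  apply (frakR0_zero_source p (fun r => 1 * w r + - (w0 / k1) * K1 (r / kappa p)) HR Hk);
    [| exact Hr].
  split; [| split].
  - apply helmholtz_ext with (w := fun r => 1 * w r + - (w0 / k1) * K1 (r / kappa p))
      (f := fun r => 1 * 0 + - (w0 / k1) * 0); [reflexivity | intros; ring |].
    apply helmholtz_lincomb; [exact HR | exact Hw | now apply helmholtz_K1].
  - replace 0 with (1 * w0 + - (w0 / k1) * k1) by (field; lra).
    apply filterlim_at_right_lincomb; [exact Hw0 |].
    apply (filterlim_at_right_of_continuous (fun x => K1 (x / kappa p))).
    now apply continuous_K1_scaled.
  - apply is_lim_lincomb; [exact Hinf | now apply is_lim_K1_scaled].
Qed.

(** [∂_r (1 - kappa^2 d_r ∂_r) = (1 - kappa^2 ∂_r d_r) ∂_r]. The third derivative of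
    [v] exists because the equation expresses [dr (Derive v)] through [v] and [f]. *)
Lemma frakR1_derive_helmholtz (p : params) (f v : R -> R) : 0 < kappa p ->
  is_frakR1 p f v -> (forall r, Rad p < r -> ex_derive f r) ->
  helmholtz p (Derive v) (Derive f).
Proof.
  intros Hk [Heq _] Hf r Hr.
  assert (Hdr : forall x, Rad p < x ->
            / kappa p ^ 2 * v x + - / kappa p ^ 2 * f x = dr (Derive v) x).
  { intros x Hx. destruct (Heq x Hx) as [_ [_ <-]]. field; lra. }
  destruct (Heq r Hr) as [H1 [H2 H3]]. specialize (Hf r Hr).
  repeat split.
  - exact H2.
  - apply ex_derive_ext_gt with (a := Rad p) (2 := Hdr); [exact Hr |].
    now apply ex_derive_lincomb.
  - rewrite <- (Derive_ext_gt (Rad p) r _ _ Hr Hdr), Derive_plus; [rewrite !Derive_scal | |];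
      [field; lra | now apply (ex_derive_scal v) | now apply (ex_derive_scal f)].
Qed.

(** On [[r - 1, r]] the mean value theorem gives a point where [v'] is small, because
    [v] is; the equation [(r v')' = r (v - f) / kappa^2] carries this bound to [r]. *)
Lemma frakR1_derive_decay (p : params) (f v : R -> R) : 0 < Rad p -> 0 < kappa p < 1 ->
  is_frakR1 p f v -> is_lim f p_infty 0 -> is_lim (Derive v) p_infty 0.
Proof.
  intros HR Hk [Heq [_ Hv]] Hf. apply is_lim_p_infty_0. intros e He.
  assert (Hk2 : 0 < kappa p ^ 2 < 1) by nra.
  (* since [kappa^2 < 1], both [2 e'] and [2 e' / kappa^2] are at most [e / 4] *)
  set (e' := e * kappa p ^ 2 / 8). assert (He' : 0 < e') by (unfold e'; nra).
  destruct (is_lim_p_infty_0_inv v e' Hv He') as [Mv HMv].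
  destruct (is_lim_p_infty_0_inv f e' Hf He') as [Mf HMf].
  exists (Rmax (Rmax Mv Mf) (Rad p) + 1). intros r Hr.
  assert (H1 := Rmax_l (Rmax Mv Mf) (Rad p)). assert (H2 := Rmax_r (Rmax Mv Mf) (Rad p)).
  assert (H3 := Rmax_l Mv Mf). assert (H4 := Rmax_r Mv Mf).
  assert (Hbv : forall x, r - 1 <= x -> Rabs (v x) < e') by (intros x Hx; apply HMv; lra).
  assert (Hbf : forall x, r - 1 <= x -> Rabs (f x) < e') by (intros x Hx; apply HMf; lra).
  destruct (MVT_gen v (r - 1) r (Derive v)) as [xi [Hxi Hmvt]];
    rewrite ?Rmin_left, ?Rmax_right in * by lra.
  { intros x Hx. apply Derive_correct, Heq; lra. }
  { intros x Hx. apply continuity_pt_filterlim.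
    apply (ex_derive_continuous (V := R_NormedModule)), Heq; lra. }
  assert (Hder : forall x, r - 1 <= x ->
            is_derive (fun x => x * Derive v x) x (x * ((v x - f x) / kappa p ^ 2))).
  { intros x Hx. destruct (Heq x ltac:(lra)) as [_ [G1 G2]].
    replace (x * ((v x - f x) / kappa p ^ 2)) with (x * dr (Derive v) x)
      by (replace (v x) with (f x + kappa p ^ 2 * dr (Derive v) x) by lra; field; lra).
    replace (x * dr (Derive v) x) with (Derive v x + x * Derive (Derive v) x)
      by (unfold dr; field; lra).
    apply is_derive_id_mult. now apply Derive_correct. }
  destruct (MVT_gen (fun x => x * Derive v x) xi r
              (fun x => x * ((v x - f x) / kappa p ^ 2))) as [eta [Heta Hmvt2]];
    rewrite ?Rmin_left, ?Rmax_right in * by lra.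
  { intros x Hx. apply Hder; lra. }
  { intros x Hx. apply continuity_pt_filterlim.
    apply (ex_derive_continuous (V := R_NormedModule) (fun y : R => y * Derive v y)).
    exists (x * ((v x - f x) / kappa p ^ 2)). apply Hder; lra. }
  assert (Hb1 := Rabs_def2 _ _ (Hbv r ltac:(lra))).
  assert (Hb2 := Rabs_def2 _ _ (Hbv (r - 1) ltac:(lra))).
  assert (Hb3 := Rabs_def2 _ _ (Hbv eta ltac:(lra))).
  assert (Hb4 := Rabs_def2 _ _ (Hbf eta ltac:(lra))).
  assert (Hxi' : Rabs (Derive v xi) <= 2 * e') by (apply Rabs_le; lra).
  assert (Hq : Rabs ((v eta - f eta) / kappa p ^ 2) <= e / 4).
  { unfold Rdiv at 1. rewrite Rabs_mult, (Rabs_pos_eq (/ _)) by (left; apply Rinv_0_lt_compat; lra).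
    apply Rmult_le_reg_r with (kappa p ^ 2); [lra |].
    rewrite Rmult_assoc, Rinv_l, Rmult_1_r by lra.
    apply Rabs_le. unfold e' in *. lra. }
  apply Rmult_lt_reg_l with r; [lra |].
  replace (r * Rabs (Derive v r)) with (Rabs (r * Derive v r))
    by (rewrite Rabs_mult, (Rabs_pos_eq r) by lra; reflexivity).
  replace (r * Derive v r)
    with (xi * Derive v xi + eta * ((v eta - f eta) / kappa p ^ 2) * (r - xi)) by lra.
  apply Rle_lt_trans with (1 := Rabs_triang _ _).
  rewrite !Rabs_mult, (Rabs_pos_eq xi), (Rabs_pos_eq eta), (Rabs_pos_eq (r - xi)) by lra.
  assert (He8 : 2 * e' <= e / 4) by (unfold e'; nra).
  assert (B1 : xi * Rabs (Derive v xi) <= r * (e / 4)).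
  { apply Rmult_le_compat; [lra | apply Rabs_pos | lra | lra]. }
  assert (B2 : eta * Rabs ((v eta - f eta) / kappa p ^ 2) * (r - xi) <= r * (e / 4) * 1).
  { apply Rmult_le_compat; [| lra | | lra].
    - apply Rmult_le_pos; [lra | apply Rabs_pos].
    - apply Rmult_le_compat; [lra | apply Rabs_pos | lra | exact Hq]. }
  nra.
Qed.

(** * The exterior momentum equation as an elliptic equation *)

Lemma ex_derive_dr (w : R -> R) (r : R) : r <> 0 ->
  ex_derive w r -> ex_derive (Derive w) r -> ex_derive (dr w) r.
Proof.
  intros Hr Hw Hw'. unfold dr.
  apply (ex_derive_plus (V := R_NormedModule)); [exact Hw' |].
  apply ex_derive_div; [exact Hw | apply ex_derive_id | exact Hr].
Qed.

(** Positivity of the height, and not only its nonvanishing, makes the derivative of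
    [ln h] equal to [h' / h]. *)
Definition smooth_profile (p : params) (zeta q : R -> R) : Prop :=
  forall r, Rad p < r ->
    ex_derive zeta r /\ ex_derive q r /\ ex_derive (Derive q) r /\ 0 < height p zeta r.

Definition momentum_flux (p : params) (zeta q : R -> R) (r : R) : R :=
  q r ^ 2 / height p zeta r.

Lemma is_derive_height (p : params) (zeta : R -> R) (r : R) :
  ex_derive zeta r -> is_derive (height p zeta) r (eps p * Derive zeta r).
Proof.
  intros Hz. replace (eps p * Derive zeta r) with (0 + eps p * Derive zeta r) by ring.
  apply (is_derive_plus (V := R_NormedModule) (fun _ => 1) (fun x => eps p * zeta x)).
  - apply (is_derive_const (V := R_NormedModule)).
  - apply is_derive_scal. now apply Derive_correct.
Qed.

Lemma ex_derive_momentum_flux (p : params) (zeta q : R -> R) (r : R) :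
  ex_derive zeta r -> ex_derive q r -> height p zeta r <> 0 ->
  ex_derive (momentum_flux p zeta q) r.
Proof.
  intros Hz Hq Hh. apply ex_derive_div; [| eexists; now apply is_derive_height | exact Hh].
  now apply (ex_derive_pow q 2).
Qed.

Lemma is_derive_src1 (p : params) (zeta q : R -> R) (r : R) : r <> 0 ->
  ex_derive zeta r -> ex_derive q r -> ex_derive (Derive q) r -> height p zeta r <> 0 ->
  is_derive (src1 p zeta q) r
    (Derive zeta r - nu p * Derive (dr q) r
     + eps p * (zeta r * Derive zeta r + Derive (momentum_flux p zeta q) r)).
Proof.
  intros Hr Hz Hq Hq' Hh. unfold src1, ff.
  apply (is_derive_plus (V := R_NormedModule)
           (fun x => zeta x - nu p * dr q x)
           (fun x => eps p * (zeta x ^ 2 / 2 + momentum_flux p zeta q x))).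
  - apply (is_derive_minus (V := R_NormedModule) zeta (fun x => nu p * dr q x)).
    + now apply Derive_correct.
    + apply is_derive_scal, Derive_correct. now apply ex_derive_dr.
  - apply is_derive_scal.
    apply (is_derive_plus (V := R_NormedModule)
             (fun x => zeta x ^ 2 / 2) (momentum_flux p zeta q)).
    + replace (zeta r * Derive zeta r)
        with (INR 2 * Derive zeta r * zeta r ^ 1 * / 2) by (simpl; field).
      apply (is_derive_scal_l (V := R_NormedModule) (fun x => zeta x ^ 2)).
      apply is_derive_pow. now apply Derive_correct.
    + now apply Derive_correct, ex_derive_momentum_flux.
Qed.

(** The exterior momentum equation, with the gradient terms gathered in [src1] and
    the terms that are not gradients left as sources. *)
Definition momentum_residual (p : params) (zeta q qt : R -> R) (r : R) : R :=
  qt r - kappa p ^ 2 * Derive (dr qt) r + Derive (src1 p zeta q) r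
  + eps p * src_r p zeta q r + nu p * src_nu p zeta q r.

(** Three identities: [h zeta' = (zeta + eps zeta^2 / 2)'],
    [dr (q^2 / h) = (q^2 / h)' + q^2 / (r h)] and
    [h (dr q / h)' = (dr q)' - (ln h)' dr q]. *)
Lemma momentum_residual_eq (p : params) (zeta q qt : R -> R) (r : R) : 0 < r ->
  ex_derive zeta r -> ex_derive q r -> ex_derive (Derive q) r -> 0 < height p zeta r ->
  momentum_residual p zeta q qt r =
  qt r - kappa p ^ 2 * Derive (dr qt) r
  + eps p * dr (fun x => q x ^ 2 / height p zeta x) r
  + height p zeta r * Derive zeta r
  - nu p * height p zeta r * Derive (fun x => dr q x / height p zeta x) r.
Proof.
  intros Hr Hz Hq Hq' Hh. unfold momentum_residual.
  rewrite (is_derive_unique _ _ _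
             (is_derive_src1 p zeta q r ltac:(lra) Hz Hq Hq' ltac:(lra))).
  change (fun x => q x ^ 2 / height p zeta x) with (momentum_flux p zeta q).
  change (dr (momentum_flux p zeta q) r)
    with (Derive (momentum_flux p zeta q) r + momentum_flux p zeta q r / r).
  unfold src_r, src_nu.
  assert (Hh' := is_derive_height p zeta r Hz).
  replace (Derive (fun x => ln (height p zeta x)) r)
    with (eps p * Derive zeta r / height p zeta r).
  2: { symmetry. apply is_derive_unique.
       replace (eps p * Derive zeta r / height p zeta r)
         with (eps p * Derive zeta r * / height p zeta r) by reflexivity.
       apply (is_derive_comp (V := R_NormedModule) ln (height p zeta)); [| exact Hh'].
       apply is_derive_ln, Hh. }
  replace (Derive (fun x => dr q x / height p zeta x) r)
    with ((Derive (dr q) r * height p zeta r - dr q r * (eps p * Derive zeta r))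
          / height p zeta r ^ 2).
  2: { symmetry. apply is_derive_unique, is_derive_div; [| exact Hh' | lra].
       apply Derive_correct, ex_derive_dr; [lra | exact Hq | exact Hq']. }
  set (B := Derive (momentum_flux p zeta q) r). unfold momentum_flux.
  change (height p zeta r) with (1 + eps p * zeta r) in *.
  field. lra.
Qed.

(** The quantity that the exterior momentum equation puts in the kernel of
    [1 - kappa^2 ∂_r d_r]. *)
Definition hydro_combination (p : params) (qt v wr wnu : R -> R) (r : R) : R :=
  qt r + Derive v r + eps p * wr r + nu p * wnu r.

Lemma hydro_combination_helmholtz (p : params) (zeta q qt v wr wnu : R -> R) :
  0 < Rad p -> 0 < kappa p -> smooth_profile p zeta q ->
  (forall r, Rad p < r -> ex_derive qt r /\ ex_derive (Derive qt) r) ->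
  is_frakR1 p (src1 p zeta q) v -> is_frakR0 p (src_r p zeta q) wr ->
  is_frakR0 p (src_nu p zeta q) wnu ->
  helmholtz p (hydro_combination p qt v wr wnu) (momentum_residual p zeta q qt).
Proof.
  intros HR Hk Hprof Hqt Hv Hwr Hwnu.
  apply helmholtz_ext with
    (w := fun r => 1 * (1 * qt r + 1 * Derive v r) + 1 * (eps p * wr r + nu p * wnu r))
    (f := fun r => 1 * (1 * (qt r - kappa p ^ 2 * Derive (dr qt) r)
                        + 1 * Derive (src1 p zeta q) r)
                   + 1 * (eps p * src_r p zeta q r + nu p * src_nu p zeta q r)).
  - intros r _; unfold hydro_combination; ring.
  - intros r _; unfold momentum_residual; ring.
  - apply helmholtz_lincomb; [exact HR | |].
    + apply helmholtz_lincomb; [exact HR | |].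
      * intros r Hr. destruct (Hqt r Hr) as [H1 H2].
        split; [exact H1 | split; [| reflexivity]]. apply ex_derive_dr; [lra | exact H1 | exact H2].
      * apply frakR1_derive_helmholtz; [lra | exact Hv |].
        intros r Hr. destruct (Hprof r Hr) as [H1 [H2 [H3 H4]]].
        eexists. apply is_derive_src1; trivial; lra.
    + apply helmholtz_lincomb; [exact HR | exact (proj1 Hwr) | exact (proj1 Hwnu)].
Qed.

(** Apply [dr] to the combination and use [kappa^2 dr (Derive v) = v - src1]. *)
Lemma f_hyd_identity (p : params) (zeta q qt v wr wnu : R -> R) (r : R) :
  0 < Rad p -> ex_derive qt r ->
  is_frakR1 p (src1 p zeta q) v -> is_frakR0 p (src_r p zeta q) wr ->
  is_frakR0 p (src_nu p zeta q) wnu -> Rad p < r ->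
  v r + eps p * kappa p ^ 2 * dr wr r + nu p * kappa p ^ 2 * dr wnu r
  = src1 p zeta q r
    + kappa p ^ 2 * (dr (hydro_combination p qt v wr wnu) r - dr qt r).
Proof.
  intros HR Hqt1 Hv Hwr Hwnu Hr.
  destruct (proj1 Hv r Hr) as [_ [Hv2 Hv3]].
  destruct (proj1 Hwr r Hr) as [Hwr1 _]. destruct (proj1 Hwnu r Hr) as [Hwnu1 _].
  enough (Heq : dr (hydro_combination p qt v wr wnu) r
                = dr qt r + dr (Derive v) r + eps p * dr wr r + nu p * dr wnu r)
    by (rewrite Heq, <- Hv3; ring).
  rewrite <- (dr_ext_gt (Rad p) r
    (fun r => 1 * (1 * qt r + 1 * Derive v r) + 1 * (eps p * wr r + nu p * wnu r)));
    [| exact Hr | intros x _; unfold hydro_combination; ring].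
  rewrite !dr_lincomb; try lra; try assumption; now apply ex_derive_lincomb.
Qed.

(** The height tends to 1 at infinity; without zeros it keeps this sign. *)
Lemma smooth_profile_height_pos (p : params) (zeta q : R -> R) : 0 < eps p < 1 ->
  (forall r, Rad p < r ->
     ex_derive zeta r /\ ex_derive q r /\ ex_derive (Derive q) r /\ height p zeta r <> 0) ->
  is_lim zeta p_infty 0 -> smooth_profile p zeta q.
Proof.
  intros He Hreg Hlim r Hr. destruct (Hreg r Hr) as [H1 [H2 [H3 H4]]].
  split; [exact H1 | split; [exact H2 | split; [exact H3 |]]].
  apply Rnot_le_lt. intros Hle.
  destruct (is_lim_p_infty_0_inv zeta 1 Hlim Rlt_0_1) as [M HM].
  set (x := Rmax M r + 1).
  assert (Hx1 : M < x) by (unfold x; generalize (Rmax_l M r); lra).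
  assert (Hx2 : r < x) by (unfold x; generalize (Rmax_r M r); lra).
  specialize (HM x Hx1). apply Rabs_def2 in HM.
  destruct (Ranalysis5.IVT_interv (height p zeta) r x) as [z [Hz Hz0]].
  - intros a Ha. apply continuity_pt_filterlim.
    apply (ex_derive_continuous (V := R_NormedModule)).
    eexists; apply is_derive_height, Hreg; lra.
  - exact Hx2.
  - lra.
  - unfold height. nra.
  - apply (Hreg z); [lra | exact Hz0].
Qed.

(** * Time derivatives and traces on the contact line *)

Lemma Rbar_lt_open (t : R) (T : Rbar) : Rbar_lt t T ->
  exists d, 0 < d /\ forall s, s < t + d -> Rbar_lt s T.
Proof.
  destruct T as [T | |]; simpl; intros Ht.
  - exists (T - t). split; [lra |]. intros; lra.
  - exists 1. split; [lra | trivial].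
  - destruct Ht.
Qed.

Lemma Rbar_lt_trans_le (s t : R) (T : Rbar) : s <= t -> Rbar_lt t T -> Rbar_lt s T.
Proof. destruct T; simpl; intros; trivial; lra. Qed.

Lemma Dt_pos (f : R -> R) (t : R) : 0 < t -> Dt f t = Derive f t.
Proof. intros Ht. unfold Dt. destruct (Rlt_dec 0 t); [reflexivity | contradiction]. Qed.

Lemma dt_pos (f : R -> R -> R) (t r : R) : 0 < t -> dt f t r = Derive (fun s => f s r) t.
Proof. apply Dt_pos. Qed.

Lemma continuous_up_to_boundary_modulus (p : params) (T : Rbar) (f : R -> R -> R) :
  continuous_up_to_boundary p T f ->
  exists g : R -> R -> R,
    (forall t r, 0 <= t -> Rbar_lt t T -> Rad p < r -> f t r = g t r) /\
    (forall t r e, 0 <= t -> Rbar_lt t T -> Rad p <= r -> 0 < e ->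
       exists d, 0 < d /\ forall s x, 0 <= s -> Rad p <= x ->
         Rabs (s - t) < d -> Rabs (x - r) < d -> Rabs (g s x - g t r) < e).
Proof.
  intros [g [Hfg Hg]]. exists g. split; [exact Hfg |].
  intros t r e Ht HtT Hr He.
  specialize (Hg t r Ht HtT Hr).
  apply (proj1 (filterlim_locally _ _)) with (eps := mkposreal e He) in Hg.
  destruct Hg as [d Hd]. exists d. split; [apply cond_pos |].
  intros s x Hs Hx Hst Hxr. apply (Hd (s, x)).
  - split; [exact Hst | exact Hxr].
  - split; [exact Hs | exact Hx].
Qed.

Lemma filterlim_at_right_intro (x l : R) (f : R -> R) :
  (forall e, 0 < e -> exists d, 0 < d /\
     forall y, x < y -> Rabs (y - x) < d -> Rabs (f y - l) < e) ->
  filterlim f (at_right x) (locally l).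
Proof.
  intros H. apply filterlim_locally. intros e.
  destruct (H e (cond_pos e)) as [d [Hd Hfd]].
  exists (mkposreal d Hd). intros y Hy Hxy. now apply Hfd.
Qed.

(** The joint modulus of continuity in time and radius, which is uniform near the
    contact line, is what lets the traces inherit continuity and differentiability in
    time. *)
Lemma trace_modulus (p : params) (T : Rbar) (f : R -> R -> R) (t : R) :
  continuous_up_to_boundary p T f -> 0 <= t -> Rbar_lt t T ->
  filterlim (f t) (at_right (Rad p)) (locally (lim_right (Rad p) (f t))) /\
  forall e, 0 < e -> exists d, 0 < d /\
    forall s x, 0 <= s -> Rbar_lt s T -> Rad p < x ->
      Rabs (s - t) < d -> Rabs (x - Rad p) < d ->
      Rabs (f s x - lim_right (Rad p) (f t)) < e.
Proof.
  intros Hf Ht HtT.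
  destruct (continuous_up_to_boundary_modulus p T f Hf) as [g [Hfg Hg]].
  assert (Hlim : filterlim (f t) (at_right (Rad p)) (locally (g t (Rad p)))).
  { apply filterlim_at_right_intro. intros e He.
    destruct (Hg t (Rad p) e Ht HtT (Rle_refl _) He) as [d [Hd Hgd]].
    exists d. split; [exact Hd |]. intros y Hy Hyd. rewrite Hfg by assumption.
    apply Hgd; try lra. replace (t - t) with 0 by ring. now rewrite Rabs_R0. }
  rewrite (lim_right_eq _ _ _ Hlim). split; [exact Hlim |].
  intros e He. destruct (Hg t (Rad p) e Ht HtT (Rle_refl _) He) as [d [Hd Hgd]].
  exists d. split; [exact Hd |]. intros s x Hs HsT Hx Hst Hxr.
  rewrite Hfg by assumption. apply Hgd; lra.
Qed.

Lemma trace_lim (p : params) (T : Rbar) (f : R -> R -> R) (t : R) :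
  continuous_up_to_boundary p T f -> 0 <= t -> Rbar_lt t T ->
  filterlim (f t) (at_right (Rad p)) (locally (lim_right (Rad p) (f t))).
Proof. intros Hf Ht HtT. apply (trace_modulus p T f t Hf Ht HtT). Qed.

Lemma lim_at_right_le (x l c e d : R) (f : R -> R) : 0 < d ->
  (forall y, x < y -> Rabs (y - x) < d -> Rabs (f y - c) <= e) ->
  filterlim f (at_right x) (locally l) -> Rabs (l - c) <= e.
Proof.
  intros Hd Hf Hl.
  assert (Hlim : filterlim (fun y => Rabs (f y - c)) (at_right x) (locally (Rabs (l - c)))).
  { apply (filterlim_continuous_comp (at_right x) (fun y => f y - c) Rabs (l - c)).
    - apply (filterlim_Rplus (at_right x)); [exact Hl | apply filterlim_const].
    - apply continuity_pt_filterlim, Rcontinuity_abs. }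
  apply (@filterlim_le _ (at_right x) _ (fun y => Rabs (f y - c)) (fun _ => e)
           (Rabs (l - c)) e); [| exact Hlim | apply filterlim_const].
  exists (mkposreal d Hd). intros y Hy Hxy. now apply Hf.
Qed.

Lemma trace_continuous (p : params) (T : Rbar) (f : R -> R -> R) :
  continuous_up_to_boundary p T f ->
  continuous_on_time T (fun t => lim_right (Rad p) (f t)).
Proof.
  intros Hf t Ht HtT. apply filterlim_locally. intros e.
  destruct (trace_modulus p T f t Hf Ht HtT) as [_ Hmod].
  destruct (Hmod (e / 2) ltac:(generalize (cond_pos e); lra)) as [d [Hd Hfd]].
  destruct (Rbar_lt_open t T HtT) as [d' [Hd' HT]].
  exists (mkposreal (Rmin d d') (Rmin_pos _ _ Hd Hd')). intros s Hs Hs0.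
  change (Rabs (s - t) < Rmin d d') in Hs.
  assert (H1 := Rlt_le_trans _ _ _ Hs (Rmin_l _ _)).
  assert (H2 := Rlt_le_trans _ _ _ Hs (Rmin_r _ _)). apply Rabs_def2 in H2.
  assert (HsT : Rbar_lt s T) by (apply HT; lra).
  apply Rle_lt_trans with (e / 2); [| generalize (cond_pos e); lra].
  apply lim_at_right_le with (x := Rad p) (d := d) (f := f s);
    [exact Hd | | now apply trace_lim with T].
  intros y Hy Hyd. left. now apply Hfd.
Qed.

(** By the mean value theorem in time, the difference quotients of [f] at any radius
    close to [Rad] are close to the trace of [dt f], uniformly in the radius, so the
    radius can tend to [Rad]. *)
Lemma trace_is_derive (p : params) (T : Rbar) (f : R -> R -> R) (t : R) :
  continuous_up_to_boundary p T f -> continuous_up_to_boundary p T (dt f) ->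
  (forall s r, 0 < s -> Rbar_lt s T -> Rad p < r -> ex_derive (fun u => f u r) s) ->
  0 < t -> Rbar_lt t T ->
  is_derive (fun s => lim_right (Rad p) (f s)) t (lim_right (Rad p) (dt f t)).
Proof.
  intros Hf Hdf Hder Ht HtT. apply is_derive_Reals. intros e He.
  destruct (trace_modulus p T (dt f) t Hdf (Rlt_le _ _ Ht) HtT) as [_ Hmod].
  destruct (Hmod (e / 2) ltac:(lra)) as [d [Hd Hfd]].
  destruct (Rbar_lt_open t T HtT) as [d' [Hd' HT]].
  assert (Hdd : 0 < Rmin d (Rmin d' t)) by (repeat apply Rmin_pos; assumption).
  exists (mkposreal _ Hdd). intros h Hh Hhd. simpl in Hhd.
  assert (H1 := Rlt_le_trans _ _ _ Hhd (Rmin_l _ _)).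
  assert (H2 := Rlt_le_trans _ _ _ Hhd (Rmin_r _ _)).
  assert (H3 := Rlt_le_trans _ _ _ H2 (Rmin_l _ _)).
  assert (H4 := Rlt_le_trans _ _ _ H2 (Rmin_r _ _)).
  apply Rabs_def2 in H3. apply Rabs_def2 in H4.
  assert (HthT : Rbar_lt (t + h) T) by (apply HT; lra).
  apply Rle_lt_trans with (e / 2); [| lra].
  apply lim_at_right_le with (x := Rad p) (d := d) (f := fun x => (f (t + h) x - f t x) / h);
    [exact Hd | |].
  - intros y Hy Hyd.
    destruct (MVT_gen (fun s => f s y) t (t + h) (fun s => dt f s y)) as [xi [Hxi Heq]].
    + intros s Hs. assert (0 < s /\ s < t + d').
      { destruct Hs as [Hs1 Hs2]. revert Hs1 Hs2.
        apply Rmin_case; apply Rmax_case; lra. }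
      rewrite dt_pos by lra. apply Derive_correct, Hder; [lra | apply HT; lra | exact Hy].
    + intros s Hs. assert (0 < s /\ s < t + d').
      { destruct Hs as [Hs1 Hs2]. revert Hs1 Hs2.
        apply Rmin_case; apply Rmax_case; lra. }
      apply continuity_pt_filterlim.
      apply (ex_derive_continuous (V := R_NormedModule) (fun s => f s y)).
      apply Hder; [lra | apply HT; lra | exact Hy].
    + replace (t + h - t) with h in Heq by ring.
      replace ((f (t + h) y - f t y) / h) with (dt f xi y)
        by (rewrite Heq; field; exact Hh).
      assert (0 < xi /\ xi < t + d' /\ Rabs (xi - t) < d).
      { destruct Hxi as [Hs1 Hs2]. apply Rabs_def2 in H1. revert Hs1 Hs2.
        apply Rmin_case; apply Rmax_case; intros; repeat split; try lra; apply Rabs_def1; lra. }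
      left. apply Hfd; try tauto; try lra. apply HT; lra.
  - apply (filterlim_Rmult (at_right (Rad p))); [| apply filterlim_const].
    apply (filterlim_Rplus (at_right (Rad p))); [apply trace_lim with T; trivial; lra |].
    apply (filterlim_continuous_comp (at_right (Rad p)) (f t) Ropp).
    + apply trace_lim with T; trivial; lra.
    + apply (ex_derive_continuous (V := R_NormedModule)). auto_derive. trivial.
Qed.

Lemma interior_modulus (p : params) (T : Rbar) (f : R -> R -> R) (t r e : R) :
  continuous_up_to_boundary p T f -> 0 < t -> Rbar_lt t T -> Rad p < r -> 0 < e ->
  exists d, 0 < d /\ forall s x, Rabs (s - t) < d -> Rabs (x - r) < d ->
    0 < s /\ Rbar_lt s T /\ Rad p < x /\ Rabs (f s x - f t r) < e.
Proof.
  intros Hf Ht HtT Hr He.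
  destruct (continuous_up_to_boundary_modulus p T f Hf) as [g [Hfg Hg]].
  destruct (Hg t r e (Rlt_le _ _ Ht) HtT (Rlt_le _ _ Hr) He) as [d1 [Hd1 Hgd]].
  destruct (Rbar_lt_open t T HtT) as [d2 [Hd2 HT]].
  exists (Rmin (Rmin d1 d2) (Rmin t (r - Rad p))).
  split; [repeat apply Rmin_pos; lra |].
  intros s x Hs Hx.
  assert (A1 := Rlt_le_trans _ _ _ Hs (Rmin_l _ _)).
  assert (A2 := Rlt_le_trans _ _ _ Hs (Rmin_r _ _)).
  assert (A3 := Rlt_le_trans _ _ _ A1 (Rmin_l _ _)).
  assert (A4 := Rlt_le_trans _ _ _ A1 (Rmin_r _ _)).
  assert (A5 := Rlt_le_trans _ _ _ A2 (Rmin_l _ _)).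
  assert (B1 := Rlt_le_trans _ _ _ Hx (Rmin_l _ _)).
  assert (B2 := Rlt_le_trans _ _ _ Hx (Rmin_r _ _)).
  assert (B3 := Rlt_le_trans _ _ _ B1 (Rmin_l _ _)).
  assert (B4 := Rlt_le_trans _ _ _ B2 (Rmin_r _ _)).
  apply Rabs_def2 in A4. apply Rabs_def2 in A5. apply Rabs_def2 in B4.
  assert (HsT : Rbar_lt s T) by (apply HT; lra).
  repeat split; try lra; try exact HsT.
  rewrite !Hfg; try lra; try assumption. apply Hgd; lra.
Qed.

Lemma interior_continuity_2d (p : params) (T : Rbar) (f : R -> R -> R) (t r : R) :
  continuous_up_to_boundary p T f -> 0 < t -> Rbar_lt t T -> Rad p < r ->
  continuity_2d_pt f t r.
Proof.
  intros Hf Ht HtT Hr e.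
  destruct (interior_modulus p T f t r e Hf Ht HtT Hr (cond_pos e)) as [d [Hd Hfd]].
  exists (mkposreal d Hd). intros s x Hs Hx. now apply Hfd.
Qed.

Lemma interior_locally_2d (p : params) (T : Rbar) (t r : R) :
  0 < t -> Rbar_lt t T -> Rad p < r ->
  locally_2d (fun s x => 0 < s /\ Rbar_lt s T /\ Rad p < x) t r.
Proof.
  intros Ht HtT Hr. destruct (Rbar_lt_open t T HtT) as [d2 [Hd2 HT]].
  assert (Hd : 0 < Rmin d2 (Rmin t (r - Rad p))) by (repeat apply Rmin_pos; lra).
  exists (mkposreal _ Hd). simpl. intros s x Hs Hx.
  assert (A1 := Rlt_le_trans _ _ _ Hs (Rmin_l _ _)).
  assert (A2 := Rlt_le_trans _ _ _ Hs (Rmin_r _ _)).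
  assert (A3 := Rlt_le_trans _ _ _ A2 (Rmin_l _ _)).
  assert (B2 := Rlt_le_trans _ _ _ Hx (Rmin_r _ _)).
  assert (B3 := Rlt_le_trans _ _ _ B2 (Rmin_r _ _)).
  apply Rabs_def2 in A1. apply Rabs_def2 in A3. apply Rabs_def2 in B3.
  repeat split; try lra. apply HT; lra.
Qed.

Lemma locally_time (T : Rbar) (t : R) : 0 < t -> Rbar_lt t T ->
  locally t (fun s => 0 < s /\ Rbar_lt s T).
Proof.
  intros Ht HtT. destruct (Rbar_lt_open t T HtT) as [d [Hd HT]].
  exists (mkposreal _ (Rmin_pos _ _ Hd Ht)). intros s Hs.
  change (Rabs (s - t) < Rmin d t) in Hs.
  assert (A1 := Rlt_le_trans _ _ _ Hs (Rmin_l _ _)).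
  assert (A2 := Rlt_le_trans _ _ _ Hs (Rmin_r _ _)).
  apply Rabs_def2 in A1. apply Rabs_def2 in A2.
  split; [lra | apply HT; lra].
Qed.

(** The intermediate value theorem on [[0, t]]. *)
Lemma continuous_on_time_sign (T : Rbar) (f : R -> R) : 0 < f 0 ->
  continuous_on_time T f -> (forall t, 0 <= t -> Rbar_lt t T -> f t <> 0) ->
  forall t, 0 <= t -> Rbar_lt t T -> 0 < f t.
Proof.
  intros Hf0 Hc Hne t Ht HtT. apply Rnot_le_lt. intros Hle.
  assert (Hlt : f t < 0) by (generalize (Hne t Ht HtT); lra).
  assert (Ht' : 0 < t) by (destruct (Req_dec t 0) as [-> |]; lra).
  destruct (Ranalysis5.IVT_interv (fun s => - f (Rmax 0 s)) 0 t) as [z [Hz Hz0]].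
  (* [Rmax 0] extends [f] continuously to negative times *)
  - intros a Ha. apply continuity_pt_opp with (f := fun s => f (Rmax 0 s)).
    apply continuity_pt_filterlim.
    rewrite Rmax_right by lra.
    apply filterlim_comp with (2 := Hc a (proj1 Ha) (Rbar_lt_trans_le _ _ _ (proj2 Ha) HtT)).
    intros Q [d HQ]. exists d. intros y Hy. apply HQ; [| apply Rmax_l].
    change (Rabs (Rmax 0 y - a) < d). change (Rabs (y - a) < d) in Hy.
    apply Rabs_def2 in Hy. apply Rabs_def1; apply Rmax_case_strong; lra.
  - exact Ht'.
  - rewrite Rmax_right by lra. lra.
  - rewrite Rmax_right by lra. lra.
  - rewrite Rmax_right in Hz0 by lra.
    apply (Hne z (proj1 Hz)); [| lra]. apply (Rbar_lt_trans_le _ _ _ (proj2 Hz) HtT).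
Qed.

(** Mass conservation and the symmetry of the second derivatives of [q]. *)
Lemma dt_dt_elevation (p : params) (T : Rbar) (zeta q : R -> R -> R) (t r : R) :
  0 < Rad p -> regular_exterior p T zeta q ->
  (forall s x, 0 < s -> Rbar_lt s T -> Rad p < x -> dt zeta s x + dr (q s) x = 0) ->
  0 < t -> Rbar_lt t T -> Rad p < r ->
  dt (dt zeta) t r = - dr (dt q t) r.
Proof.
  intros HR [Hreg [Hcub _]] Hmass Ht HtT Hr.
  destruct Hcub as [_ [_ [Hc3 [_ [_ [_ [_ [Hc8 [Hc9 _]]]]]]]]].
  assert (Hmix : forall s x, 0 < s -> Rbar_lt s T -> Rad p < x ->
            is_derive (fun u => Derive (q u) x) s (- dt (dt zeta) s x - dt q s x / x)).
  { intros s x Hs HsT Hx.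
    destruct (Hreg s x Hs HsT Hx) as [_ [H2 [_ [_ [_ [H6 _]]]]]].
    apply (is_derive_ext_loc (fun u => - dt zeta u x - q u x / x)).
    - apply filter_imp with (2 := locally_time T s Hs HsT). intros u [Hu HuT].
      assert (H := Hmass u x Hu HuT Hx). unfold dr in H. lra.
    - apply (is_derive_minus (V := R_NormedModule)
               (fun u => - dt zeta u x) (fun u => q u x / x)).
      + apply (is_derive_opp (V := R_NormedModule) (fun u => dt zeta u x)).
        rewrite dt_pos by exact Hs. now apply Derive_correct.
      + apply (is_derive_scal_l (V := R_NormedModule) (fun u => q u x) s (dt q s x) (/ x)).
        rewrite dt_pos by exact Hs. now apply Derive_correct. }
  assert (Heq : Derive (fun u => Derive (q u) r) t = Derive (dt q t) r).
  { transitivity (Derive (fun z => Derive (fun u => q u z) t) r).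
    2: { apply Derive_ext. intros z. now rewrite dt_pos. }
    apply Schwarz.
    - destruct (interior_locally_2d p T t r Ht HtT Hr) as [d Hd].
      exists d. intros s x Hs Hx. destruct (Hd s x Hs Hx) as [Hs' [HsT Hx']].
      destruct (Hreg s x Hs' HsT Hx') as [_ [_ [_ [H4 [_ [H6 [H7 _]]]]]]].
      split; [exact H6 | split; [exact H4 | split]].
      + eexists. now apply Hmix.
      + apply ex_derive_ext with (2 := H7). intros z. now apply dt_pos.
    - apply continuity_2d_pt_ext_loc with
        (f := fun s x => - dt (dt zeta) s x - dt q s x * / x).
      + destruct (interior_locally_2d p T t r Ht HtT Hr) as [d Hd].
        exists d. intros s x Hs Hx. destruct (Hd s x Hs Hx) as [Hs' [HsT Hx']].
        symmetry. apply is_derive_unique. now apply Hmix.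
      + apply continuity_2d_pt_minus.
        * apply continuity_2d_pt_opp. now apply interior_continuity_2d with p T.
        * apply continuity_2d_pt_mult; [now apply interior_continuity_2d with p T |].
          apply continuity_2d_pt_inv; [apply continuity_2d_pt_id2 | lra].
    - apply continuity_2d_pt_ext_loc with (f := Dr (dt q)).
      + destruct (interior_locally_2d p T t r Ht HtT Hr) as [d Hd].
        exists d. intros s x Hs Hx. destruct (Hd s x Hs Hx) as [Hs' [HsT Hx']].
        apply Derive_ext. intros z. now apply dt_pos.
      + now apply interior_continuity_2d with p T. }
  assert (H := is_derive_unique _ _ _ (Hmix t r Ht HtT Hr)). simpl in H.
  unfold dr. rewrite <- Heq.
  replace (Derive (fun u => Derive (q u) r) t) with (- dt (dt zeta) t r - dt q t r / r)
    by (symmetry; exact H). ring.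
Qed.

(** * The exterior flow *)

Lemma src1_decay (p : params) (zeta q : R -> R) :
  is_lim zeta p_infty 0 -> is_lim q p_infty 0 -> is_lim (Derive q) p_infty 0 ->
  is_lim (src1 p zeta q) p_infty 0.
Proof.
  intros Hz Hq Hq'.
  assert (Hinv : is_lim (fun r => / r) p_infty 0).
  { apply is_lim_p_infty_0. intros e He. exists (Rmax 1 (/ e)). intros x Hx.
    assert (H1 := Rle_lt_trans _ _ _ (Rmax_l _ _) Hx).
    assert (H2 := Rle_lt_trans _ _ _ (Rmax_r _ _) Hx).
    rewrite Rabs_pos_eq by (left; apply Rinv_0_lt_compat; lra).
    rewrite <- (Rinv_inv e). apply Rinv_lt_contravar; [| exact H2].
    apply Rmult_lt_0_compat; [now apply Rinv_0_lt_compat | lra]. }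
  set (F := Rbar_locally' p_infty).
  apply is_lim_ext with (f := fun r =>
    zeta r + (- nu p * (Derive q r + q r * / r)
              + eps p * (zeta r * zeta r * / 2 + q r * q r * / (1 + eps p * zeta r)))).
  { intros r. unfold src1, ff, height, dr, Rdiv. ring. }
  replace 0 with (0 + (- nu p * (0 + 0 * 0)
     + eps p * (0 * 0 * / 2 + 0 * 0 * / (1 + eps p * 0)))) by (field; lra).
  apply (filterlim_Rplus F); [exact Hz |].
  apply (filterlim_Rplus F); apply (filterlim_Rscal F); apply (filterlim_Rplus F).
  - exact Hq'.
  - now apply (filterlim_Rmult F).
  - apply (filterlim_Rmult F); [now apply (filterlim_Rmult F) | apply filterlim_const].
  - apply (filterlim_Rmult F); [now apply (filterlim_Rmult F) |].
    apply (filterlim_Rinv F); [lra |].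
    apply (filterlim_Rplus F); [apply filterlim_const |].
    now apply (filterlim_Rscal F).
Qed.

Lemma regular_exterior_profile (p : params) (T : Rbar) (zeta q : R -> R -> R) (t : R) :
  0 < eps p < 1 -> regular_exterior p T zeta q -> exterior_nonvanishing p T zeta ->
  0 < t -> Rbar_lt t T -> smooth_profile p (zeta t) (q t).
Proof.
  intros He [Hreg [_ [[Hz _] _]]] Hne Ht HtT.
  apply smooth_profile_height_pos; [exact He | | now apply Hz; [lra |]].
  intros r Hr. destruct (Hreg t r Ht HtT Hr) as [_ [_ [H3 [H4 [H5 _]]]]].
  split; [exact H3 | split; [exact H4 | split; [exact H5 |]]].
  apply (Hne t (Rlt_le _ _ Ht) HtT); exact Hr.
Qed.

Lemma trace_height_neq_0 (p : params) (T : Rbar) (zeta : R -> R -> R) (t : R) :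
  continuous_up_to_boundary p T zeta -> exterior_nonvanishing p T zeta ->
  0 <= t -> Rbar_lt t T -> 1 + eps p * lim_right (Rad p) (zeta t) <> 0.
Proof.
  intros Hz Hne Ht HtT. destruct (Hne t Ht HtT) as [_ H].
  rewrite (lim_right_eq (Rad p) (height p (zeta t))
             (1 + eps p * lim_right (Rad p) (zeta t))) in H; [exact H |].
  apply (filterlim_Rplus (at_right (Rad p))); [apply filterlim_const |].
  apply (filterlim_Rscal (at_right (Rad p))). now apply trace_lim with T.
Qed.

(** The choice operator in [frakR1] and [frakR0] meets its specification since
    [regular_exterior] provides solutions. *)
Lemma exterior_resolvents (p : params) (T : Rbar) (zeta q : R -> R -> R) (t : R) :
  regular_exterior p T zeta q -> 0 < t -> Rbar_lt t T ->
  is_frakR1 p (src1 p (zeta t) (q t)) (frakR1 p (src1 p (zeta t) (q t))) /\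
  is_frakR0 p (src_r p (zeta t) (q t)) (frakR0 p (src_r p (zeta t) (q t))) /\
  is_frakR0 p (src_nu p (zeta t) (q t)) (frakR0 p (src_nu p (zeta t) (q t))).
Proof.
  intros [_ [_ [_ Hex]]] Ht HtT. destruct (Hex t Ht HtT) as [H1 [H2 H3]].
  unfold frakR1, frakR0. split; [| split]; now apply epsilon_spec.
Qed.

(** The combination solves the homogeneous equation and decays. At [Rad] it keeps
    only the trace of [dt q], because [frakR0] vanishes there and [frakR1] has a
    vanishing derivative. *)
Lemma exterior_hydro_combination (p : params) (T : Rbar) (zeta q : R -> R -> R) (t r : R) :
  standing_params p -> regular_exterior p T zeta q -> exterior_nonvanishing p T zeta ->
  0 < t -> Rbar_lt t T ->
  (forall x, Rad p < x -> momentum_residual p (zeta t) (q t) (dt q t) x = 0) ->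
  Rad p < r ->
  hydro_combination p (dt q t) (frakR1 p (src1 p (zeta t) (q t)))
    (frakR0 p (src_r p (zeta t) (q t))) (frakR0 p (src_nu p (zeta t) (q t))) r
  = lim_right (Rad p) (dt q t) * (K1 (r / kappa p) / K1 (Rad p / kappa p)).
Proof.
  intros [He [Hnu [Hk [_ [HR _]]]]] Hreg Hne Ht HtT Hres Hr.
  assert (Hprof := regular_exterior_profile p T zeta q t He Hreg Hne Ht HtT).
  destruct (exterior_resolvents p T zeta q t Hreg Ht HtT) as [Hv [Hwr Hwnu]].
  destruct Hreg as [Hreg [Hcub [[Hz0 [Hq0 [Hq0' Hqt0]]] _]]].
  destruct Hcub as [_ [_ [_ [_ [_ [_ [_ [Hcqt _]]]]]]]].
  set (v := frakR1 p (src1 p (zeta t) (q t))) in *.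
  set (wr := frakR0 p (src_r p (zeta t) (q t))) in *.
  set (wnu := frakR0 p (src_nu p (zeta t) (q t))) in *.
  apply helmholtz_homogeneous; [exact HR | lra | | | | exact Hr].
  - apply helmholtz_ext with (w := hydro_combination p (dt q t) v wr wnu)
      (f := momentum_residual p (zeta t) (q t) (dt q t)); [reflexivity | exact Hres |].
    apply hydro_combination_helmholtz; trivial; [lra |].
    intros x Hx. destruct (Hreg t x Ht HtT Hx) as [_ [_ [_ [_ [_ [_ [H7 H8]]]]]]].
    now split.
  - apply filterlim_at_right_ext with
      (f := fun r => dt q t r + Derive v r + eps p * wr r + nu p * wnu r);
      [reflexivity |].
    replace (lim_right (Rad p) (dt q t))
      with (lim_right (Rad p) (dt q t) + 0 + eps p * 0 + nu p * 0) by ring.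
    set (F := at_right (Rad p)).
    apply (filterlim_Rplus F); [apply (filterlim_Rplus F); [apply (filterlim_Rplus F) |] |].
    + apply trace_lim with T; trivial; lra.
    + exact (proj1 (proj2 Hv)).
    + apply (filterlim_Rscal F). exact (proj1 (proj2 Hwr)).
    + apply (filterlim_Rscal F). exact (proj1 (proj2 Hwnu)).
  - set (F := Rbar_locally' p_infty).
    change (filterlim (fun r => dt q t r + Derive v r + eps p * wr r + nu p * wnu r)
              F (locally 0)).
    replace 0 with (0 + 0 + eps p * 0 + nu p * 0) by ring.
    apply (filterlim_Rplus F); [apply (filterlim_Rplus F); [apply (filterlim_Rplus F) |] |].
    + apply (Hqt0 t); [lra | exact HtT].
    + apply frakR1_derive_decay with (2 := Hk) (3 := Hv); [exact HR |].
      assert (Ht0 : 0 <= t) by lra.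
      apply src1_decay; [now apply Hz0 | now apply Hq0 | exact (Hq0' t Ht0 HtT)].
    + apply (filterlim_Rscal F). exact (proj2 (proj2 Hwr)).
    + apply (filterlim_Rscal F). exact (proj2 (proj2 Hwnu)).
Qed.

(** [f_hyd_identity] for the explicit combination: [dr (K1 (r / kappa))] is
    [- K0 (r / kappa) / kappa], which produces [G], and mass conservation turns
    [- dr q] and [- dr (dt q)] into time derivatives of [zeta]. *)
Lemma exterior_f_hyd_trace (p : params) (T : Rbar) (zeta q : R -> R -> R) (t : R) :
  standing_params p -> regular_exterior p T zeta q -> exterior_nonvanishing p T zeta ->
  0 < t -> Rbar_lt t T ->
  (forall s x, 0 < s -> Rbar_lt s T -> Rad p < x -> dt zeta s x + dr (q s) x = 0) ->
  (forall x, Rad p < x -> momentum_residual p (zeta t) (q t) (dt q t) x = 0) ->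
  filterlim (f_hyd p (zeta t) (q t)) (at_right (Rad p))
    (locally (kappa p ^ 2 * lim_right (Rad p) (dt (dt zeta) t)
              + lim_right (Rad p) (zeta t) + nu p * lim_right (Rad p) (dt zeta t)
              + eps p * (lim_right (Rad p) (zeta t) ^ 2 / 2
                         + lim_right (Rad p) (q t) ^ 2
                           / (1 + eps p * lim_right (Rad p) (zeta t)))
              - kappa p * (2 / Rad p) * G p * lim_right (Rad p) (dt q t))).
Proof.
  intros Hp Hreg Hne Ht HtT Hmass Hres.
  assert (HW := exterior_hydro_combination p T zeta q t).
  assert (HW' : forall r, Rad p < r -> _) by
    (intros r Hr; exact (HW r Hp Hreg Hne Ht HtT Hres Hr)). clear HW.
  destruct Hp as [He [Hnu [Hk [_ [HR _]]]]].
  assert (Hprof := regular_exterior_profile p T zeta q t He Hreg Hne Ht HtT).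
  assert (Htt : forall x, Rad p < x -> dt (dt zeta) t x = - dr (dt q t) x)
    by (intros x Hx; now apply dt_dt_elevation with p T).
  destruct (exterior_resolvents p T zeta q t Hreg Ht HtT) as [Hv [Hwr Hwnu]].
  destruct Hreg as [Hreg [Hcub _]].
  destruct Hcub as [Hcz [Hczt [Hcztt [_ [Hcq [_ [_ [Hcqt _]]]]]]]].
  assert (Hhe := trace_height_neq_0 p T zeta t Hcz Hne (Rlt_le _ _ Ht) HtT).
  unfold f_hyd.
  set (v := frakR1 p (src1 p (zeta t) (q t))) in *.
  set (wr := frakR0 p (src_r p (zeta t) (q t))) in *.
  set (wnu := frakR0 p (src_nu p (zeta t) (q t))) in *.
  set (c := lim_right (Rad p) (dt q t)) in *.
  set (k1 := K1 (Rad p / kappa p)) in *.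
  assert (Hk1 : 0 < k1) by (apply K1_pos, Rdiv_lt_0_compat; lra).
  apply filterlim_at_right_ext with (f := fun r =>
    kappa p ^ 2 * dt (dt zeta) t r + zeta t r + nu p * dt zeta t r
    + eps p * (zeta t r * zeta t r * / 2 + q t r * q t r * / (1 + eps p * zeta t r))
    + - (kappa p * c / k1) * K0 (r / kappa p)).
  - intros r Hr.
    assert (Hdqt : ex_derive (dt q t) r) by now apply (Hreg t r Ht HtT Hr).
    rewrite (f_hyd_identity p (zeta t) (q t) (dt q t) v wr wnu r) by assumption.
    rewrite (dr_ext_gt (Rad p) r (hydro_combination p (dt q t) v wr wnu)
               (fun x => c / k1 * K1 (x / kappa p) + 0 * 0));
      [| exact Hr | intros x Hx; rewrite HW' by exact Hx; field; lra].
    rewrite (dr_lincomb (c / k1) 0 (fun x => K1 (x / kappa p)) (fun _ => 0));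
      [| lra | eexists; apply is_derive_K1_scaled; lra | apply ex_derive_const].
    rewrite dr_K1_scaled by lra. unfold src1, ff, height.
    assert (Hm := Hmass t r Ht HtT Hr). rewrite (Htt r Hr).
    replace (dt zeta t r) with (- dr (q t) r) by lra.
    destruct (Hprof r Hr) as [_ [_ [_ Hh]]]. unfold height in Hh. field. lra.
  - set (F := at_right (Rad p)).
    replace (_ - _) with
      (kappa p ^ 2 * lim_right (Rad p) (dt (dt zeta) t)
       + lim_right (Rad p) (zeta t) + nu p * lim_right (Rad p) (dt zeta t)
       + eps p * (lim_right (Rad p) (zeta t) * lim_right (Rad p) (zeta t) * / 2
                  + lim_right (Rad p) (q t) * lim_right (Rad p) (q t)
                    * / (1 + eps p * lim_right (Rad p) (zeta t)))
       + - (kappa p * c / k1) * K0 (Rad p / kappa p))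
      by (unfold G; fold k1; field; repeat split; trivial; lra).
    assert (Lz := trace_lim p T zeta t Hcz (Rlt_le _ _ Ht) HtT).
    assert (Lzt := trace_lim p T (dt zeta) t Hczt (Rlt_le _ _ Ht) HtT).
    assert (Lztt := trace_lim p T (dt (dt zeta)) t Hcztt (Rlt_le _ _ Ht) HtT).
    assert (Lq := trace_lim p T q t Hcq (Rlt_le _ _ Ht) HtT).
    apply (filterlim_Rplus F); [apply (filterlim_Rplus F); [apply (filterlim_Rplus F);
      [apply (filterlim_Rplus F) |] |] |].
    + now apply (filterlim_Rscal F).
    + exact Lz.
    + now apply (filterlim_Rscal F).
    + apply (filterlim_Rscal F), (filterlim_Rplus F).
      * apply (filterlim_Rmult F); [now apply (filterlim_Rmult F) | apply filterlim_const].
      * apply (filterlim_Rmult F); [now apply (filterlim_Rmult F) |].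
        apply (filterlim_Rinv F); [exact Hhe |].
        apply (filterlim_Rplus F); [apply filterlim_const |]. now apply (filterlim_Rscal F).
    + apply (filterlim_Rscal F).
      apply (filterlim_at_right_of_continuous (fun x => K0 (x / kappa p))).
      apply continuous_K0_scaled; lra.
Qed.

(** * The interior flow, the jump condition and the acceleration of the solid *)

Lemma disc_int_radial (rho : R) (f : R -> R) :
  disc_int rho f = 2 * PI * RInt (fun r => f r * r) 0 rho.
Proof.
  unfold disc_int. rewrite (RInt_const (V := R_CompleteNormedModule)).
  unfold scal; simpl; unfold mult; simpl. ring.
Qed.

Lemma is_RInt_parabola (rho A C : R) (f : R -> R) : 0 < rho ->
  (forall r, 0 < r < rho -> f r = (r ^ 2 - rho ^ 2) * A + C) ->
  is_RInt (fun r => f r * r) 0 rho (C * rho ^ 2 / 2 - A * rho ^ 4 / 4).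
Proof.
  intros Hrho Hf.
  apply (is_RInt_ext (V := R_NormedModule) (fun r => ((r ^ 2 - rho ^ 2) * A + C) * r)).
  { intros r. rewrite Rmin_left, Rmax_right by lra. intros Hr. now rewrite Hf. }
  set (prim := fun r : R => (r ^ 4 / 4 - rho ^ 2 * r ^ 2 / 2) * A + C * r ^ 2 / 2).
  replace (C * rho ^ 2 / 2 - A * rho ^ 4 / 4) with (minus (prim rho) (prim 0))
    by (unfold minus, plus, opp, prim; simpl; field).
  apply (is_RInt_derive (V := R_CompleteNormedModule) prim).
  - intros r _. unfold prim. auto_derive; [trivial | field].
  - intros r _. apply (ex_derive_continuous (V := R_NormedModule)). auto_derive. trivial.
Qed.

Lemma disc_mean_parabola (rho A C : R) (f : R -> R) : 0 < rho ->
  (forall r, 0 < r < rho -> f r = (r ^ 2 - rho ^ 2) * A + C) ->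
  disc_mean rho f = C - rho ^ 2 / 2 * A.
Proof.
  intros Hrho Hf. unfold disc_mean. rewrite !disc_int_radial.
  rewrite (is_RInt_unique (V := R_CompleteNormedModule) _ _ _ _
             (is_RInt_parabola rho A C f Hrho Hf)).
  rewrite (is_RInt_unique (V := R_CompleteNormedModule) _ _ _ _
             (is_RInt_parabola rho 0 1 (fun _ => 1) Hrho ltac:(intros; cbv beta; ring))).
  field. generalize PI_RGT_0. lra.
Qed.

Lemma locally_in (a b r : R) : a < r < b -> locally r (fun x => a < x < b).
Proof.
  intros [Ha Hb]. apply filter_and; [exact (open_gt a r Ha) | exact (open_lt b r Hb)].
Qed.

Lemma Derive_ext_in (a b r : R) (f g : R -> R) : a < r < b ->
  (forall x, a < x < b -> f x = g x) -> Derive f r = Derive g r.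
Proof.
  intros Hr Hfg. apply Derive_ext_loc, filter_imp with (2 := locally_in _ _ _ Hr), Hfg.
Qed.

Lemma ex_derive_ext_in (a b r : R) (f g : R -> R) : a < r < b ->
  (forall x, a < x < b -> f x = g x) -> ex_derive f r -> ex_derive g r.
Proof.
  intros Hr Hfg. apply ex_derive_ext_loc, filter_imp with (2 := locally_in _ _ _ Hr), Hfg.
Qed.

Lemma dr_ext_in (a b r : R) (f g : R -> R) : a < r < b ->
  (forall x, a < x < b -> f x = g x) -> dr f r = dr g r.
Proof.
  intros Hr Hfg. unfold dr. now rewrite (Derive_ext_in a b r f g Hr Hfg), (Hfg r Hr).
Qed.

Lemma filterlim_at_left_ext (a x l : R) (f g : R -> R) : a < x ->
  (forall y, a < y < x -> f y = g y) ->
  filterlim f (at_left x) (locally l) -> filterlim g (at_left x) (locally l).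
Proof.
  intros Ha Hfg. apply filterlim_ext_loc. unfold at_left, within.
  apply filter_imp with (2 := locally_gt a x Ha). intros y Hy Hyx. apply Hfg. lra.
Qed.

Lemma zero_derive_const (a b : R) (f : R -> R) :
  (forall x, a < x < b -> is_derive f x 0) ->
  forall x y, a < x < b -> a < y < b -> f x = f y.
Proof.
  intros Hf.
  assert (Hle : forall x y, a < x -> x <= y -> y < b -> f x = f y).
  { intros x y Hx Hxy Hy. apply Rle_antisym.
    - apply nondecreasing_of_derive_ge0 with (df := fun _ => 0); [exact Hxy | | intros; lra].
      intros z Hz. apply Hf. lra.
    - apply Ropp_le_cancel.
      apply nondecreasing_of_derive_ge0 with (f := fun z => - f z) (df := fun _ => 0);
        [exact Hxy | | intros; lra].
      intros z Hz. rewrite <- Ropp_0.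
      apply (is_derive_opp (V := R_NormedModule)), Hf. lra. }
  intros x y Hx Hy. destruct (Rle_lt_dec x y) as [H | H]; [apply Hle; lra |].
  symmetry. apply Hle; lra.
Qed.

(** [(r q)' = - r b], and the regularity at the centre fixes the constant of
    integration. *)
Lemma interior_discharge (rho b : R) (q : R -> R) :
  (forall r, 0 < r < rho -> ex_derive q r /\ dr q r = - b) ->
  filterlim q (at_right 0) (locally 0) ->
  forall r, 0 < r < rho -> q r = - (r / 2) * b.
Proof.
  intros Hq Hq0 r Hr.
  set (f := fun x : R => x * q x + x ^ 2 / 2 * b).
  assert (Hf : forall x, 0 < x < rho -> is_derive f x 0).
  { intros x Hx. destruct (Hq x Hx) as [H1 H2].
    replace 0 with ((q x + x * Derive q x) + x * b)
      by (unfold dr in H2; replace b with (- (Derive q x + q x / x)) by lra; field; lra).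
    apply (is_derive_plus (V := R_NormedModule) (fun x => x * q x) (fun x => x ^ 2 / 2 * b)).
    - now apply is_derive_id_mult, Derive_correct.
    - auto_derive; [trivial | field]. }
  assert (Hlim0 : filterlim f (at_right 0) (locally 0)).
  { replace 0 with (0 * 0 + 0 ^ 2 / 2 * b) at 2 by field.
    apply (filterlim_Rplus (at_right 0)).
    - apply (filterlim_Rmult (at_right 0)); [| exact Hq0].
      apply (filterlim_at_right_of_continuous (fun x => x)), continuous_id.
    - apply (filterlim_at_right_of_continuous (fun x : R => x ^ 2 / 2 * b)).
      apply (ex_derive_continuous (V := R_NormedModule)). auto_derive. trivial. }
  assert (Hlimr : filterlim f (at_right 0) (locally (f r))).
  { apply filterlim_at_right_intro. intros e He. exists r. split; [lra |].
    intros y Hy Hyr. apply Rabs_def2 in Hyr.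
    rewrite (zero_derive_const 0 rho f Hf y r) by lra.
    replace (f r - f r) with 0 by ring. now rewrite Rabs_R0. }
  assert (H := filterlim_locally_unique (V := R_NormedModule) (F := at_right 0) f _ _ Hlimr Hlim0).
  unfold f in H. apply Rmult_eq_reg_l with r; [| lra].
  replace (r * (- (r / 2) * b)) with (- (r ^ 2 / 2 * b)) by field. lra.
Qed.

Lemma interior_pressure (rho A : R) (P : R -> R) : 0 < rho ->
  (forall r, 0 < r < rho -> is_derive P r (2 * r * A)) ->
  exists C, forall r, 0 < r < rho -> P r = (r ^ 2 - rho ^ 2) * A + C.
Proof.
  intros Hrho HP. exists (P (rho / 2) - ((rho / 2) ^ 2 - rho ^ 2) * A).
  intros r Hr.
  enough (P r - r ^ 2 * A = P (rho / 2) - (rho / 2) ^ 2 * A) by lra.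
  apply (zero_derive_const 0 rho (fun x => P x - x ^ 2 * A)); [| exact Hr | lra].
  intros x Hx. replace 0 with (2 * x * A - 2 * x * A) by ring.
  apply (is_derive_minus (V := R_NormedModule) P (fun x => x ^ 2 * A)); [now apply HP |].
  auto_derive; [trivial | ring].
Qed.

Lemma dr_linear (c x : R) : x <> 0 -> dr (fun y => - (y / 2) * c) x = - c.
Proof.
  intros Hx. unfold dr. replace (Derive (fun y => - (y / 2) * c) x) with (- (c / 2)).
  - field; exact Hx.
  - symmetry. apply is_derive_unique. auto_derive; [trivial | field].
Qed.

(** A height constant in [r] and a discharge linear in [r] cancel the dispersive,
    gravity and viscous terms. The right-hand side is [- h] times the derivative of the
    parabola that appears as the interior pressure. *)
Lemma interior_momentum (p : params) (z q qt : R -> R) (b b' h r : R) :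
  0 < eps p -> h <> 0 -> 0 < r < Rad p ->
  (forall x, 0 < x < Rad p ->
     height p z x = h /\ q x = - (x / 2) * b /\ qt x = - (x / 2) * b') ->
  qt r - kappa p ^ 2 * Derive (dr qt) r
  + eps p * dr (fun x => q x ^ 2 / height p z x) r
  + height p z r * Derive z r
  - nu p * height p z r * Derive (fun x => dr q x / height p z x) r
  = - (h * (2 * r * ((b' / 2 - 3 * eps p * b ^ 2 / (4 * h)) / (2 * h)))).
Proof.
  intros He Hh Hr Hin.
  assert (Hdr : forall f c x, (forall y, 0 < y < Rad p -> f y = - (y / 2) * c) ->
            0 < x < Rad p -> dr f x = - c).
  { intros f c x Hf Hx. rewrite (dr_ext_in 0 (Rad p) x f (fun y => - (y / 2) * c) Hx Hf).
    apply dr_linear; lra. }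
  assert (Hqt : forall x, 0 < x < Rad p -> dr qt x = - b')
    by (intros x Hx; apply Hdr; [intros y Hy; apply (Hin y Hy) | exact Hx]).
  assert (Hq : forall x, 0 < x < Rad p -> dr q x = - b)
    by (intros x Hx; apply Hdr; [intros y Hy; apply (Hin y Hy) | exact Hx]).
  rewrite (Derive_ext_in 0 (Rad p) r (dr qt) (fun _ => - b') Hr Hqt), Derive_const.
  rewrite (Derive_ext_in 0 (Rad p) r z (fun _ => (h - 1) / eps p) Hr), Derive_const.
  2: { intros x Hx. destruct (Hin x Hx) as [<- _]. unfold height. field; lra. }
  rewrite (Derive_ext_in 0 (Rad p) r (fun x => dr q x / height p z x) (fun _ => - b / h) Hr),
    Derive_const.
  2: { intros x Hx. destruct (Hin x Hx) as [-> _]. now rewrite Hq. }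
  rewrite (dr_ext_in 0 (Rad p) r (fun x => q x ^ 2 / height p z x)
             (fun x => x ^ 2 * (b ^ 2 / (4 * h))) Hr).
  2: { intros x Hx. destruct (Hin x Hx) as [-> [-> _]]. field; exact Hh. }
  unfold dr. replace (Derive (fun x => x ^ 2 * (b ^ 2 / (4 * h))) r)
    with (2 * r * (b ^ 2 / (4 * h)))
    by (symmetry; apply is_derive_unique; auto_derive; [trivial | field; exact Hh]).
  destruct (Hin r Hr) as [-> [_ ->]]. field. lra.
Qed.

(** The quantity that the second transmission condition requires to be continuous. *)
Definition bernoulli (p : params) (zeta q P : R -> R -> R) (t r : R) : R :=
  P t r / eps p + zeta t r + nu p * dt zeta t r + kappa p ^ 2 * dt (dt zeta) t r
  + eps p / 2 * (q t r ^ 2 / height p (zeta t) r ^ 2).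

Lemma bernoulli_exterior_trace (p : params) (T : Rbar) (zeta q P : R -> R -> R) (t : R) :
  0 < eps p -> regular_exterior p T zeta q -> exterior_nonvanishing p T zeta ->
  0 <= t -> Rbar_lt t T -> (forall r, Rad p < r -> P t r = 0) ->
  filterlim (bernoulli p zeta q P t) (at_right (Rad p))
    (locally (lim_right (Rad p) (zeta t) + nu p * lim_right (Rad p) (dt zeta t)
              + kappa p ^ 2 * lim_right (Rad p) (dt (dt zeta) t)
              + eps p / 2 * (lim_right (Rad p) (q t) ^ 2
                             / (1 + eps p * lim_right (Rad p) (zeta t)) ^ 2))).
Proof.
  intros He [_ [Hcub _]] Hne Ht HtT HP.
  destruct Hcub as [Hcz [Hczt [Hcztt [_ [Hcq _]]]]].
  assert (Hhe := trace_height_neq_0 p T zeta t Hcz Hne Ht HtT).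
  set (F := at_right (Rad p)).
  assert (Hsq : forall (f : R -> R) l, filterlim f F (locally l) ->
            filterlim (fun r => f r ^ 2) F (locally (l ^ 2))).
  { intros f l Hf. apply (filterlim_continuous_comp F f (fun y => y ^ 2) l Hf).
    apply (ex_derive_continuous (V := R_NormedModule)). auto_derive. trivial. }
  apply filterlim_at_right_ext with (f := fun r =>
    zeta t r + nu p * dt zeta t r + kappa p ^ 2 * dt (dt zeta) t r
    + eps p / 2 * (q t r ^ 2 * / (1 + eps p * zeta t r) ^ 2)).
  - intros r Hr. unfold bernoulli, height. rewrite (HP r Hr). unfold Rdiv. ring.
  - apply (filterlim_Rplus F); [apply (filterlim_Rplus F); [apply (filterlim_Rplus F) |] |].
    + now apply trace_lim with T.
    + apply (filterlim_Rscal F). now apply trace_lim with T.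
    + apply (filterlim_Rscal F). now apply trace_lim with T.
    + apply (filterlim_Rscal F), (filterlim_Rmult F).
      * apply Hsq. now apply trace_lim with T.
      * apply (filterlim_Rinv F); [now apply pow_nonzero |].
        apply Hsq, (filterlim_Rplus F); [apply filterlim_const |].
        apply (filterlim_Rscal F). now apply trace_lim with T.
Qed.

Lemma bernoulli_interior_trace (p : params) (zeta q P : R -> R -> R)
  (t A C b z z1 z2 h : R) : 0 < Rad p -> h <> 0 ->
  (forall r, 0 < r < Rad p ->
     P t r / eps p = (r ^ 2 - Rad p ^ 2) * A + C /\ zeta t r = z /\
     dt zeta t r = z1 /\ dt (dt zeta) t r = z2 /\ q t r = - (r / 2) * b /\
     height p (zeta t) r = h) ->
  filterlim (bernoulli p zeta q P t) (at_left (Rad p))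
    (locally (C + z + nu p * z1 + kappa p ^ 2 * z2
              + eps p / 2 * ((Rad p / 2 * b) ^ 2 / h ^ 2))).
Proof.
  intros HR Hh Hin.
  apply filterlim_at_left_ext with (a := 0)
    (f := fun r => (r ^ 2 - Rad p ^ 2) * A + C + z + nu p * z1 + kappa p ^ 2 * z2
                   + eps p / 2 * ((r / 2 * b) ^ 2 / h ^ 2)); [exact HR | |].
  - intros r Hr. destruct (Hin r Hr) as [H1 [H2 [H3 [H4 [H5 H6]]]]].
    unfold bernoulli. rewrite H1, H2, H3, H4, H5, H6. field. exact Hh.
  - replace (C + z + nu p * z1 + kappa p ^ 2 * z2 + eps p / 2 * ((Rad p / 2 * b) ^ 2 / h ^ 2))
      with ((Rad p ^ 2 - Rad p ^ 2) * A + C + z + nu p * z1 + kappa p ^ 2 * z2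
            + eps p / 2 * ((Rad p / 2 * b) ^ 2 / h ^ 2)) by ring.
    apply (filterlim_at_left_of_continuous (fun r : R =>
      (r ^ 2 - Rad p ^ 2) * A + C + z + nu p * z1 + kappa p ^ 2 * z2
      + eps p / 2 * ((r / 2 * b) ^ 2 / h ^ 2))).
    apply (ex_derive_continuous (V := R_NormedModule)).
    auto_derive. trivial.
Qed.

Lemma G_pos (p : params) : 0 < Rad p -> 0 < kappa p -> 0 < G p.
Proof.
  intros HR Hk. unfold G. assert (H := Rdiv_lt_0_compat _ _ HR Hk).
  apply Rmult_lt_0_compat; [lra |].
  apply Rdiv_lt_0_compat; [now apply K0_pos | now apply K1_pos].
Qed.

(** The left-hand side is Newton's equation with the mean of the parabolic pressure,
    whose constant is the one given by the jump condition. Replacing [z4'] by the trace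
    identity makes it affine in the acceleration [b'], which collects the coefficient
    [tau2_of p Z + kappa p * G p > 0]: the inertia of the solid plus the added mass,
    [kappa p * G p] being the share of the dispersive boundary layer. *)
Lemma newton_iff_acceleration (p : params) (I F : R) (Z : vec4) (b' z4' : R) :
  standing_params p -> 0 < hi_of p Z -> he_of p Z <> 0 ->
  kappa p ^ 2 * z4' = I - eps p * ff_of p Z - Z3 Z - nu p * Z4 Z - kappa p * G p * b' ->
  (taub p ^ 2 * b' + mass p / eps p
   = Z3 Z - (hi_of p Z - 1) / eps p + nu p * (Z4 Z - Z2 Z) + kappa p ^ 2 * (z4' - b')
     + eps p / 2 * ((Rad p / 2 * Z2 Z) ^ 2 / he_of p Z ^ 2
                    - (Rad p / 2 * Z2 Z) ^ 2 / hi_of p Z ^ 2)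
     - Rad p ^ 2 / 2 * ((b' / 2 - 3 * eps p * Z2 Z ^ 2 / (4 * hi_of p Z)) / (2 * hi_of p Z))
     + F
   <-> b' = DD p I Z F).
Proof.
  intros [He [_ [Hk [_ [HR [_ [Htau Hm]]]]]]] Hhi Hhe Hz4.
  assert (HG := G_pos p HR (proj1 Hk)).
  set (den := tau2_of p Z + kappa p * G p).
  set (num := I - eps p * ff_of p Z - Z1 Z - nu p * Z2 Z + eps p * a_of p Z * Z2 Z ^ 2 + F).
  assert (Hden : 0 < den).
  { unfold den, tau2_of.
    assert (0 < kappa p * G p) by (apply Rmult_lt_0_compat; lra).
    assert (0 < Rad p ^ 2 / (8 * hi_of p Z)) by (apply Rdiv_lt_0_compat; [apply pow_lt |]; lra).
    generalize (pow2_ge_0 (taub p)) (pow2_ge_0 (kappa p)). lra. }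
  change (DD p I Z F) with (num / den).
  (* [den * b' = num] is Newton's equation multiplied out *)
  match goal with |- (?l = ?r <-> _) => assert (Hid : l - r = den * b' - num) end.
  { replace (kappa p ^ 2 * (z4' - b')) with (kappa p ^ 2 * z4' - kappa p ^ 2 * b') by ring.
    rewrite Hz4, Hm. unfold num, den, tau2_of, a_of, ff_of.
    replace (hi_of p Z - 1) with (hieq p + eps p * Z1 Z - 1) by reflexivity.
    set (hi := hi_of p Z) in *. set (he := he_of p Z) in *.
    field. repeat split; trivial; lra. }
  split; intros H.
  - apply Rmult_eq_reg_l with den; [| lra].
    replace (den * (num / den)) with num by (field; lra). lra.
  - assert (den * b' = num) by (rewrite H; field; lra). lra.
Qed.

Lemma continuous_on_time_eq_0 (T : Rbar) (f g : R -> R) : Rbar_lt 0 T ->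
  continuous_on_time T f -> continuous_on_time T g ->
  (forall t, 0 < t -> Rbar_lt t T -> f t = g t) -> f 0 = g 0.
Proof.
  intros HT Hf Hg Hfg.
  assert (Hr : forall h : R -> R, continuous_on_time T h ->
            filterlim h (at_right 0) (locally (h 0))).
  { intros h Hh. apply filterlim_filter_le_1 with (2 := Hh 0 (Rle_refl 0) HT).
    intros Q [d Hd]. exists d. intros y Hy Hy0. apply Hd; [exact Hy | lra]. }
  apply (filterlim_locally_unique (V := R_NormedModule) (F := at_right 0) f);
    [now apply Hr |].
  apply filterlim_ext_loc with (2 := Hr g Hg).
  destruct (Rbar_lt_open 0 T HT) as [d [Hd HTd]].
  exists (mkposreal d Hd). intros y Hy Hy0. symmetry. apply Hfg; [exact Hy0 |].
  apply HTd. apply Rabs_def2 in Hy. unfold minus, plus, opp in Hy; simpl in Hy. lra.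
Qed.

Lemma continuous_on_time_affine (T : Rbar) (a c : R) (f : R -> R) :
  continuous_on_time T f -> continuous_on_time T (fun t => a + c * f t).
Proof.
  intros Hf t Ht HtT. set (F := within (fun s => 0 <= s) (locally t)).
  apply (filterlim_Rplus F); [apply filterlim_const |].
  apply (filterlim_Rscal F). now apply Hf.
Qed.

Lemma dt_ext_time (T : Rbar) (f : R -> R -> R) (g : R -> R) (t r : R) :
  (forall s, 0 < s -> Rbar_lt s T -> f s r = g s) -> 0 < t -> Rbar_lt t T ->
  dt f t r = Derive g t.
Proof.
  intros Hfg Ht HtT. rewrite dt_pos by exact Ht.
  apply Derive_ext_loc, filter_imp with (2 := locally_time T t Ht HtT).
  intros s [Hs HsT]. now apply Hfg.
Qed.

Lemma dt_ext_in_space (f g : R -> R -> R) (r : R) :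
  (forall s, f s r = g s r) -> forall t, dt f t r = dt g t r.
Proof.
  intros Hfg t. unfold dt. f_equal. apply functional_extensionality, Hfg.
Qed.

(** The system is differential, so that on each side of the contact line it sees only
    the corresponding piece of a glued function. *)
Lemma BA_local (p : params) (a b t r : R) (zeta q P zeta' q' P' : R -> R -> R) :
  a < r < b ->
  (forall s x, a < x < b -> zeta s x = zeta' s x) ->
  (forall s x, a < x < b -> q s x = q' s x) ->
  (forall s x, a < x < b -> P s x = P' s x) ->
  BA_defined zeta q P t r /\ BA_equations p zeta q P t r ->
  BA_defined zeta' q' P' t r /\ BA_equations p zeta' q' P' t r.
Proof.
  intros Hr Hz Hq HP [[D1 [D2 [D3 [D4 [D5 [D6 [D7 D8]]]]]]] [E1 E2]].
  assert (Hdtq : forall x, a < x < b -> dt q t x = dt q' t x).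
  { intros x Hx. apply dt_ext_in_space. intros s; now apply Hq. }
  assert (Hdrq : forall x, a < x < b -> dr (q t) x = dr (q' t) x).
  { intros x Hx. apply dr_ext_in with a b; [exact Hx | apply Hq]. }
  assert (Hdrdtq : forall x, a < x < b -> dr (dt q t) x = dr (dt q' t) x).
  { intros x Hx. apply dr_ext_in with a b; [exact Hx | exact Hdtq]. }
  assert (Hdtz : dt zeta t r = dt zeta' t r).
  { apply dt_ext_in_space. intros s; now apply Hz. }
  assert (Hh : forall x, a < x < b -> height p (zeta t) x = height p (zeta' t) x).
  { intros x Hx. unfold height. now rewrite Hz. }
  split; [repeat apply conj |].
  - apply ex_derive_ext with (2 := D1). intros s; now apply Hz.
  - exact (ex_derive_ext_in a b r _ _ Hr (Hz t) D2).
  - exact (ex_derive_ext_in a b r _ _ Hr (Hq t) D3).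
  - exact (ex_derive_ext_in a b r _ _ Hr Hdrq D4).
  - apply ex_derive_ext with (2 := D5). intros s; now apply Hq.
  - exact (ex_derive_ext_in a b r _ _ Hr Hdtq D6).
  - exact (ex_derive_ext_in a b r _ _ Hr Hdrdtq D7).
  - exact (ex_derive_ext_in a b r _ _ Hr (HP t) D8).
  - split; cbv zeta in *.
    + rewrite <- Hdtz, <- Hdrq by exact Hr. exact E1.
    + rewrite <- Hdtq, <- Hh by exact Hr.
      rewrite <- (Derive_ext_in a b r _ _ Hr Hdrdtq), <- (Derive_ext_in a b r _ _ Hr (Hz t)).
      rewrite <- (dr_ext_in a b r (fun x => q t x ^ 2 / height p (zeta t) x)
                    (fun x => q' t x ^ 2 / height p (zeta' t) x) Hr)
        by (intros x Hx; now rewrite Hq, Hh).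
      rewrite <- (Derive_ext_in a b r (fun x => P t x / eps p) (fun x => P' t x / eps p) Hr)
        by (intros x Hx; now rewrite HP).
      rewrite <- (Derive_ext_in a b r (fun x => dr (q t) x / height p (zeta t) x)
                    (fun x => dr (q' t) x / height p (zeta' t) x) Hr)
        by (intros x Hx; now rewrite Hdrq, Hh).
      exact E2.
Qed.

Lemma glue_in (rho t r : R) (f g : R -> R -> R) : r < rho -> glue rho f g t r = f t r.
Proof. intros Hr. unfold glue. destruct (Rlt_dec r rho); [reflexivity | lra]. Qed.

Lemma glue_out (rho t r : R) (f g : R -> R -> R) : rho < r -> glue rho f g t r = g t r.
Proof. intros Hr. unfold glue. destruct (Rlt_dec r rho); [lra | reflexivity]. Qed.

(** * From the physical system to the augmented formulation *)

(** What the constraint on the height and mass conservation leave of the interior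
    flow: all of it is a function of [delta]. *)
Definition interior_constraint (p : params) (T : Rbar) (zeta q : R -> R -> R)
    (delta : R -> R) : Prop :=
  (forall t r, 0 <= t -> Rbar_lt t T -> 0 < r < Rad p ->
     height p (zeta t) r = hieq p + eps p * delta t) /\
  (forall t, 0 < t -> Rbar_lt t T ->
     is_derive delta t (Dt delta t) /\ ex_derive (Dt delta) t) /\
  (forall t r, 0 < t -> Rbar_lt t T -> 0 < r < Rad p -> q t r = - (r / 2) * Dt delta t).

(** Only values at positive times before [T] determine [dt]: the constraint holds in a
    neighbourhood of each such time and can be differentiated. *)
Lemma interior_time_derivatives (p : params) (T : Rbar) (zeta q : R -> R -> R)
  (delta : R -> R) (t r : R) :
  0 < eps p -> interior_constraint p T zeta q delta ->
  0 < t -> Rbar_lt t T -> 0 < r < Rad p ->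
  zeta t r = (hieq p + eps p * delta t - 1) / eps p /\
  dt zeta t r = Dt delta t /\
  dt (dt zeta) t r = Derive (Dt delta) t /\
  dt q t r = - (r / 2) * Derive (Dt delta) t.
Proof.
  intros He [Hh [Hdelta Hq]] Ht HtT Hr.
  assert (Hz : forall s, 0 < s -> Rbar_lt s T ->
            zeta s r = (hieq p + eps p * delta s - 1) / eps p).
  { intros s Hs HsT. rewrite <- (Hh s r) by (trivial; lra). unfold height. field; lra. }
  assert (Hzt : forall s, 0 < s -> Rbar_lt s T -> dt zeta s r = Dt delta s).
  { intros s Hs HsT. rewrite (dt_ext_time T zeta _ s r Hz Hs HsT).
    apply is_derive_unique.
    destruct (Hdelta s Hs HsT) as [Hd _].
    apply (is_derive_ext (fun u => (hieq p - 1) / eps p + delta u)).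
    - intros u. simpl. field. lra.
    - replace (Dt delta s) with (0 + Dt delta s) by ring.
      apply (is_derive_plus (V := R_NormedModule) (fun _ => (hieq p - 1) / eps p) delta);
        [apply (is_derive_const (V := R_NormedModule)) | exact Hd]. }
  split; [now apply Hz | split; [now apply Hzt | split]].
  - now apply dt_ext_time with T.
  - rewrite (dt_ext_time T q (fun s => - (r / 2) * Dt delta s) t r) by auto.
    apply Derive_scal.
Qed.

Lemma BA_interior_constraint (p : params) (T : Rbar) (F : R -> R) (zeta q P : R -> R -> R)
  (delta : R -> R) :
  0 < eps p -> BA_solution p T zeta q P delta -> newton p T F delta (Dt delta) P ->
  interior_constraint p T zeta q delta.
Proof.
  intros He [HBA [_ [Hh Hq0]]] HN.
  assert (Hdelta : forall t, 0 < t -> Rbar_lt t T ->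
            is_derive delta t (Dt delta t) /\ ex_derive (Dt delta) t).
  { intros t Ht HtT. destruct (HN t Ht HtT) as [H1 [H2 _]]. now split. }
  split; [exact Hh | split; [exact Hdelta |]].
  intros t r Ht HtT Hr. apply (interior_discharge (Rad p)); [| apply Hq0; trivial; lra | exact Hr].
  intros x Hx. destruct (HBA t x Ht HtT) as [[_ [_ [H3 _]]] [E1 _]]; try lra.
  split; [exact H3 |].
  assert (Hzt : dt zeta t x = Dt delta t).
  { apply (interior_time_derivatives p T zeta (fun s y => - (y / 2) * Dt delta s));
      trivial. split; [exact Hh | split; [exact Hdelta | reflexivity]]. }
  lra.
Qed.

Lemma BA_interior_pressure (p : params) (T : Rbar) (zeta q P : R -> R -> R)
  (delta : R -> R) (t : R) :
  0 < eps p -> 0 < Rad p -> interior_constraint p T zeta q delta ->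
  0 < t -> Rbar_lt t T ->
  (forall r, 0 < r < Rad p -> BA_defined zeta q P t r /\ BA_equations p zeta q P t r) ->
  let h := hieq p + eps p * delta t in
  h <> 0 ->
  exists C, forall r, 0 < r < Rad p ->
    P t r / eps p
    = (r ^ 2 - Rad p ^ 2)
      * ((Derive (Dt delta) t / 2 - 3 * eps p * Dt delta t ^ 2 / (4 * h)) / (2 * h)) + C.
Proof.
  intros He HR Hin Ht HtT HBA h Hhne.
  apply (interior_pressure (Rad p) _ (fun r => P t r / eps p)); [exact HR |].
  intros r Hr. destruct (HBA r Hr) as [[_ [_ [_ [_ [_ [_ [_ HP]]]]]]] [_ E2]].
  assert (HPd : ex_derive (fun r => P t r / eps p) r).
  { apply ex_derive_div; [exact HP | apply ex_derive_const | lra]. }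
  apply Derive_correct in HPd. cbv zeta in E2.
  rewrite (proj1 Hin t r ltac:(lra) HtT Hr) in E2. fold h in E2.
  assert (Hm := interior_momentum p (zeta t) (q t) (dt q t) (Dt delta t)
                  (Derive (Dt delta) t) h r He Hhne Hr).
  rewrite (proj1 Hin t r ltac:(lra) HtT Hr) in Hm. fold h in Hm.
  match goal with |- is_derive _ _ ?l =>
    replace l with (Derive (fun r => P t r / eps p) r); [exact HPd |] end.
  apply Rmult_eq_reg_l with h; [| exact Hhne].
  enough (Hm' : forall x, 0 < x < Rad p ->
            height p (zeta t) x = h /\ q t x = - (x / 2) * Dt delta t /\
            dt q t x = - (x / 2) * Derive (Dt delta) t) by (specialize (Hm Hm'); lra).
  intros x Hx. split; [apply (proj1 Hin); trivial; lra | split].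
  - now apply (proj2 (proj2 Hin)).
  - now apply (interior_time_derivatives p T zeta q delta t x He Hin).
Qed.

Lemma BA_exterior_residual (p : params) (zeta q P : R -> R -> R) (t r : R) :
  0 < eps p -> 0 < Rad p -> Rad p < r -> smooth_profile p (zeta t) (q t) ->
  (forall x, Rad p < x -> P t x = 0) ->
  (dt q t r - kappa p ^ 2 * Derive (dr (dt q t)) r
   + eps p * dr (fun x => q t x ^ 2 / height p (zeta t) x) r
   + height p (zeta t) r * Derive (zeta t) r
   = - (height p (zeta t) r * Derive (fun x => P t x / eps p) r)
     + nu p * height p (zeta t) r * Derive (fun x => dr (q t) x / height p (zeta t) x) r
   <-> momentum_residual p (zeta t) (q t) (dt q t) r = 0).
Proof.
  intros He HR Hr Hprof HP. destruct (Hprof r Hr) as [H1 [H2 [H3 H4]]].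
  rewrite momentum_residual_eq by (trivial; lra).
  rewrite (Derive_ext_gt (Rad p) r (fun x => P t x / eps p) (fun _ => 0) Hr), Derive_const
    by (intros x Hx; rewrite HP by exact Hx; field; lra).
  split; intros; lra.
Qed.

(** [K0' = - K1]: the boundary-layer term of the flux is a primitive of a
    multiple of [K1 (r / kappa)], the profile of the hydrodynamic combination. *)
Lemma is_derive_Ftilde_snd (p : params) (zeta q : R -> R) (Z : vec4) (F r : R) :
  0 < Rad p -> 0 < kappa p -> Rad p < r ->
  ex_derive (frakR1 p (src1 p zeta q)) r ->
  is_derive (fun x => snd (Ftilde p zeta q Z F x)) r
    (Derive (frakR1 p (src1 p zeta q)) r
     + DD p (I_hyd p zeta q) Z F * (Rad p / 2) * (K1 (r / kappa p) / K1 (Rad p / kappa p))).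
Proof.
  intros HR Hk Hr Hv. unfold Ftilde. simpl snd.
  set (D := DD p (I_hyd p zeta q) Z F). set (k1 := K1 (Rad p / kappa p)).
  assert (Hk1 : 0 < k1) by (apply K1_pos, Rdiv_lt_0_compat; lra).
  replace (_ + _) with (Derive (frakR1 p (src1 p zeta q)) r
    - D * (kappa p * Rad p / 2) * (- (K1 (r / kappa p) / kappa p) * / k1)) by (field; lra).
  apply (is_derive_minus (V := R_NormedModule) (frakR1 p (src1 p zeta q))
    (fun x => D * (kappa p * Rad p / 2) * (K0 (x / kappa p) / k1))).
  - now apply Derive_correct.
  - apply is_derive_scal.
    apply (is_derive_scal_l (V := R_NormedModule) (fun x => K0 (x / kappa p))).
    apply is_derive_K0_scaled; lra.
Qed.

(** The order of deduction matters: the interior flow and the trace of the discharge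
    come first, then the exterior representation and its trace identity, and only then
    Newton's equation, which identifies [delta''] with [DD]. *)
Lemma direct_part (p : params) (T : Rbar) (F : R -> R) (zeta q P : R -> R -> R)
  (delta : R -> R) :
  standing_params p -> Rbar_lt 0 T ->
  regular_exterior p T zeta q ->
  continuous_on_time T delta -> continuous_on_time T (Dt delta) ->
  exterior_nonvanishing p T zeta -> interior_nonvanishing p T zeta ->
  0 < eps p * delta 0 + hieq p ->
  BA_solution p T zeta q P delta -> newton p T F delta (Dt delta) P ->
  transmission p T zeta q P ->
  augmented p T F (zeta 0) (q 0) (dt zeta 0) (delta 0) (Dt delta 0) zeta q
    (fun t => Vec4 (delta t) (Dt delta t)
                   (lim_right (Rad p) (zeta t)) (lim_right (Rad p) (dt zeta t))).
Proof.
  intros Hp HT Hreg Hcd Hcdd Hne Hni Hh0 HBA HN Htr.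
  assert (Hp' := Hp). destruct Hp' as [He [_ [Hk [_ [HR _]]]]].
  assert (Hin := BA_interior_constraint p T F zeta q P delta (proj1 He) HBA HN).
  assert (Hhpos : forall t, 0 <= t -> Rbar_lt t T -> 0 < hieq p + eps p * delta t).
  { apply continuous_on_time_sign; [lra | now apply continuous_on_time_affine |].
    intros t Ht HtT. rewrite <- (proj1 Hin t (Rad p / 2)) by (trivial; lra).
    apply Hni; trivial; lra. }
  assert (Hreg' := Hreg). destruct Hreg' as [Hsm [Hcub _]].
  destruct Hcub as [Hcz [Hczt [Hcztt [_ [Hcq [_ [_ [Hcqt _]]]]]]]].
  destruct HBA as [HBA [HPe _]].
  set (Z := fun t => Vec4 (delta t) (Dt delta t)
                      (lim_right (Rad p) (zeta t)) (lim_right (Rad p) (dt zeta t))).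
  assert (Hqtr : forall t, 0 < t -> Rbar_lt t T ->
            lim_right (Rad p) (q t) = - (Rad p / 2) * Dt delta t).
  { intros t Ht HtT. destruct (Htr t Ht HtT) as [[_ [_ Hj]] _].
    rewrite (lim_left_eq (Rad p) (q t) (- (Rad p / 2) * Dt delta t)) in Hj; [lra |].
    apply filterlim_at_left_ext with (a := 0) (f := fun r => - (r / 2) * Dt delta t);
      [exact HR | intros y Hy; symmetry; now apply Hin |].
    apply (filterlim_at_left_of_continuous (fun r : R => - (r / 2) * Dt delta t)).
    apply (ex_derive_continuous (V := R_NormedModule)). auto_derive. trivial. }
  assert (Hqttr : forall t, 0 < t -> Rbar_lt t T ->
            lim_right (Rad p) (dt q t) = - (Rad p / 2) * Derive (Dt delta) t).
  { intros t Ht HtT.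
    assert (Hd := trace_is_derive p T q t Hcq Hcqt (fun s r A B C =>
                    proj1 (proj2 (proj2 (proj2 (proj2 (proj2 (Hsm s r A B C))))))) Ht HtT).
    rewrite <- (is_derive_unique _ _ _ Hd), <- Derive_scal.
    apply Derive_ext_loc, filter_imp with (2 := locally_time T t Ht HtT).
    intros s [Hs HsT]. now apply Hqtr. }
  assert (Hmass : forall s x, 0 < s -> Rbar_lt s T -> Rad p < x ->
            dt zeta s x + dr (q s) x = 0).
  { intros s x Hs HsT Hx. apply (HBA s x Hs HsT); lra. }
  assert (Hres : forall t x, 0 < t -> Rbar_lt t T -> Rad p < x ->
            momentum_residual p (zeta t) (q t) (dt q t) x = 0).
  { intros t x Ht HtT Hx.
    apply (BA_exterior_residual p zeta q P t x (proj1 He) HR Hx).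
    - now apply regular_exterior_profile with T.
    - intros y Hy. apply HPe; trivial; lra.
    - apply (HBA t x Ht HtT); lra. }
  assert (HIhyd : forall t, 0 < t -> Rbar_lt t T ->
            ex_lim_right (Rad p) (f_hyd p (zeta t) (q t)) /\
            kappa p ^ 2 * lim_right (Rad p) (dt (dt zeta) t)
            = I_hyd p (zeta t) (q t) - eps p * ff_of p (Z t) - Z3 (Z t)
              - nu p * Z4 (Z t) - kappa p * G p * Derive (Dt delta) t).
  { intros t Ht HtT.
    assert (Hl := exterior_f_hyd_trace p T zeta q t Hp Hreg Hne Ht HtT Hmass
                    (fun x => Hres t x Ht HtT)).
    split; [eexists; exact Hl |].
    unfold I_hyd. rewrite (lim_right_eq _ _ _ Hl), Hqtr, Hqttr by assumption.
    assert (Hhe := trace_height_neq_0 p T zeta t Hcz Hne (Rlt_le _ _ Ht) HtT).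
    unfold ff_of, he_of; simpl Z1; simpl Z2; simpl Z3; simpl Z4.
    field. split; [exact Hhe | lra]. }
  assert (Hacc : forall t, 0 < t -> Rbar_lt t T ->
            Derive (Dt delta) t = DD p (I_hyd p (zeta t) (q t)) (Z t) (F t)).
  { intros t Ht HtT.
    assert (Hh := Hhpos t (Rlt_le _ _ Ht) HtT).
    assert (Hhe := trace_height_neq_0 p T zeta t Hcz Hne (Rlt_le _ _ Ht) HtT).
    apply (newton_iff_acceleration p _ _ (Z t) _ (lim_right (Rad p) (dt (dt zeta) t)) Hp);
      [exact Hh | exact Hhe | now apply HIhyd |].
    destruct (BA_interior_pressure p T zeta q P delta t (proj1 He) HR Hin Ht HtT) as [C HC].
    { intros r Hr. apply HBA; trivial; lra. }
    { lra. }
    set (A := _ / (2 * _)) in HC.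
    destruct (HN t Ht HtT) as [_ [_ [_ HNt]]].
    rewrite Dt_pos in HNt by exact Ht.
    rewrite (disc_mean_parabola (Rad p) A C (fun r => P t r / eps p) HR HC) in HNt.
    destruct (Htr t Ht HtT) as [_ [[_ [_ Hj]] _]].
    change (lim_right (Rad p) (bernoulli p zeta q P t)
            - lim_left (Rad p) (bernoulli p zeta q P t) = 0) in Hj.
    rewrite (lim_right_eq _ _ _ (bernoulli_exterior_trace p T zeta q P t (proj1 He) Hreg Hne
               (Rlt_le _ _ Ht) HtT (fun r => HPe t r (Rlt_le _ _ Ht) HtT))) in Hj.
    rewrite (lim_left_eq _ _ _ (bernoulli_interior_trace p zeta q P t A C (Dt delta t)
               ((hieq p + eps p * delta t - 1) / eps p) (Dt delta t)
               (Derive (Dt delta) t) (hieq p + eps p * delta t) HR ltac:(lra)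
               ltac:(intros r Hr;
                     destruct (interior_time_derivatives p T zeta q delta t r (proj1 He) Hin
                                 Ht HtT Hr) as [B1 [B2 [B3 _]]];
                     repeat split; trivial;
                       [now apply HC | now apply Hin | apply Hin; trivial; lra]))) in Hj.
    rewrite Hqtr in Hj by assumption.
    unfold hi_of, he_of; simpl Z1; simpl Z2; simpl Z3; simpl Z4.
    fold A. replace ((- (Rad p / 2) * Dt delta t) ^ 2) with ((Rad p / 2 * Dt delta t) ^ 2) in Hj
      by ring.
    lra. }
  split; [| split; [| split; [| split; [| split]]]].
  - intros t r Ht HtT Hr.
    assert (Hz := regular_exterior_profile p T zeta q t He Hreg Hne Ht HtT r Hr).
    assert (HW := exterior_hydro_combination p T zeta q t r Hp Hreg Hne Ht HtT
                    (fun x => Hres t x Ht HtT) Hr).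
    rewrite Hqttr in HW by assumption. rewrite Hacc in HW by assumption.
    destruct (Hsm t r Ht HtT Hr) as [G1 [_ [_ [G4 [_ [G6 _]]]]]].
    destruct (exterior_resolvents p T zeta q t Hreg Ht HtT) as [Hv _].
    destruct (proj1 Hv r Hr) as [Gv _].
    assert (Hflux := is_derive_Ftilde_snd p (zeta t) (q t) (Z t) (F t) r HR
                       (proj1 Hk) Hr Gv).
    cbv zeta. split; [exact G1 | split; [exact G6 | split; [exact G4 | split]]].
    + eexists; exact Hflux.
    + split.
      * change (dt zeta t r + Derive (q t) r = - (q t r / r) + 0).
        assert (H := Hmass t r Ht HtT Hr). unfold dr in H. lra.
      * apply is_derive_unique in Hflux. fold (Z t).
        replace (Derive _ r) with
          (Derive (frakR1 p (src1 p (zeta t) (q t))) r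
           + DD p (I_hyd p (zeta t) (q t)) (Z t) (F t) * (Rad p / 2)
             * (K1 (r / kappa p) / K1 (Rad p / kappa p))) by (symmetry; exact Hflux).
        unfold hydro_combination in HW. simpl. lra.
  - intros t Ht HtT. destruct (HIhyd t Ht HtT) as [Hex HI].
    destruct (proj1 (proj2 Hin) t Ht HtT) as [D1 D2].
    assert (Hd3 := trace_is_derive p T zeta t Hcz Hczt
                     (fun s r A B C => proj1 (Hsm s r A B C)) Ht HtT).
    assert (Hd4 := trace_is_derive p T (dt zeta) t Hczt Hcztt
                     (fun s r A B C => proj1 (proj2 (Hsm s r A B C))) Ht HtT).
    cbv zeta. split; [exact Hex |].
    split; [| split; [| split]]; rewrite Dt_pos by exact Ht; split;
      try (eexists; eassumption); try exact D2; simpl.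
    + change (fun s : R => delta s) with delta. rewrite (is_derive_unique _ _ _ D1). lra.
    + change (fun s : R => Dt delta s) with (Dt delta). rewrite Hacc by assumption. unfold Z. lra.
    + replace (Derive _ t) with (lim_right (Rad p) (dt zeta t))
        by (symmetry; now apply is_derive_unique). lra.
    + replace (Derive _ t) with (lim_right (Rad p) (dt (dt zeta) t))
        by (symmetry; now apply is_derive_unique).
      fold (Z t). rewrite <- Hacc by assumption.
      replace (_ - _ - _ - _ - _)
        with (kappa p ^ 2 * lim_right (Rad p) (dt (dt zeta) t)) by (rewrite HI; reflexivity).
      field. lra.
  - intros t Ht HtT. split; split.
    + eexists; now apply trace_lim with T.
    + reflexivity.
    + eexists; now apply trace_lim with T.
    (* the transmission conditions hold for [t > 0] only: at [t = 0] pass to the limit *)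
    + simpl Z2. destruct (Rle_lt_or_eq_dec 0 t Ht) as [Ht' | <-]; [now apply Hqtr |].
      apply (continuous_on_time_eq_0 T (fun s => lim_right (Rad p) (q s))
               (fun s => - (Rad p / 2) * Dt delta s) HT).
      * now apply trace_continuous.
      * intros s Hs HsT. set (Fl := within (fun s => 0 <= s) (locally s)).
        apply (filterlim_Rscal Fl). now apply Hcdd.
      * exact Hqtr.
  - simpl. split; [exact Hcd | split; [exact Hcdd | split]]; now apply trace_continuous.
  - intros r _. split; reflexivity.
  - reflexivity.
Qed.

(** * From the augmented formulation to the physical system *)

Lemma no_jump_intro (x l : R) (f : R -> R) :
  filterlim f (at_right x) (locally l) -> filterlim f (at_left x) (locally l) ->
  no_jump x f.
Proof.
  intros Hr Hl. split; [now exists l | split; [now exists l |]].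
  rewrite (lim_right_eq _ _ _ Hr), (lim_left_eq _ _ _ Hl). ring.
Qed.

Lemma bernoulli_ext (p : params) (zeta q P zeta' q' P' : R -> R -> R) (t r : R) :
  (forall s, zeta s r = zeta' s r) -> q t r = q' t r -> P t r = P' t r ->
  bernoulli p zeta q P t r = bernoulli p zeta' q' P' t r.
Proof.
  intros Hz Hq HP. assert (Hzt := dt_ext_in_space zeta zeta' r Hz).
  unfold bernoulli, height.
  now rewrite Hz, Hq, HP, Hzt, (dt_ext_in_space (dt zeta) (dt zeta') r Hzt).
Qed.

Lemma zeta_int_height (p : params) (Z : R -> vec4) (t : R) : 0 < eps p ->
  1 + eps p * zeta_int p Z t = hieq p + eps p * Z1 (Z t).
Proof. intros He. unfold zeta_int. field. lra. Qed.

Lemma augmented_acceleration (p : params) (T : Rbar) (F : R -> R)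
  (zeta0 q0 zetadot0 : R -> R) (delta0 deltadot0 : R) (u1 u2 : R -> R -> R) (Z : R -> vec4)
  (t : R) :
  0 < kappa p -> augmented p T F zeta0 q0 zetadot0 delta0 deltadot0 u1 u2 Z ->
  0 < t -> Rbar_lt t T ->
  is_derive (fun s => Z1 (Z s)) t (Z2 (Z t)) /\
  is_derive (fun s => Z2 (Z s)) t (DD p (I_hyd p (u1 t) (u2 t)) (Z t) (F t)) /\
  is_derive (fun s => Z3 (Z s)) t (Z4 (Z t)) /\
  ex_derive (fun s => Z4 (Z s)) t /\
  kappa p ^ 2 * Derive (fun s => Z4 (Z s)) t
  = I_hyd p (u1 t) (u2 t) - eps p * ff_of p (Z t) - Z3 (Z t) - nu p * Z4 (Z t)
    - kappa p * G p * Derive (fun s => Z2 (Z s)) t.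
Proof.
  intros Hk [_ [Hode _]] Ht HtT.
  destruct (Hode t Ht HtT) as [_ [[D1 E1] [[D2 E2] [[D3 E3] [D4 E4]]]]].
  rewrite Dt_pos in E1, E2, E3, E4 by exact Ht. simpl in E1, E2, E3, E4.
  set (D := DD p (I_hyd p (u1 t) (u2 t)) (Z t) (F t)) in *.
  apply Derive_correct in D1, D2, D3.
  assert (E2' : Derive (fun s => Z2 (Z s)) t = D) by (clearbody D; lra).
  split; [| split; [| split; [| split]]].
  - replace (Z2 (Z t)) with (Derive (fun s => Z1 (Z s)) t) by lra. exact D1.
  - rewrite <- E2'. exact D2.
  - replace (Z4 (Z t)) with (Derive (fun s => Z3 (Z s)) t) by lra. exact D3.
  - exact D4.
  - rewrite E2'.
    match type of E4 with ?d + - (?k * ?x) = 0 => replace d with (k * x) by lra end.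
    field. lra.
Qed.

(** The second augmented equation makes the combination a multiple of
    [K1 (r / kappa)], an element of the kernel; the residual is its image. *)
Lemma augmented_residual (p : params) (T : Rbar) (F : R -> R)
  (zeta0 q0 zetadot0 : R -> R) (delta0 deltadot0 : R) (u1 u2 : R -> R -> R) (Z : R -> vec4)
  (t r : R) :
  standing_params p -> regular_exterior p T u1 u2 -> exterior_nonvanishing p T u1 ->
  augmented p T F zeta0 q0 zetadot0 delta0 deltadot0 u1 u2 Z ->
  0 < t -> Rbar_lt t T -> Rad p < r ->
  momentum_residual p (u1 t) (u2 t) (dt u2 t) r = 0.
Proof.
  intros [He [_ [Hk [_ [HR _]]]]] Hreg Hne [Hpde _] Ht HtT Hr.
  assert (Hprof := regular_exterior_profile p T u1 u2 t He Hreg Hne Ht HtT).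
  destruct (exterior_resolvents p T u1 u2 t Hreg Ht HtT) as [Hv [Hwr Hwnu]].
  assert (Hsm := proj1 Hreg).
  set (W := hydro_combination p (dt u2 t) (frakR1 p (src1 p (u1 t) (u2 t)))
              (frakR0 p (src_r p (u1 t) (u2 t))) (frakR0 p (src_nu p (u1 t) (u2 t)))).
  assert (HW : helmholtz p W (momentum_residual p (u1 t) (u2 t) (dt u2 t))).
  { apply hydro_combination_helmholtz; trivial; [lra |].
    intros x Hx. destruct (Hsm t x Ht HtT Hx) as [_ [_ [_ [_ [_ [_ [H7 H8]]]]]]].
    now split. }
  set (D := DD p (I_hyd p (u1 t) (u2 t)) (Z t) (F t)).
  set (k1 := K1 (Rad p / kappa p)).
  assert (Hk1 : 0 < k1) by (apply K1_pos, Rdiv_lt_0_compat; lra).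
  assert (HW0 : helmholtz p W (fun _ => 0)).
  { apply helmholtz_ext with
      (w := fun x => - (D * (Rad p / 2) / k1) * K1 (x / kappa p) + 0 * K1 (x / kappa p))
      (f := fun _ => - (D * (Rad p / 2) / k1) * 0 + 0 * 0).
    - intros x Hx. destruct (Hpde t x Ht HtT Hx) as [_ [_ [_ [_ [_ E2]]]]].
      assert (Hflux := is_derive_Ftilde_snd p (u1 t) (u2 t) (Z t) (F t) x HR
                         (proj1 Hk) Hx (proj1 (proj1 Hv x Hx))).
      apply is_derive_unique in Hflux. fold D k1 in Hflux.
      assert (E2' := Rplus_eq_compat_l (dt u2 t x) _ _ Hflux).
      assert (E3 := eq_trans (eq_sym E2') E2). simpl in E3.
      unfold W, hydro_combination. unfold Rdiv in *. lra.
    - intros; ring.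
    - apply helmholtz_lincomb; [exact HR | |]; apply helmholtz_K1; lra. }
  destruct (HW r Hr) as [_ [_ <-]]. apply (HW0 r Hr).
Qed.

(** In the interior, [zeta_int] and [q_int] have the form of [interior_constraint]
    and [P_int] is a parabola [(r^2 - Rad^2) A + C]; the constant [C] is such that the
    Bernoulli quantity has no jump, as the traces of [u1] and of its time derivatives
    are [Z3], [Z4] and the derivative of [Z4]. *)
Lemma converse_part (p : params) (T : Rbar) (F : R -> R)
  (zeta0 q0 zetadot0 : R -> R) (delta0 deltadot0 : R) (u1 u2 : R -> R -> R) (Z : R -> vec4) :
  standing_params p -> Rbar_lt 0 T ->
  regular_exterior p T u1 u2 -> exterior_nonvanishing p T u1 ->
  interior_nonvanishing p T (fun t _ => zeta_int p Z t) ->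
  0 < eps p * delta0 + hieq p ->
  augmented p T F zeta0 q0 zetadot0 delta0 deltadot0 u1 u2 Z ->
  newton p T F (fun t => Z1 (Z t)) (fun t => Z2 (Z t)) (P_int p u1 u2 Z) /\
  BA_solution p T
    (glue (Rad p) (fun t _ => zeta_int p Z t) u1)
    (glue (Rad p) (q_int Z) u2)
    (glue (Rad p) (P_int p u1 u2 Z) (fun _ _ => 0))
    (fun t => Z1 (Z t)) /\
  transmission p T
    (glue (Rad p) (fun t _ => zeta_int p Z t) u1)
    (glue (Rad p) (q_int Z) u2)
    (glue (Rad p) (P_int p u1 u2 Z) (fun _ _ => 0)).
Proof.
  intros Hp HT Hreg Hne Hni Hh0 Haug.
  assert (Hp' := Hp). destruct Hp' as [He [_ [Hk [_ [HR _]]]]].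
  assert (Hzh := fun t => zeta_int_height p Z t (proj1 He)).
  assert (Hres := fun t r => augmented_residual p T F zeta0 q0 zetadot0 delta0 deltadot0
                               u1 u2 Z t r Hp Hreg Hne Haug).
  assert (Hacc := fun t => augmented_acceleration p T F zeta0 q0 zetadot0 delta0 deltadot0
                             u1 u2 Z t (proj1 Hk) Haug).
  destruct Haug as [Hpde [_ [Htr [[Hc1 _] [_ HZ0]]]]].
  assert (Hhpos : forall t, 0 <= t -> Rbar_lt t T -> 0 < hieq p + eps p * Z1 (Z t)).
  { apply (continuous_on_time_sign T (fun t => hieq p + eps p * Z1 (Z t)));
      [rewrite HZ0; simpl; lra | now apply continuous_on_time_affine |].
    intros t Ht HtT. rewrite <- Hzh.
    apply (Hni t (Rad p / 2)); trivial; lra. }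
  assert (Hsm := proj1 Hreg). assert (Hcub := proj1 (proj2 Hreg)).
  destruct Hcub as [Hcz [Hczt [Hcztt [_ [Hcq [_ [_ [Hcqt _]]]]]]]].
  set (delta := fun t => Z1 (Z t)). set (b := fun t => Z2 (Z t)).
  set (zi := fun t (_ : R) => zeta_int p Z t).
  assert (Hb : forall t, 0 < t -> Rbar_lt t T -> Dt delta t = b t).
  { intros t Ht HtT. rewrite Dt_pos by exact Ht.
    apply is_derive_unique. now apply Hacc. }
  assert (Hb' : forall t, 0 < t -> Rbar_lt t T ->
            is_derive (Dt delta) t (Derive b t)).
  { intros t Ht HtT. apply (is_derive_ext_loc b).
    - apply filter_imp with (2 := locally_time T t Ht HtT).
      intros s [Hs HsT]. symmetry. now apply Hb.
    - apply Derive_correct. destruct (Hacc t Ht HtT) as [_ [H _]]. eexists; exact H. }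
  assert (Hin : interior_constraint p T zi (fun t r => - (r / 2) * Dt delta t) delta).
  { split; [| split; [| reflexivity]].
    - intros t r Ht HtT Hr. apply Hzh.
    - intros t Ht HtT. rewrite Hb by assumption.
      split; [now apply Hacc | eexists; now apply Hb']. }
  assert (Hkin : forall t r, 0 < t -> Rbar_lt t T -> 0 < r < Rad p ->
            dt zi t r = b t /\ dt (dt zi) t r = Derive b t /\
            dt (q_int Z) t r = - (r / 2) * Derive b t).
  { intros t r Ht HtT Hr.
    destruct (interior_time_derivatives p T zi _ delta t r (proj1 He) Hin Ht HtT Hr)
      as [_ [B2 [B3 _]]].
    rewrite Hb in B2 by assumption.
    rewrite (is_derive_unique _ _ _ (Hb' t Ht HtT)) in B3.
    split; [exact B2 | split; [exact B3 |]].
    rewrite (dt_ext_time T (q_int Z) (fun s => - (r / 2) * b s) t r) by auto.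
    apply Derive_scal. }
  set (A := fun t => (Derive b t / 2 - 3 * eps p * b t ^ 2 / (4 * hi_of p (Z t)))
                     / (2 * hi_of p (Z t))).
  set (C := fun t =>
    Z3 (Z t) - (hi_of p (Z t) - 1) / eps p + nu p * (Z4 (Z t) - b t)
    + kappa p ^ 2 * (Derive (fun s => Z4 (Z s)) t - Derive b t)
    + eps p / 2 * ((Rad p / 2 * b t) ^ 2 / he_of p (Z t) ^ 2
                   - (Rad p / 2 * b t) ^ 2 / hi_of p (Z t) ^ 2)).
  assert (Hhe : forall t, 0 <= t -> Rbar_lt t T -> he_of p (Z t) <> 0).
  { intros t Ht HtT. unfold he_of. rewrite <- (proj2 (proj1 (Htr t Ht HtT))).
    now apply trace_height_neq_0 with T. }
  assert (HP : forall t r, 0 < t -> Rbar_lt t T ->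
            P_int p u1 u2 Z t r / eps p = (r ^ 2 - Rad p ^ 2) * A t + C t).
  { intros t r Ht HtT.
    assert (Hr : 0 < Rad p / 2 < Rad p) by lra.
    destruct (Hkin t (Rad p / 2) Ht HtT Hr) as [B2 [B3 _]].
    change (dt zi t (Rad p / 2)) with (Dt (zeta_int p Z) t) in B2.
    change (dt (dt zi) t (Rad p / 2)) with (Dt (Dt (zeta_int p Z)) t) in B3.
    unfold P_int. cbv zeta.
    rewrite B2, B3, !Hzh, !pow2_abs.
    rewrite (proj2 (proj1 (Htr t (Rlt_le _ _ Ht) HtT))),
      (proj2 (proj2 (Htr t (Rlt_le _ _ Ht) HtT))).
    rewrite !Dt_pos by exact Ht.
    assert (H1 := Hhpos t (Rlt_le _ _ Ht) HtT). assert (H2 := Hhe t (Rlt_le _ _ Ht) HtT).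
    unfold A, C, q_int, zeta_int.
    change (Derive (fun s => Z2 (Z s)) t) with (Derive b t).
    unfold b. unfold he_of in *. unfold hi_of in *.
    field. repeat split; trivial; lra. }
  split; [| split].
  - intros t Ht HtT. destruct (Hacc t Ht HtT) as [D1 [D2 [D3 [D4 D5]]]].
    split; [exact D1 | split; [eexists; exact D2 | split]].
    + eexists. apply (is_RInt_parabola (Rad p) (A t) (C t) (fun r => P_int p u1 u2 Z t r / eps p) HR).
      intros r _. now apply HP.
    + rewrite (disc_mean_parabola (Rad p) (A t) (C t) _ HR) by (intros r _; now apply HP).
      rewrite Dt_pos by exact Ht.
      assert (HN := proj2 (newton_iff_acceleration p _ (F t) (Z t) (Derive b t) _ Hp
                (Hhpos t (Rlt_le _ _ Ht) HtT) (Hhe t (Rlt_le _ _ Ht) HtT) D5)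
                (is_derive_unique _ _ _ D2)).
      unfold A, C. unfold b in *. lra.
  - split; [| split; [| split]].
    + intros t r Ht HtT Hr Hne_r.
      destruct (Rlt_or_le r (Rad p)) as [Hlt | Hge].
      * assert (Hr' : 0 < r < Rad p) by lra.
        apply (BA_local p 0 (Rad p) t r zi (q_int Z) (P_int p u1 u2 Z) _ _ _ Hr');
          try (intros s x Hx; rewrite glue_in by apply Hx; reflexivity).
        assert (Hbd : ex_derive b t)
          by (destruct (Hacc t Ht HtT) as [_ [D2 _]]; eexists; exact D2).
        assert (Hdrq : forall x, 0 < x < Rad p -> - b t = dr (q_int Z t) x)
          by (intros x Hx; symmetry; apply (dr_linear (b t)); lra).
        assert (Hdtq : forall x, 0 < x < Rad p ->
                  - (x / 2) * Derive b t = dt (q_int Z) t x)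
          by (intros x Hx; symmetry; now apply Hkin).
        assert (Hdrdtq : forall x, 0 < x < Rad p -> - Derive b t = dr (dt (q_int Z) t) x).
        { intros x Hx. rewrite <- (dr_ext_in 0 (Rad p) x _ _ Hx Hdtq).
          symmetry. apply dr_linear; lra. }
        assert (HdP : is_derive (fun x => P_int p u1 u2 Z t x / eps p) r (2 * r * A t)).
        { apply (is_derive_ext (fun x => (x ^ 2 - Rad p ^ 2) * A t + C t)).
          - intros x. symmetry. now apply HP.
          - auto_derive; [trivial | ring]. }
        split; [repeat apply conj |].
        -- apply (ex_derive_plus (V := R_NormedModule) delta (fun _ => / eps p * (hieq p - 1))).
           ++ destruct (Hacc t Ht HtT) as [D1 _]. eexists; exact D1.
           ++ apply ex_derive_const.
        -- apply ex_derive_const.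
        -- unfold q_int. auto_derive. trivial.
        -- apply (ex_derive_ext_in 0 (Rad p) r _ _ Hr' Hdrq), ex_derive_const.
        -- now apply (ex_derive_scal b (- (r / 2))).
        -- apply (ex_derive_ext_in 0 (Rad p) r _ _ Hr' Hdtq). auto_derive. trivial.
        -- apply (ex_derive_ext_in 0 (Rad p) r _ _ Hr' Hdrdtq), ex_derive_const.
        -- apply (ex_derive_ext (fun x => eps p * (P_int p u1 u2 Z t x / eps p))).
           ++ intros x. simpl. field. lra.
           ++ apply (ex_derive_scal (fun x => P_int p u1 u2 Z t x / eps p)).
              eexists; exact HdP.
        -- split.
           ++ rewrite <- Hdrq by exact Hr'. rewrite (proj1 (Hkin t r Ht HtT Hr')). ring.
           ++ assert (Hh := Hhpos t (Rlt_le _ _ Ht) HtT).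
              assert (Hm := interior_momentum p (zi t) (q_int Z t) (dt (q_int Z) t) (b t)
                              (Derive b t) (hi_of p (Z t)) r (proj1 He)
                              ltac:(unfold hi_of; lra) Hr'
                              (fun x Hx => conj (Hzh t) (conj eq_refl (eq_sym (Hdtq x Hx))))).
              cbv zeta.
              replace (Derive (fun x => P_int p u1 u2 Z t x / eps p) r) with (2 * r * A t)
                by (symmetry; now apply is_derive_unique).
              replace (height p (zi t) r) with (hi_of p (Z t)) in * by (symmetry; apply Hzh).
              unfold A. lra.
      * assert (Hr' : Rad p < r < r + 1) by lra.
        apply (BA_local p (Rad p) (r + 1) t r u1 u2 (fun _ _ => 0) _ _ _ Hr');
          try (intros s x Hx; rewrite glue_out by apply Hx; reflexivity).
        destruct (Hsm t r Ht HtT (proj1 Hr'))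
          as [G1 [_ [G3 [G4 [G5 [G6 [G7 G8]]]]]]].
        split; [repeat apply conj; trivial | split].
        -- apply ex_derive_dr; [lra | exact G4 | exact G5].
        -- apply ex_derive_dr; [lra | exact G7 | exact G8].
        -- apply ex_derive_const.
        -- destruct (Hpde t r Ht HtT (proj1 Hr')) as [_ [_ [_ [_ [E1 _]]]]].
           change (dt u1 t r + Derive (u2 t) r = - (u2 t r / r) + 0) in E1.
           unfold dr. lra.
        -- apply (BA_exterior_residual p u1 u2 (fun _ _ => 0) t r (proj1 He) HR (proj1 Hr'));
             [now apply regular_exterior_profile with T | reflexivity |].
           now apply Hres.
    + intros t r _ _ Hr. now apply glue_out.
    + intros t r Ht HtT Hr. unfold height. rewrite glue_in by lra. apply Hzh.
    + intros t Ht HtT.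
      apply filterlim_ext_loc with (f := q_int Z t).
      * apply filter_imp with (fun x => x < Rad p).
        -- intros x Hx. symmetry. now apply glue_in.
        -- apply (filter_le_within (F := locally 0)). now apply (open_lt (Rad p) 0).
      * replace 0 with (q_int Z t 0) at 2 by (unfold q_int; field).
        apply (filterlim_at_right_of_continuous (q_int Z t)).
        apply (ex_derive_continuous (V := R_NormedModule)). unfold q_int. auto_derive. trivial.
  - intros t Ht HtT. assert (Ht0 := Rlt_le _ _ Ht). cbv zeta. split; [| split].
    + apply no_jump_intro with (- (Rad p / 2) * b t).
      * apply filterlim_at_right_ext with (f := u2 t);
          [intros y Hy; now rewrite glue_out |].
        change (b t) with (Z2 (Z t)).
        rewrite <- (proj2 (proj2 (Htr t Ht0 HtT))). now apply trace_lim with T.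
      * apply filterlim_at_left_ext with (a := 0) (f := q_int Z t);
          [exact HR | intros y Hy; now rewrite glue_in |].
        apply (filterlim_at_left_of_continuous (q_int Z t)).
        apply (ex_derive_continuous (V := R_NormedModule)). unfold q_int. auto_derive. trivial.
    + destruct (Hacc t Ht HtT) as [D1 [D2 [D3 [D4 D5]]]].
      assert (Hzt : forall s, 0 < s -> Rbar_lt s T -> lim_right (Rad p) (dt u1 s) = Z4 (Z s)).
      { intros s Hs HsT.
        assert (Hd := trace_is_derive p T u1 s Hcz Hczt
                        (fun s' r A' B' C' => proj1 (Hsm s' r A' B' C')) Hs HsT).
        rewrite <- (is_derive_unique _ _ _ Hd).
        rewrite <- (is_derive_unique _ _ _ (proj1 (proj2 (proj2 (Hacc s Hs HsT))))).
        apply Derive_ext_loc, filter_imp with (2 := locally_time T s Hs HsT).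
        intros s' [Hs' HsT']. apply Htr; trivial; lra. }
      assert (Hztt : lim_right (Rad p) (dt (dt u1) t) = Derive (fun s => Z4 (Z s)) t).
      { assert (Hd := trace_is_derive p T (dt u1) t Hczt Hcztt
                        (fun s' r A' B' C' => proj1 (proj2 (Hsm s' r A' B' C'))) Ht HtT).
        rewrite <- (is_derive_unique _ _ _ Hd).
        apply Derive_ext_loc, filter_imp with (2 := locally_time T t Ht HtT).
        intros s [Hs HsT]. now apply Hzt. }
      assert (Bout := bernoulli_exterior_trace p T u1 u2 (fun _ _ => 0) t (proj1 He) Hreg Hne
                        Ht0 HtT (fun _ _ => eq_refl)).
      assert (Hhi : hi_of p (Z t) <> 0) by (generalize (Hhpos t Ht0 HtT); unfold hi_of; lra).
      assert (Bin := bernoulli_interior_trace p zi (q_int Z) (P_int p u1 u2 Z) t (A t) (C t)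
                       (b t) ((hi_of p (Z t) - 1) / eps p) (b t) (Derive b t) (hi_of p (Z t))
                       HR Hhi).
      rewrite Hzt, Hztt in Bout by assumption.
      rewrite (proj2 (proj1 (Htr t Ht0 HtT))), (proj2 (proj2 (Htr t Ht0 HtT))) in Bout.
      eapply no_jump_intro.
      * eapply filterlim_at_right_ext; [| exact Bout].
        intros y Hy.
        change (bernoulli p u1 u2 (fun _ _ => 0) t y
                = bernoulli p (glue (Rad p) zi u1) (glue (Rad p) (q_int Z) u2)
                    (glue (Rad p) (P_int p u1 u2 Z) (fun _ _ => 0)) t y).
        apply bernoulli_ext; [intros s |  |]; now rewrite glue_out.
      * match goal with |- filterlim _ _ (locally ?l) =>
          replace l with (C t + (hi_of p (Z t) - 1) / eps p + nu p * b t
             + kappa p ^ 2 * Derive b t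
             + eps p / 2 * ((Rad p / 2 * b t) ^ 2 / hi_of p (Z t) ^ 2)) end.
        2: { unfold C, b. change (1 + eps p * Z3 (Z t)) with (he_of p (Z t)).
             assert (H2 := Hhe t Ht0 HtT). field. repeat split; trivial; lra. }
        eapply (filterlim_at_left_ext 0); [exact HR | | apply Bin].
        -- intros y Hy.
           change (bernoulli p zi (q_int Z) (P_int p u1 u2 Z) t y
                   = bernoulli p (glue (Rad p) zi u1) (glue (Rad p) (q_int Z) u2)
                       (glue (Rad p) (P_int p u1 u2 Z) (fun _ _ => 0)) t y).
           apply bernoulli_ext; [intros s |  |]; now rewrite glue_in.
        -- intros r Hr. destruct (Hkin t r Ht HtT Hr) as [B1 [B2 _]].
           split; [now apply HP | split; [| split; [exact B1 | split; [exact B2 | split]]]].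
           ++ unfold zi, zeta_int, hi_of. field. lra.
           ++ reflexivity.
           ++ apply Hzh.
    + intros theta. apply no_jump_intro with 0.
      * apply filterlim_at_right_ext with (f := fun _ => 0); [| apply filterlim_const].
        intros y _. unfold Rdiv. ring.
      * apply filterlim_at_left_ext with (a := 0) (f := fun _ => 0);
          [exact HR | intros y _; unfold Rdiv; ring | apply filterlim_const].
Qed.

Theorem theorem1p1 (p : params) (T : Rbar) (F_ext : R -> R)
  (Hp : standing_params p) (HT : Rbar_lt 0 T) (HF : standing_force T F_ext) :
  (* Direct part *)
  (forall (zeta q P : R -> R -> R) (delta : R -> R),
     regular_exterior p T zeta q ->
     continuous_on_time T delta -> continuous_on_time T (Dt delta) ->
     exterior_nonvanishing p T zeta ->
     interior_nonvanishing p T zeta ->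
     0 < eps p * delta 0 + hieq p ->
     (forall r, 0 < r < Rad p ->
        ex_derive (q 0) r /\ dr (q 0) r = - Dt delta 0) ->
     BA_solution p T zeta q P delta ->
     newton p T F_ext delta (Dt delta) P ->
     transmission p T zeta q P ->
     augmented p T F_ext (zeta 0) (q 0) (dt zeta 0) (delta 0) (Dt delta 0)
       zeta q
       (fun t => Vec4 (delta t) (Dt delta t)
                      (lim_right (Rad p) (zeta t)) (lim_right (Rad p) (dt zeta t))))
  /\
  (* Converse part *)
  (forall (zeta0 q0 zetadot0 : R -> R) (delta0 deltadot0 : R)
          (u1 u2 : R -> R -> R) (Z : R -> vec4),
     regular_exterior p T u1 u2 ->
     exterior_nonvanishing p T u1 ->
     interior_nonvanishing p T (fun t _ => zeta_int p Z t) ->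
     0 < eps p * delta0 + hieq p ->
     augmented p T F_ext zeta0 q0 zetadot0 delta0 deltadot0 u1 u2 Z ->
     newton p T F_ext (fun t => Z1 (Z t)) (fun t => Z2 (Z t)) (P_int p u1 u2 Z) /\
     BA_solution p T
       (glue (Rad p) (fun t _ => zeta_int p Z t) u1)
       (glue (Rad p) (q_int Z) u2)
       (glue (Rad p) (P_int p u1 u2 Z) (fun _ _ => 0))
       (fun t => Z1 (Z t)) /\
     transmission p T
       (glue (Rad p) (fun t _ => zeta_int p Z t) u1)
       (glue (Rad p) (q_int Z) u2)
       (glue (Rad p) (P_int p u1 u2 Z) (fun _ _ => 0))).
Proof.
  split.
  - intros zeta q P delta Hreg Hcd Hcdd Hne Hni Hh0 _ HBA HN Htr.
    now apply (direct_part p T F_ext zeta q P delta Hp HT).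
  - intros zeta0 q0 zetadot0 delta0 deltadot0 u1 u2 Z Hreg Hne Hni Hh0 Haug.
    now apply (converse_part p T F_ext zeta0 q0 zetadot0 delta0 deltadot0).
Qed.
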